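(* Let $A$ be a cooperad and $P$ an operad (in dg vector spaces over $k$). There is a one-one correspondence between elements $\phi\in(\hat{\pmb{\oplus}}_SP^A)^1$ that satisfy the Maurer-Cartan equation $\frac12[\phi,\phi]+d(\phi)=0$ and dg operad morphisms $\tilde\phi:B^*(A)\to P$ from the cobar construction of $A$ to $P$.
   Context: Let $k$ be a field of characteristic $0$. Vector spaces are $\mathbb{Z}$-graded, differentials have degree $+1$, the Koszul sign convention is used, and the shift is $V[p]^n=V^{n-p}$. A collection is a contravariant functor from finite pointed sets and basepoint-preserving bijections to dg vector spaces; with $\mathbf n=\{0,\dots,n\}$ pointed by $0$, $C(n)=C(\mathbf n)$ is a right $S_n$-module. Operads are taken to be augmented and cooperads coaugmented, and they are identified throughout with their (co)augmentation (co)ideals, i.e. with pseudo operads (equivariant associative partial compositions $\circ_x$, no unit) and pseudo cooperads (the dual notion, with partial decompositions $\circ_x^*$). Cobar construction. $T(C)$ denotes the free pseudo operad on a collection $C$: $T(C)(X)=\bigoplus_t\big(\bigotimes_{v}C(\mathbf l(v))\big)_{\mathrm{Aut}(t)}$, the sum over isomorphism classes of rooted trees $t$ with legs labelled by the pointed set $X$, where $v$ runs over the vertices of $t$ and $\mathbf l(v)$ is the set of half-edges at $v$, pointed towards the root. For a cooperad $A$, $B^*A=(T(A[1]),\partial)$, where $\partial$ is the derivation of degree $+1$ with $\partial^2=0$ whose restriction to $A[1]$ is the sum of the internal differential and the map into two-vertex trees given by the partial decompositions of $A$. Convolution operad. $P^A(X)=\mathrm{Hom}_k(A(X),P(X))$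 (graded Hom), with action $(\phi\sigma)(a)=\phi(a\sigma^{-1})\sigma$, differential the graded commutator $d\phi=d_P\circ\phi-(-1)^{|\phi|}\phi\circ d_A$, and compositions $\phi\circ_x\psi=(\circ_x)_P\circ(\phi\otimes\psi)\circ(\circ_x^* )_A$. Lie algebra of an operad. For an operad $R$, $\bigoplus_nR(n)$ is a dg Lie algebra under the graded commutator of $p\circ q=\sum_{i=1}^np\circ_iq$ ($p\in R(n)$), and this descends to $\pmb{\oplus}_SR=\bigoplus_nR(n)_{S_n}$ (coinvariants) and extends to its completion $\hat{\pmb{\oplus}}_SR=\prod_nR(n)_{S_n}$. The superscript $1$ denotes the part of internal degree $1$. The correspondence in question is induced by restricting an operad morphism $T(A[1])\to P$ to the generators $A[1]$ (a morphism of graded collections of degree $0$, i.e. a family of $S_n$-equivariant maps $f_n:A(n)\to P(n)$ of degree $1$) and identifying $S_n$-invariants of $P^A(n)$ with coinvariants by means of symmetrization. *)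

(* Defs.v *)
From HB Require Import structures.
From mathcomp Require Import all_boot all_order perm all_algebra zify.
From mathcomp Require Import finmap boolp.
From mathcomp Require Import monalg.

Set Implicit Arguments.
Unset Strict Implicit.
Unset Printing Implicit Defensive.

Import GRing.Theory.
Local Open Scope ring_scope.
Local Open Scope quotient_scope.

Section Quotients.
Variables (k : fieldType) (V : lmodType k).

Inductive span (R : V -> Prop) : V -> Prop :=
| span_gen u : R u -> span R u
| span_zero : span R 0
| span_lin a u v : span R u -> span R v -> span R (a *: u + v).

Variable R : V -> Prop.

Definition spanb : {pred V} := fun v => `[< span R v >].

Lemma spanb_zmod : zmod_closed spanb.
Proof.
split; first by apply/asboolP; exact: span_zero.
move=> u v /asboolP hu /asboolP hv; apply/asboolP.
by rewrite addrC -scaleN1r; exact: span_lin.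
Qed.

HB.instance Definition _ := GRing.isZmodClosed.Build V spanb spanb_zmod.

Definition qmod : Type := Quotient.quot spanb.

HB.instance Definition _ := GRing.Zmodule.on qmod.
HB.instance Definition _ := EqQuotient.on qmod.

Lemma qmod_eq (u v : V) : (\pi_qmod u = \pi_qmod v) <-> span R (u - v).
Proof.
have E : (\pi_qmod u == \pi_qmod v) = (u - v \in spanb).
  by rewrite (Quotient.idealrBE (spanb : zmodClosed V)).
split; first by move/eqP; rewrite E => /asboolP.
by move=> h; apply/eqP; rewrite E; apply/asboolP.
Qed.

Definition qscale (a : k) (x : qmod) : qmod := \pi_qmod (a *: repr x).

Lemma pi_qscale a v : qscale a (\pi_qmod v) = \pi_qmod (a *: v).
Proof.
apply/qmod_eq; rewrite -scalerBr -[X in span _ X]addr0.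
by apply: span_lin; [apply/qmod_eq; rewrite reprK | exact: span_zero].
Qed.

Lemma pi_qadd u v : \pi_qmod (u + v) = \pi_qmod u + \pi_qmod v.
Proof. exact: (@Quotient.pi_add V (GRing.ZmodClosed.clone V spanb _) u v). Qed.

Lemma qscaleA a b x : qscale a (qscale b x) = qscale (a * b) x.
Proof. by elim/quotW: x => u; rewrite (pi_qscale b) !pi_qscale scalerA. Qed.

Lemma qscale1 : left_id 1 qscale.
Proof. by elim/quotW=> u; rewrite pi_qscale scale1r. Qed.

Lemma qscaleDr : right_distributive qscale +%R.
Proof.
move=> a; elim/quotW=> u; elim/quotW=> v.
by rewrite -pi_qadd !pi_qscale -pi_qadd scalerDr.
Qed.

Lemma qscaleDl x : {morph qscale^~ x : a b / a + b}.
Proof. by elim/quotW: x => u a b; rewrite !pi_qscale -pi_qadd scalerDl. Qed.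

HB.instance Definition _ :=
  GRing.Zmodule_isLmodule.Build k qmod qscaleA qscale1 qscaleDr qscaleDl.

Lemma pi_qmod_linear : linear (\pi_qmod : V -> qmod).
Proof. by move=> a u v; rewrite pi_qadd -pi_qscale. Qed.

End Quotients.

Notation free_mod k M := {malg k[{classic M}]}.

Section Presentations.
Variables (k : fieldType) (M : Type).

Definition fgen (m : M) : free_mod k M := mkmalgU (m : {classic M}) 1.

Variable R : free_mod k M -> Prop.

Definition pres : lmodType k := qmod R.
Definition pgen (m : M) : pres := \pi_(qmod R) (fgen m).

(* plift f is the linear extension of f to pres when free_lift f kills R: the
   choice of the representative is then irrelevant, see plift_gen and
   plift_linear. *)
Definition free_lift (E : lmodType k) (f : M -> E) (u : free_mod k M) : E :=
  \sum_(m <- msupp u) mcoeff m u *: f m.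
Definition plift (E : lmodType k) (f : M -> E) (x : pres) : E :=
  free_lift f (repr (x : qmod R)).

Section Lift.
Variables (E : lmodType k) (f : M -> E).

Lemma free_liftE (d : {fset {classic M}}) (u : free_mod k M) :
  (msupp u `<=` d)%fset ->
  free_lift f u = \sum_(m <- d) mcoeff m u *: f m.
Proof.
move=> hd; rewrite /free_lift; apply: big_fset_incl => // m _ /mcoeff_outdom ->.
by rewrite scale0r.
Qed.

Lemma free_lift_linear : linear (free_lift f).
Proof.
move=> a u v; pose d := (msupp (a *: u + v) `|` (msupp u `|` msupp v))%fset.
rewrite (@free_liftE d) ?fsubsetUl // (@free_liftE d u); last first.
  by apply: fsubset_trans (fsubsetUr _ _); exact: fsubsetUl.
rewrite (@free_liftE d v); last first.
  by apply: fsubset_trans (fsubsetUr _ _); exact: fsubsetUr.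
rewrite scaler_sumr -big_split /=; apply: eq_bigr => m _.
by rewrite mcoeffD mcoeffZ scalerDl scalerA.
Qed.

Lemma free_lift_gen m : free_lift f (fgen m) = f m.
Proof.
rewrite (@free_liftE [fset (m : {classic M})]%fset) ?msuppU_le //.
by rewrite big_seq_fset1 mcoeffU eqxx scale1r.
Qed.

Hypothesis fR : forall u, R u -> free_lift f u = 0.

Lemma free_lift_span u : span R u -> free_lift f u = 0.
Proof.
elim=> [? /fR //||a v w _ hv _ hw].
  by rewrite /free_lift msupp0 big_seq_fset0.
by rewrite free_lift_linear hv hw scaler0 addr0.
Qed.

Lemma plift_pi u : plift f (\pi_(qmod R) u : pres) = free_lift f u.
Proof.
rewrite /plift; set v := repr _; apply/subr0_eq.
rewrite addrC -scaleN1r -free_lift_linear; apply: free_lift_span.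
by rewrite scaleN1r addrC; apply/qmod_eq; rewrite reprK.
Qed.

Lemma plift_linear : linear (plift f).
Proof.
move=> a x y.
have E1 : a *: x + y = \pi_(qmod R) (a *: repr (x : qmod R) + repr (y : qmod R)).
  by rewrite pi_qmod_linear !reprK.
by rewrite [LHS]/plift -/pres E1 -[LHS]/(plift f _) plift_pi free_lift_linear.
Qed.

Lemma plift_gen m : plift f (pgen m) = f m.
Proof. by rewrite plift_pi free_lift_gen. Qed.

End Lift.
End Presentations.

Section Graded.
Variable k : fieldType.

Definition gspace := int -> lmodType k.

Definition ksign (i : int) : k := (-1) ^+ `|i|%N.

(* Degrees are related by propositional equalities rather than computed in
   types: an operation of degree p is a family of maps V i -> W j indexed by
   the proofs of i + p = j. *)
Definition gcast (V : gspace) i j (e : i = j) (v : V i) : V j := ecast n (V n) e v.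

(* Generators of a graded tensor product: tensors of homogeneous vectors. *)
Record tgen2 (V W : gspace) (n : int) := Tgen2 {
  t2i : int; t2j : int; t2e : t2i + t2j = n;
  t2v : V t2i; t2w : W t2j }.
Arguments Tgen2 {V W n i j} e v w : rename.

Inductive trel2 (V W : gspace) n : free_mod k (tgen2 V W n) -> Prop :=
| Trel2l i j (e : i + j = n) a (v v' : V i) (w : W j) :
    trel2 (fgen k (Tgen2 e (a *: v + v') w)
           - (a *: fgen k (Tgen2 e v w) + fgen k (Tgen2 e v' w)))
| Trel2r i j (e : i + j = n) a (v : V i) (w w' : W j) :
    trel2 (fgen k (Tgen2 e v (a *: w + w'))
           - (a *: fgen k (Tgen2 e v w) + fgen k (Tgen2 e v w'))).

Definition tens2 (V W : gspace) : gspace := fun n => pres (@trel2 V W n).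
Definition pure2 (V W : gspace) n i j (e : i + j = n) (v : V i) (w : W j) :
  tens2 V W n := pgen _ (Tgen2 e v w).

Record tgen3 (U V W : gspace) (n : int) := Tgen3 {
  t3i : int; t3j : int; t3l : int; t3e : t3i + t3j + t3l = n;
  t3u : U t3i; t3v : V t3j; t3w : W t3l }.
Arguments Tgen3 {U V W n i j l} e u v w : rename.

Inductive trel3 (U V W : gspace) n : free_mod k (tgen3 U V W n) -> Prop :=
| Trel3l i j l (e : i + j + l = n) a (u u' : U i) (v : V j) (w : W l) :
    trel3 (fgen k (Tgen3 e (a *: u + u') v w)
           - (a *: fgen k (Tgen3 e u v w) + fgen k (Tgen3 e u' v w)))
| Trel3m i j l (e : i + j + l = n) a (u : U i) (v v' : V j) (w : W l) :
    trel3 (fgen k (Tgen3 e u (a *: v + v') w)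
           - (a *: fgen k (Tgen3 e u v w) + fgen k (Tgen3 e u v' w)))
| Trel3r i j l (e : i + j + l = n) a (u : U i) (v : V j) (w w' : W l) :
    trel3 (fgen k (Tgen3 e u v (a *: w + w'))
           - (a *: fgen k (Tgen3 e u v w) + fgen k (Tgen3 e u v w'))).

Definition tens3 (U V W : gspace) : gspace := fun n => pres (@trel3 U V W n).
Definition pure3 (U V W : gspace) n i j l (e : i + j + l = n)
  (u : U i) (v : V j) (w : W l) : tens3 U V W n := pgen _ (Tgen3 e u v w).

Lemma plift2_linear (V W : gspace) n (E : lmodType k) (f : tgen2 V W n -> E) :
  (forall i j (e : i + j = n) (w : W j), linear (fun v : V i => f (Tgen2 e v w))) ->
  (forall i j (e : i + j = n) (v : V i), linear (fun w : W j => f (Tgen2 e v w))) ->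
  linear (plift f : tens2 V W n -> E).
Proof.
move=> fl fr; apply: plift_linear => _ [i j e a v v' w|i j e a v w w'].
  rewrite addrC -scaleN1r !(@free_lift_linear _ _ _ f) !free_lift_gen fl.
  by rewrite scaleN1r addNr.
rewrite addrC -scaleN1r !(@free_lift_linear _ _ _ f) !free_lift_gen fr.
by rewrite scaleN1r addNr.
Qed.

Record ghom (V W : gspace) (p : int) := Ghom {
  ghom_fun :> forall i j, i + p = j -> V i -> W j;
  ghom_linear : forall i j (e : i + p = j), linear (ghom_fun e) }.

Section GhomModule.
Variables (V W : gspace) (p : int).
Implicit Types f g : ghom V W p.

Lemma ghomP f g : (forall i j (e : i + p = j) v, f i j e v = g i j e v) -> f = g.
Proof.
case: f g => [f fl] [g gl] /= h.
have E : f = g.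
  by do 3![apply: functional_extensionality_dep => ?]; apply/funext => v; exact: h.
by case: _ / E gl => gl; congr Ghom; exact: Prop_irrelevance.
Qed.

HB.instance Definition _ := gen_eqMixin (ghom V W p).
HB.instance Definition _ := gen_choiceMixin (ghom V W p).

Lemma ghom_zero_linear i j (e : i + p = j) : linear (fun _ : V i => 0 : W j).
Proof. by move=> a u v; rewrite scaler0 addr0. Qed.
Definition ghom_zero : ghom V W p := Ghom ghom_zero_linear.

Lemma ghom_add_linear f g i j (e : i + p = j) :
  linear (fun v : V i => f i j e v + g i j e v).
Proof. by move=> a u v; rewrite !ghom_linear scalerDr addrACA. Qed.
Definition ghom_add f g : ghom V W p := Ghom (@ghom_add_linear f g).

Lemma ghom_scale_linear b f i j (e : i + p = j) :
  linear (fun v : V i => b *: f i j e v).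
Proof. by move=> a u v; rewrite ghom_linear scalerDr !scalerA mulrC. Qed.
Definition ghom_scale b f : ghom V W p := Ghom (@ghom_scale_linear b f).

Definition ghom_opp f := ghom_scale (-1) f.

Lemma ghom_addA : associative ghom_add.
Proof. by move=> f g h; apply: ghomP => *; rewrite /= addrA. Qed.
Lemma ghom_addC : commutative ghom_add.
Proof. by move=> f g; apply: ghomP => *; rewrite /= addrC. Qed.
Lemma ghom_add0 : left_id ghom_zero ghom_add.
Proof. by move=> f; apply: ghomP => *; rewrite /= add0r. Qed.
Lemma ghom_addN : left_inverse ghom_zero ghom_opp ghom_add.
Proof. by move=> f; apply: ghomP => *; rewrite /= scaleN1r addNr. Qed.

HB.instance Definition _ :=
  GRing.isZmodule.Build (ghom V W p) ghom_addA ghom_addC ghom_add0 ghom_addN.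

Lemma ghom_scaleA a b f : ghom_scale a (ghom_scale b f) = ghom_scale (a * b) f.
Proof. by apply: ghomP => *; rewrite /= scalerA. Qed.
Lemma ghom_scale1 : left_id 1 ghom_scale.
Proof. by move=> f; apply: ghomP => *; rewrite /= scale1r. Qed.
Lemma ghom_scaleDr : right_distributive ghom_scale +%R.
Proof. by move=> a f g; apply: ghomP => *; rewrite /= scalerDr. Qed.
Lemma ghom_scaleDl f : {morph ghom_scale^~ f : a b / a + b}.
Proof. by move=> a b; apply: ghomP => *; rewrite /= scalerDl. Qed.

HB.instance Definition _ := GRing.Zmodule_isLmodule.Build k (ghom V W p)
  ghom_scaleA ghom_scale1 ghom_scaleDr ghom_scaleDl.

End GhomModule.
End Graded.

Arguments Tgen2 {k V W n i j} e v w : rename.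
Arguments Tgen3 {k U V W n i j l} e u v w : rename.

Lemma deg_assoc2 (i1 i2 j i n : int) : i1 + i2 = i -> i + j = n -> i1 + i2 + j = n.
Proof. by move=> -> ->. Qed.
Lemma deg_assoc3 (i j1 j2 j n : int) : j1 + j2 = j -> i + j = n -> i + j1 + j2 = n.
Proof. by move=> <- <-; rewrite addrA. Qed.
Lemma deg_swap (i1 i2 j i n : int) : i1 + i2 = i -> i + j = n -> i1 + j + i2 = n.
Proof. by move=> <- <-; rewrite addrAC. Qed.
Lemma deg_succl (i j n m p : int) : i + j = n -> n + p = m -> i + p + j = m.
Proof. by move=> <- <-; rewrite addrAC. Qed.
Lemma deg_succr (i j n m p : int) : i + j = n -> n + p = m -> i + (j + p) = m.
Proof. by move=> <- <-; rewrite addrA. Qed.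
Lemma deg_pair (i j p q r n m : int) :
  i + j = n -> p + q = r -> n + r = m -> i + p + (j + q) = m.
Proof. by move=> <- <- <-; rewrite addrACA. Qed.
Lemma deg_next (i p q j : int) : p + 1 = q -> i + q = j -> i + p + 1 = j.
Proof. by move=> <- <-; rewrite addrA. Qed.
Lemma deg_prev (i p q j : int) : p + 1 = q -> i + q = j -> i + 1 + p = j.
Proof. by move=> <- <-; rewrite addrAC addrA. Qed.
Lemma deg_shift (p n m : int) : n + 1 = m -> n - p + 1 = m - p.
Proof. by move=> <-; rewrite addrAC. Qed.
Lemma deg_susp (i j n m : int) : i + j = n - 1 -> n + 1 = m -> i + 1 + (j + 1) = m.
Proof. by move=> h <-; rewrite addrACA h addrA subrK. Qed.

(* A finite pointed set is given by the finite type X of its elements other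
   than the base point; basepoint-preserving bijections are then the bijections
   between these types.  The pointed set {0, ..., n}, pointed by 0, is given
   by 'I_n. *)

Record bij (X Y : Type) := Bij {
  bfun :> X -> Y; binv : Y -> X; bfunK : cancel bfun binv; binvK : cancel binv bfun }.

Definition bij_id X : bij X X := @Bij X X id id (fun=> erefl) (fun=> erefl).
Definition bij_comp X Y Z (f : bij Y Z) (e : bij X Y) : bij X Z :=
  Bij (can_comp (bfunK f) (bfunK e)) (can_comp (binvK e) (binvK f)).
Definition bij_inv X Y (e : bij X Y) : bij Y X := Bij (binvK e) (bfunK e).
Definition bij_perm (X : finType) (s : {perm X}) : bij X X := Bij (permK s) (permKV s).

Section BijOfInj.
Variables (X Y : finType) (f : X -> Y).
Hypotheses (fI : injective f) (cXY : (#|Y| <= #|X|)%N).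
Let f_onto y : y \in codom f. Proof. exact: inj_card_onto. Qed.
Lemma bij_of_injK : cancel f (fun y => iinv (f_onto y)).
Proof. by move=> x; apply: fI; rewrite f_iinv. Qed.
Lemma bij_of_injVK : cancel (fun y => iinv (f_onto y)) f.
Proof. by move=> y; rewrite f_iinv. Qed.
Definition bij_of_inj : bij X Y := Bij bij_of_injK bij_of_injVK.
End BijOfInj.

(* The base point of Y is glued to x, and the base point is that of X. *)
Definition ins (X : finType) (x : X) (Y : finType) : finType :=
  ({a : X | a != x} + Y)%type.

Definition insl (X : finType) (x : X) (Y : finType) (a : X) (h : a != x) : ins x Y :=
  inl (exist _ a h).
Definition insr (X : finType) (x : X) (Y : finType) (y : Y) : ins x Y := inr y.
Arguments insl {X x} Y {a} h.
Arguments insr {X} x {Y} y.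

Lemma sval_neq (X : finType) (x : X) (u v : {a : X | a != x}) :
  sval u = sval v -> u = v.
Proof. exact: val_inj. Qed.

Section BijIns.
Variables (X X' Y Y' : finType) (e : bij X X') (f : bij Y Y') (x : X).
Lemma bij_neq a : a != x -> e a != e x.
Proof. by apply: contra_neq => /(can_inj (bfunK e)). Qed.
Lemma binv_neq b : b != e x -> binv e b != x.
Proof. by apply: contra_neq => <-; rewrite binvK. Qed.
Definition bij_ins_fun (u : ins x Y) : ins (e x) Y' :=
  match u with
  | inl a => insl Y' (bij_neq (svalP a))
  | inr y => insr (e x) (f y)
  end.
Definition bij_ins_inv (u : ins (e x) Y') : ins x Y :=
  match u with
  | inl b => insl Y (binv_neq (svalP b))
  | inr y => insr x (binv f y)
  end.
Lemma bij_ins_funK : cancel bij_ins_fun bij_ins_inv.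
Proof.
case=> [a|y] /=; last by rewrite bfunK.
by congr inl; apply: sval_neq; rewrite /= bfunK.
Qed.
Lemma bij_ins_invK : cancel bij_ins_inv bij_ins_fun.
Proof.
case=> [a|y] /=; last by rewrite binvK.
by congr inl; apply: sval_neq; rewrite /= binvK.
Qed.
Definition bij_ins : bij (ins x Y) (ins (e x) Y') := Bij bij_ins_funK bij_ins_invK.
End BijIns.

(* (X o_x Y) o_y Z = X o_x (Y o_y Z) *)
Section BijSeq.
Variables (X Y Z : finType) (x : X) (y : Y).
Let L : finType := ins (insr x y) Z.
Let R : finType := ins x (ins y Z).
Definition bij_seq_fun (u : L) : R :=
  match u with
  | inl (exist (inl a) _) => inl a
  | inl (exist (inr b) h) => insr x (insl Z (h : b != y))
  | inr z => insr x (insr y z)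
  end.
Definition bij_seq_inv (u : R) : L :=
  match u with
  | inl a => @insl _ (insr x y) Z (inl a) isT
  | inr (inl b) => @insl _ (insr x y) Z (inr (sval b)) (svalP b)
  | inr (inr z) => insr (insr x y) z
  end.
Lemma bij_seq_funK : cancel bij_seq_fun bij_seq_inv.
Proof. by case=> [[[a|b] h]|z] //=; congr inl; exact: sval_neq. Qed.
Lemma bij_seq_invK : cancel bij_seq_inv bij_seq_fun.
Proof. by case=> [a|[b|z]] //=; congr (inr (inl _)); exact: sval_neq. Qed.
Definition bij_seq : bij L R := Bij bij_seq_funK bij_seq_invK.
End BijSeq.

(* (X o_x Y) o_x' Z = (X o_x' Z) o_x Y  for x <> x' *)
Section BijPar.
Variables (X : finType) (x x' : X).
Definition bij_par_fun (h : x' != x) (h' : x != x') (Y Z : finType)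
    (u : ins (insl Y h) Z) : ins (insl Z h') Y :=
  match u with
  | inl (exist (inl a) q) => @insl _ (insl Z h') Y (inl (exist _ (sval a) q)) (svalP a)
  | inl (exist (inr y) _) => insr (insl Z h') y
  | inr z => @insl _ (insl Z h') Y (inr z) isT
  end.
End BijPar.
Arguments bij_par_fun {X x x'} h h' {Y Z} u.

Lemma bij_par_funK (X : finType) (x x' : X) (h : x' != x) (h' : x != x') (Y Z : finType) :
  cancel (@bij_par_fun X x x' h h' Y Z) (@bij_par_fun X x' x h' h Z Y).
Proof.
case=> [[[a|y] q]|z] //=; congr inl; apply: sval_neq => //=.
by congr inl; exact: sval_neq.
Qed.

Definition bij_par (X : finType) (x x' : X) (h : x' != x) (h' : x != x') (Y Z : finType) :
    bij (ins (insl Y h) Z) (ins (insl Z h') Y) :=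
  Bij (@bij_par_funK X x x' h h' Y Z) (@bij_par_funK X x' x h' h Z Y).

Lemma card_ins (X Y : finType) (x : X) : #|ins x Y| = (#|X|.-1 + #|Y|)%N.
Proof. by rewrite card_sum card_sig (cardC1 x). Qed.

(* The usual numbering of {0, ..., m+1} o_i {0, ..., n}: the inputs of the second
   factor are inserted at the place of i.  Here i : 'I_m.+1 counts from 0. *)
Section BijOrd.
Variables (m n N : nat) (e : (m + n)%N = N) (i : 'I_m.+1).
Definition ord_ins_val (u : ins i 'I_n) : nat :=
  match u with
  | inl j => if (sval j < i)%N then (sval j : nat) else (sval j + n).-1
  | inr l => (i + l)%N
  end.
Lemma ord_ins_lt u : (ord_ins_val u < N)%N.
Proof.
case: u => [[j ji]|l] /=; last by have := ltn_ord i; have := ltn_ord l; lia.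
have {}ji : (j : nat) != i by [].
by have := ltn_ord j; have := ltn_ord i; case: ifP; lia.
Qed.
Definition ord_ins (u : ins i 'I_n) : 'I_N := Ordinal (ord_ins_lt u).
Lemma ord_ins_inj : injective ord_ins.
Proof.
move=> [[j ji]|l] [[j' ji']|l'] /(congr1 val) /= E.
- have ji0 : (j : nat) != i by [].
  have ji0' : (j' : nat) != i by [].
  congr inl; apply/sval_neq/val_inj => /=.
  by move: E; case: ifP; case: ifP; lia.
- have ji0 : (j : nat) != i by [].
  by move: E; have := ltn_ord l'; case: ifP; lia.
- have ji0' : (j' : nat) != i by [].
  by move: E; have := ltn_ord l; case: ifP; lia.
by congr inr; apply: val_inj => /=; lia.
Qed.
Lemma ord_ins_card : (#|'I_N| <= #|ins i 'I_n|)%N.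
Proof. by rewrite card_ins !card_ord -e. Qed.
Definition bij_ord : bij (ins i 'I_n) 'I_N := bij_of_inj ord_ins_inj ord_ins_card.
End BijOrd.

Section BijCut.
Variables (Z : finType) (S : {set Z}).
(* A tree with two vertices and legs Z is determined by the set S of the legs at
   its upper vertex; None is the inner edge. *)
Definition cut_low : finType := option {z : Z | z \notin S}.
Definition cut_up : finType := {z : Z | z \in S}.
Definition cut_low_val (o : cut_low) : o != None -> Z :=
  match o with
  | Some z => fun=> sval z
  | None => fun h => False_rect Z (negP h (eqxx None))
  end.
Definition cut_fun (u : ins (None : cut_low) cut_up) : Z :=
  match u with
  | inl a => cut_low_val (svalP a)
  | inr z => sval z
  end.
Lemma cut_inj : injective cut_fun.
Proof.
move=> [[[z|] h]|z] [[[z'|] h']|z'] //= E.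
- by congr inl; apply: sval_neq => /=; congr Some; apply: val_inj.
- by have := svalP z; rewrite E (svalP z').
- by have := svalP z'; rewrite -E (svalP z).
- by congr inr; apply: val_inj.
Qed.
Lemma cut_card : (#|Z| <= #|ins (None : cut_low) cut_up|)%N.
Proof.
rewrite card_ins card_option !card_sig /= addnC.
by rewrite -(cardC [in S]).
Qed.
Definition bij_cut : bij (ins (None : cut_low) cut_up) Z := bij_of_inj cut_inj cut_card.
End BijCut.

Section Operads.
Variable k : fieldType.

(* The functoriality is contravariant: for a permutation s, act s c is c.s *)
Record coldata := ColData {
  car :> finType -> gspace k;
  act : forall (X Y : finType), bij X Y -> forall i, car Y i -> car X i;
  dif : forall X i j, i + 1 = j -> car X i -> car X j }.
Arguments act _ {X Y} e {i} c.
Arguments dif _ {X i j} e c.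

Record is_collection (C : coldata) : Prop := IsCollection {
  act_linear : forall (X Y : finType) (e : bij X Y) i, linear (act C e : C Y i -> C X i);
  act_id : forall X i (c : C X i), act C (bij_id X) c = c;
  act_comp : forall (X Y Z : finType) (f : bij Y Z) (e : bij X Y) i (c : C Z i),
    act C (bij_comp f e) c = act C e (act C f c);
  dif_linear : forall X i j (h : i + 1 = j), linear (dif C h : C X i -> C X j);
  dif_dif : forall X i j l (h : i + 1 = j) (h' : j + 1 = l) (c : C X i),
    dif C h' (dif C h c) = 0;
  dif_act : forall (X Y : finType) (e : bij X Y) i j (h : i + 1 = j) (c : C Y i),
    dif C h (act C e c) = act C e (dif C h c) }.

(* Operads have no unit, and cooperads no counit: they stand for augmentation
   ideals and coaugmentation coideals. *)
Record opdata := OpData {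
  op_col :> coldata;
  circ : forall (X Y : finType) (x : X) i j n, i + j = n ->
    op_col X i -> op_col Y j -> op_col (ins x Y) n }.
Arguments circ _ {X Y} x {i j n} e p q.

Record is_operad (P : opdata) : Prop := IsOperad {
  op_collection : is_collection P;
  circ_linearl : forall (X Y : finType) (x : X) i j n (h : i + j = n) (q : P Y j),
    linear (fun p : P X i => circ P x h p q);
  circ_linearr : forall (X Y : finType) (x : X) i j n (h : i + j = n) (p : P X i),
    linear (fun q : P Y j => circ P x h p q);
  circ_act : forall (X X' Y Y' : finType) (e : bij X X') (f : bij Y Y') (x : X)
      i j n (h : i + j = n) (p : P X' i) (q : P Y' j),
    act P (bij_ins e f x) (circ P (e x) h p q) = circ P x h (act P e p) (act P f q);
  circ_seq : forall (X Y Z : finType) (x : X) (y : Y) i j l ij jl n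
      (h1 : i + j = ij) (h2 : ij + l = n) (h3 : j + l = jl) (h4 : i + jl = n)
      (p : P X i) (q : P Y j) (r : P Z l),
    circ P (insr x y) h2 (circ P x h1 p q) r =
    act P (bij_seq Z x y) (circ P x h4 p (circ P y h3 q r));
  circ_par : forall (X Y Z : finType) (x x' : X) (e : x' != x) (e' : x != x')
      i j l ij il n
      (h1 : i + j = ij) (h2 : ij + l = n) (h3 : i + l = il) (h4 : il + j = n)
      (p : P X i) (q : P Y j) (r : P Z l),
    circ P (insl Y e) h2 (circ P x h1 p q) r =
    ksign k (j * l) *:
      act P (bij_par e e' Y Z) (circ P (insl Z e') h4 (circ P x' h3 p r) q);
  dif_circ : forall (X Y : finType) (x : X) i j n i' j' m (h : i + j = n) (hi : i + 1 = i')
      (hj : j + 1 = j') (hn : n + 1 = m) (hl : i' + j = m) (hr : i + j' = m)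
      (p : P X i) (q : P Y j),
    dif P hn (circ P x h p q) =
    circ P x hl (dif P hi p) q + ksign k i *: circ P x hr p (dif P hj q) }.

Record operad := Operad {
  operad_data :> opdata;
  operadP : is_operad operad_data }.

Record coopdata := CoopData {
  coop_col :> coldata;
  cocirc : forall (X Y : finType) (x : X) n,
    coop_col (ins x Y) n -> tens2 (coop_col X) (coop_col Y) n }.
Arguments cocirc _ {X Y} x {n} a.

Section Coassoc.
Variable A : coopdata.

Definition tens2_act (X X' Y Y' : finType) (e : bij X X') (f : bij Y Y') n :
    tens2 (A X') (A Y') n -> tens2 (A X) (A Y) n :=
  plift (fun g => pure2 (t2e g) (act A e (t2v g)) (act A f (t2w g))).

Definition tens2_dif (X Y : finType) n m (h : n + 1 = m) :
    tens2 (A X) (A Y) n -> tens2 (A X) (A Y) m :=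
  plift (fun g =>
    pure2 (deg_succl (t2e g) h) (dif A erefl (t2v g)) (t2w g) +
    ksign k (t2i g) *:
      pure2 (deg_succr (t2e g) h) (t2v g) (dif A erefl (t2w g))).

(* (o_x^* (x) id) o o_u^* *)
Definition cocirc_left (X Y Z : finType) (x : X) (u : ins x Y) n
    (a : A (ins u Z) n) : tens3 (A X) (A Y) (A Z) n :=
  plift (fun g : tgen2 (A (ins x Y)) (A Z) n =>
    plift (fun g' : tgen2 (A X) (A Y) (t2i g) =>
      pure3 (deg_assoc2 (t2e g') (t2e g)) (t2v g') (t2w g') (t2w g))
    (cocirc A x (t2v g))) (cocirc A u a).

(* (id (x) o_y^* ) o o_x^* *)
Definition cocirc_right (X Y Z : finType) (x : X) (y : Y) n
    (a : A (ins x (ins y Z)) n) : tens3 (A X) (A Y) (A Z) n :=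
  plift (fun g : tgen2 (A X) (A (ins y Z)) n =>
    plift (fun g' : tgen2 (A Y) (A Z) (t2j g) =>
      pure3 (deg_assoc3 (t2e g') (t2e g)) (t2v g) (t2v g') (t2w g'))
    (cocirc A y (t2w g))) (cocirc A x a).

(* The exchange of the last two factors, with its Koszul sign. *)
Definition tens3_swap (X Y Z : finType) n (t : tens3 (A X) (A Z) (A Y) n) :
    tens3 (A X) (A Y) (A Z) n :=
  plift (fun g : tgen3 (A X) (A Z) (A Y) n =>
    ksign k (t3j g * t3l g) *:
      pure3 (etrans (addrAC _ _ _) (t3e g)) (t3u g) (t3w g) (t3v g)) t.

End Coassoc.

Record is_cooperad (A : coopdata) : Prop := IsCooperad {
  coop_collection : is_collection A;
  cocirc_linear : forall (X Y : finType) (x : X) n,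
    linear (cocirc A x : A (ins x Y) n -> tens2 (A X) (A Y) n);
  cocirc_act : forall (X X' Y Y' : finType) (e : bij X X') (f : bij Y Y') (x : X) n
      (a : A (ins (e x) Y') n),
    cocirc A x (act A (bij_ins e f x) a) = tens2_act e f (cocirc A (e x) a);
  cocirc_seq : forall (X Y Z : finType) (x : X) (y : Y) n
      (a : A (ins x (ins y Z)) n),
    cocirc_left (act A (bij_seq Z x y) a) = cocirc_right a;
  cocirc_par : forall (X Y Z : finType) (x x' : X) (e : x' != x) (e' : x != x') n
      (a : A (ins (insl Z e') Y) n),
    cocirc_left (act A (bij_par e e' Y Z) a) = tens3_swap (cocirc_left a);
  cocirc_dif : forall (X Y : finType) (x : X) n m (h : n + 1 = m)
      (a : A (ins x Y) n),
    cocirc A x (dif A h a) = tens2_dif h (cocirc A x a) }.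

Record cooperad := Cooperad {
  cooperad_data :> coopdata;
  cooperadP : is_cooperad cooperad_data }.

Record ophom (Q P : opdata) := OpHom {
  oh_fun :> forall X i, Q X i -> P X i;
  oh_linear : forall X i, linear (@oh_fun X i);
  oh_act : forall (X Y : finType) (e : bij X Y) i (c : Q Y i),
    oh_fun (act Q e c) = act P e (oh_fun c);
  oh_circ : forall (X Y : finType) (x : X) i j n (h : i + j = n) (p : Q X i) (q : Q Y j),
    oh_fun (circ Q x h p q) = circ P x h (oh_fun p) (oh_fun q);
  oh_dif : forall X i j (h : i + 1 = j) (c : Q X i),
    oh_fun (dif Q h c) = dif P h (oh_fun c) }.

Section Convolution.
Variables (A : cooperad) (P : operad).

Definition conv_car (X : finType) : gspace k := ghom (A X) (P X).

Section ConvAct.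
Variables (X Y : finType) (e : bij X Y) (p : int) (phi : conv_car Y p).
Definition conv_act_fun i j (h : i + p = j) (a : A X i) : P X j :=
  act P e (phi i j h (act A (bij_inv e) a)).
Lemma conv_act_linear i j (h : i + p = j) : linear (conv_act_fun h).
Proof.
move=> a u v; rewrite /conv_act_fun (act_linear (coop_collection (cooperadP A))).
by rewrite ghom_linear (act_linear (op_collection (operadP P))).
Qed.
Definition conv_act : conv_car X p := Ghom conv_act_linear.
End ConvAct.

Section ConvDif.
Variables (X : finType) (p q : int) (e : p + 1 = q) (phi : conv_car X p).
Definition conv_dif_fun i j (h : i + q = j) (a : A X i) : P X j :=
  dif P (deg_next e h) (phi i (i + p) erefl a) -
  ksign k p *: phi (i + 1) j (deg_prev e h) (dif A erefl a).
Lemma conv_dif_linear i j (h : i + q = j) : linear (conv_dif_fun h).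
Proof.
move=> a u v; rewrite /conv_dif_fun (dif_linear (coop_collection (cooperadP A))).
rewrite !ghom_linear (dif_linear (op_collection (operadP P))).
by rewrite scalerDr scalerBr opprD addrACA !scalerA mulrC.
Qed.
Definition conv_dif : conv_car X q := Ghom conv_dif_linear.
End ConvDif.

Section ConvCirc.
Variables (X Y : finType) (x : X) (p q r : int) (e : p + q = r).
Variables (phi : conv_car X p) (psi : conv_car Y q).
(* (phi (x) psi) (a (x) b) = (-1)^(|psi| |a|) phi a (x) psi b *)
Definition conv_circ_fun i j (h : i + r = j) (a : A (ins x Y) i) : P (ins x Y) j :=
  plift (fun g : tgen2 (A X) (A Y) i =>
    ksign k (q * t2i g) *:
      circ P x (deg_pair (t2e g) e h) (phi _ _ erefl (t2v g)) (psi _ _ erefl (t2w g)))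
    (cocirc A x a).
Lemma conv_circ_linear i j (h : i + r = j) : linear (conv_circ_fun h).
Proof.
move=> a u v; rewrite /conv_circ_fun (cocirc_linear (cooperadP A)).
apply: plift2_linear => [i1 i2 h' w b s t|i1 i2 h' w b s t] /=.
  rewrite ghom_linear (circ_linearl (operadP P)) scalerDr !scalerA.
  by rewrite [_ * b]mulrC.
rewrite ghom_linear (circ_linearr (operadP P)) scalerDr !scalerA.
by rewrite [_ * b]mulrC.
Qed.
Definition conv_circ : conv_car (ins x Y) r := Ghom conv_circ_linear.
End ConvCirc.

Definition convolution : opdata :=
  @OpData (@ColData conv_car conv_act conv_dif) conv_circ.

End Convolution.

Section Lie.
Variable R : opdata.

Inductive coinv_rel n p : R 'I_n p -> Prop :=
| CoinvRel (s : {perm 'I_n}) (u : R 'I_n p) :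
    coinv_rel (u - act R (bij_perm s) u).
Definition coinv (n : nat) (p : int) : lmodType k := qmod (@coinv_rel n p).

Definition chat (p : int) : Type := forall n, coinv n p.

(* When R is an operad, the operations below descend from the R(n) to their
   coinvariants, so that they may be computed on any representatives. *)

Definition ord_circ m n N (e : (m + n)%N = N) (i : 'I_m.+1) p q r (h : p + q = r)
    (u : R 'I_m.+1 p) (v : R 'I_n q) : R 'I_N r :=
  act R (bij_inv (bij_ord e i)) (circ R i h u v).

(* The component in R(N)_{S_N} of phi o psi; there is no contribution of the
   component of phi in R(0). *)
Definition prelie p q r (h : p + q = r) (phi : chat p) (psi : chat q) : chat r :=
  fun N => \sum_(m < N.+1) \pi_(qmod (@coinv_rel N r))
    (\sum_(i < m.+1) ord_circ (subnKC (ltnSE (ltn_ord m))) i h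
       (repr (phi m.+1 : qmod _)) (repr (psi (N - m)%N : qmod _))).

Definition lie_bracket p q r (h : p + q = r) (phi : chat p) (psi : chat q) : chat r :=
  fun N => prelie h phi psi N -
           ksign k (p * q) *: prelie (etrans (addrC q p) h) psi phi N.

Definition lie_dif p q (h : p + 1 = q) (phi : chat p) : chat q :=
  fun N => \pi_(qmod (@coinv_rel N q)) (dif R h (repr (phi N : qmod _))).

Definition maurer_cartan (phi : chat 1) : Prop :=
  forall N, 2%:R^-1 *: lie_bracket (erefl : 1 + 1 = 2) phi phi N +
            lie_dif (erefl : 1 + 1 = 2) phi N = 0.

(* The sum is not divided by n!: it is for this normalization that the
   Maurer-Cartan equation in coinvariants, where each o_i occurs once, matches
   the cobar differential, where each tree with two vertices occurs once. *)
Definition symmetrize n p (c : coinv n p) : R 'I_n p :=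
  \sum_(s : {perm 'I_n}) act R (bij_perm s) (repr (c : qmod _)).

End Lie.
End Operads.

Arguments act {k} C {X Y} e {i} c : rename.
Arguments dif {k} C {X i j} e c : rename.
Arguments circ {k} P {X Y} x {i j n} e p q : rename.
Arguments cocirc {k} A {X Y} x {n} a : rename.

(* A rooted tree with legs labelled by X: the vertices are numbered, and so are
   the input half-edges of each vertex v, so that l(v) is {0, ..., ar v}, the
   base point being the half-edge at v towards the root.  An input half-edge i
   of v is either the leg with a label in X or is glued to the output
   half-edge of another vertex; this is glue v i.  The output half-edge of
   the root vertex is the root of the tree. *)
Record tree (X : finType) := Tree {
  nv : nat;
  ar : 'I_nv -> nat;
  root : 'I_nv;
  glue : forall v, 'I_(ar v) -> X + 'I_nv;
  glue_inj : forall v i w j, @glue v i = @glue w j ->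
    existT (fun v => 'I_(ar v)) v i = existT (fun v => 'I_(ar v)) w j;
  glue_img : forall y : X + 'I_nv, (exists v i, @glue v i = y) <-> y <> inr root;
  glue_reach : forall v,
    connect (fun u w => [exists i, @glue u i == inr w]) root v }.
Arguments glue {X} t v i : rename.
Arguments ar {X} t v : rename.

Section TreeOperations.

Definition sum_map (A B C D : Type) (f : A -> C) (g : B -> D) (u : A + B) : C + D :=
  match u with inl a => inl (f a) | inr b => inr (g b) end.

Lemma sum_map_can (A B C D : Type) (f : A -> C) (g : B -> D) f' g' :
  cancel f f' -> cancel g g' -> cancel (sum_map f g) (sum_map f' g').
Proof. by move=> fK gK [a|b] /=; rewrite ?fK ?gK. Qed.

Section Relabel.
Variables (X Y : finType) (e : bij X Y) (t : tree Y).
Definition relabel_glue v (i : 'I_(ar t v)) : X + 'I_(nv t) :=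
  sum_map (binv e) id (glue t v i).
Let K : cancel (sum_map (binv e) (@id 'I_(nv t))) (sum_map e id).
Proof. exact: sum_map_can (binvK e) (fun=> erefl). Qed.
Let K' : cancel (sum_map e (@id 'I_(nv t))) (sum_map (binv e) id).
Proof. exact: sum_map_can (bfunK e) (fun=> erefl). Qed.
Lemma relabel_inj v i w j : @relabel_glue v i = @relabel_glue w j ->
  existT (fun v => 'I_(ar t v)) v i = existT (fun v => 'I_(ar t v)) w j.
Proof. by move=> /(can_inj K) /glue_inj. Qed.
Lemma relabel_img (y : X + 'I_(nv t)) :
  (exists v i, @relabel_glue v i = y) <-> y <> inr (root t).
Proof.
rewrite -[y]K'; split=> [[v [i /(can_inj K) E]] /(congr1 (sum_map e id))|h].
  by rewrite K /= => E'; apply: (proj1 (glue_img (sum_map e id y))) E'; exists v, i.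
have /glue_img [v [i E]] : sum_map e id y <> inr (root t).
  by move=> E; apply: h; rewrite E.
by exists v, i; rewrite /relabel_glue E.
Qed.
Lemma relabel_reach v :
  connect (fun u w => [exists i, @relabel_glue u i == inr w]) (root t) v.
Proof.
have := glue_reach v; congr (is_true (connect _ _ _)).
apply/funext => u; apply/funext => w; apply: eq_existsb => i.
by rewrite /relabel_glue; case: (glue t u i).
Qed.
Definition relabel : tree X := Tree relabel_inj relabel_img relabel_reach.
End Relabel.

Section Corolla.
Variable X : finType.
Definition bij_enum : bij 'I_#|X| X := Bij (@enum_valK X) (@enum_rankK X).
Definition cor_glue (v : 'I_1) (i : 'I_#|X|) : X + 'I_1 := inl (enum_val i).
Lemma cor_inj v i w j : cor_glue v i = cor_glue w j ->
  existT (fun _ : 'I_1 => 'I_#|X|) v i = existT (fun _ : 'I_1 => 'I_#|X|) w j.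
Proof. by case=> /enum_val_inj ->; rewrite (ord1 v) (ord1 w). Qed.
Lemma cor_img (y : X + 'I_1) : (exists v i, cor_glue v i = y) <-> y <> inr ord0.
Proof.
split=> [[v [i <-]] //|]; case: y => [x _|v]; last by rewrite (ord1 v).
by exists ord0, (enum_rank x); rewrite /cor_glue enum_rankK.
Qed.
Lemma cor_reach v : connect (fun u w => [exists i, cor_glue u i == inr w]) ord0 v.
Proof. by rewrite (ord1 v) connect0. Qed.
Definition cor_tree : tree X :=
  @Tree X 1 (fun=> #|X|) ord0 cor_glue cor_inj cor_img cor_reach.
End Corolla.

(* Grafting the root of s onto the leg x of t; the vertices of t are numbered
   before those of s. *)
Section Graft.
Variables (X Y : finType) (x : X) (t : tree X) (s : tree Y).
Let N := (nv t + nv s)%N.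

Definition graft_ar' (v : 'I_(nv t) + 'I_(nv s)) : nat :=
  match v with inl v => ar t v | inr v => ar s v end.
Definition graft_ar (v : 'I_N) : nat := graft_ar' (split v).

Definition graft_left (u : X + 'I_(nv t)) : ins x Y + 'I_N :=
  match u with
  | inl a => match boolP (a != x) with
             | AltTrue h => inl (insl Y h)
             | AltFalse _ => inr (rshift (nv t) (root s))
             end
  | inr w => inr (lshift (nv s) w)
  end.
Definition graft_right (u : Y + 'I_(nv s)) : ins x Y + 'I_N :=
  match u with
  | inl b => inl (insr x b)
  | inr w => inr (rshift (nv t) w)
  end.
Definition graft_glue' (v : 'I_(nv t) + 'I_(nv s)) : 'I_(graft_ar' v) -> ins x Y + 'I_N :=
  match v with
  | inl v => fun i => graft_left (glue t v i)
  | inr v => fun i => graft_right (glue s v i)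
  end.
Definition graft_glue (v : 'I_N) (i : 'I_(graft_ar v)) : ins x Y + 'I_N :=
  graft_glue' i.
Definition graft_root : 'I_N := lshift (nv s) (root t).

Lemma graft_left_inj : injective graft_left.
Proof.
have F (a b : X) : ~~ (a != x) -> ~~ (b != x) -> a = b.
  by rewrite !negbK => /eqP -> /eqP ->.
move=> [a|w] [b|w'] /=.
- case: {-}_ / (boolP (a != x)) => ha; case: {-}_ / (boolP (b != x)) => hb //.
    by case=> ->.
  by move=> _; rewrite (F a b).
- case: {-}_ / (boolP (a != x)) => // ha [] E.
  by have := ltn_ord w'; rewrite -E; lia.
- case: {-}_ / (boolP (b != x)) => // hb [] E.
  by have := ltn_ord w; rewrite E; lia.
by case=> E; congr inr; apply: val_inj.
Qed.

Lemma graft_right_inj : injective graft_right.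
Proof.
move=> [a|w] [b|w'] //= []; first by move=> ->.
by move=> E; congr inr; apply: val_inj => /=; lia.
Qed.

Lemma graft_left_right u w : w <> inr (root s) -> graft_left u <> graft_right w.
Proof.
case: u => [a|u]; case: w => [b|w] //= hw.
- by case: {-}_ / (boolP (a != x)).
- case: {-}_ / (boolP (a != x)) => // _ [] E.
  by apply: hw; congr inr; apply: val_inj => /=; lia.
- by case=> E; have := ltn_ord u; rewrite E; lia.
Qed.

Lemma graft_glue'_inj v i w j : @graft_glue' v i = @graft_glue' w j ->
  existT (fun v => 'I_(graft_ar' v)) v i = existT (fun v => 'I_(graft_ar' v)) w j.
Proof.
have nr v' (i' : 'I_(ar s v')) : glue s v' i' <> inr (root s).
  by apply/glue_img; exists v', i'.
case: v i => v i; case: w j => w j /=.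
- move=> /graft_left_inj /glue_inj E.
  exact: (congr1 (fun u : {v & 'I_(ar t v)} =>
    existT (fun v => 'I_(graft_ar' v)) (inl (projT1 u)) (projT2 u : 'I_(graft_ar' (inl (projT1 u))))) E).
- by move=> /graft_left_right; case.
- by move=> /esym /graft_left_right; case.
- move=> /graft_right_inj /glue_inj E.
  exact: (congr1 (fun u : {v & 'I_(ar s v)} =>
    existT (fun v => 'I_(graft_ar' v)) (inr (projT1 u)) (projT2 u : 'I_(graft_ar' (inr (projT1 u))))) E).
Qed.

Lemma graft_inj v i w j : @graft_glue v i = @graft_glue w j ->
  existT (fun v => 'I_(graft_ar v)) v i = existT (fun v => 'I_(graft_ar v)) w j.
Proof.
move=> /graft_glue'_inj E.
have vw : v = w by apply: (can_inj splitK); exact: (congr1 (@projT1 _ _) E).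
case: w / vw j E => j E.
by have -> : i = j by exact: (@eq_from_Tagged _ (fun v => 'I_(graft_ar' v)) _ _ _ E).
Qed.

Lemma graft_glueP v (i : 'I_(graft_ar' v)) :
  exists i', @graft_glue (unsplit v) i' = graft_glue' i.
Proof.
suff h v' : v' = v -> exists i' : 'I_(graft_ar' v'), graft_glue' i' = graft_glue' i.
  exact: h (unsplitK v).
by move=> ->; exists i.
Qed.

Lemma graft_left_img a : a <> inr (root t) -> exists v i, @graft_glue v i = graft_left a.
Proof.
move=> /glue_img [v [i <-]]; have [i' E] := @graft_glueP (inl v) i.
by exists (unsplit (inl v)), i'.
Qed.
Lemma graft_right_img b : b <> inr (root s) -> exists v i, @graft_glue v i = graft_right b.
Proof.
move=> /glue_img [v [i <-]]; have [i' E] := @graft_glueP (inr v) i.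
by exists (unsplit (inr v)), i'.
Qed.

Lemma graft_leftx : graft_left (inl x) = inr (rshift (nv t) (root s)).
Proof. by rewrite /=; case: {-}_ / (boolP (x != x)) => // h; have := h; rewrite eqxx. Qed.

Lemma graft_img (y : ins x Y + 'I_N) :
  (exists v i, @graft_glue v i = y) <-> y <> inr graft_root.
Proof.
split=> [[v [i <-]]|].
  rewrite /graft_glue; move: i; rewrite /graft_ar; case: (split v) => {}v i /=.
    have := proj1 (glue_img (glue t v i)) (ex_intro _ v (ex_intro _ i erefl)).
    by move=> h /(@graft_left_inj _ (inr (root t))).
  case: (glue s v i) => // w [] E.
  by have := ltn_ord (root t); rewrite -E; lia.
case: y => [[[a h]|b]|w] hy.
- have [v [i E]] := @graft_left_img (inl a) ltac:(by []).
  exists v, i; rewrite E /=; case: {-}_ / (boolP (a != x)) => [h'|]; last by rewrite h.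
  by congr (inl (inl _)); apply: val_inj.
- exact: (@graft_right_img (inl b)).
- case: (split w) (splitK w) => u E; rewrite -E /=.
    apply: (@graft_left_img (inr u)) => -[ur].
    by apply: hy; rewrite -E ur.
  have [->|ne] := eqVneq u (root s); last first.
    by apply: (@graft_right_img (inr u)) => -[ur]; rewrite ur eqxx in ne.
  by rewrite -graft_leftx; apply: graft_left_img.
Qed.

Lemma connect_map (T T' : finType) (r : rel T) (r' : rel T') (f : T -> T') :
  (forall u v, r u v -> connect r' (f u) (f v)) ->
  forall u v, connect r u v -> connect r' (f u) (f v).
Proof.
move=> h u v /connectP [p]; elim: p u => [|w p IH] u /= => [_ ->|/andP[uw pw] E].
  exact: connect0.
exact: connect_trans (h _ _ uw) (IH _ pw E).
Qed.

Let r : rel 'I_N := fun u w => [exists i, @graft_glue u i == inr w].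

Lemma graft_edge v (i : 'I_(graft_ar' v)) w : graft_glue' i = inr w ->
  connect r (unsplit v) w.
Proof.
have [i' <-] := graft_glueP i => E; apply: connect1.
by apply/existsP; exists i'; rewrite E.
Qed.

Lemma graft_reach v : connect r graft_root v.
Proof.
have ht u : connect r graft_root (lshift (nv s) u).
  apply: (connect_map _ (glue_reach u)) => {}u w /existsP[i /eqP E].
  by apply: (@graft_edge (inl u) i); rewrite /= E.
have hs u : connect r (rshift (nv t) (root s)) (rshift (nv t) u).
  apply: (connect_map _ (glue_reach u)) => {}u w /existsP[i /eqP E].
  by apply: (@graft_edge (inr u) i); rewrite /= E.
have hts : connect r graft_root (rshift (nv t) (root s)).
  have /glue_img [u [i E]] : inl x <> inr (root t) :> X + 'I_(nv t) by [].
  apply: connect_trans (ht u) _; apply: (@graft_edge (inl u) i).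
  by rewrite /= E graft_leftx.
rewrite -(splitK v); case: (split v) => u /=; first exact: ht.
exact: connect_trans hts (hs u).
Qed.

Definition graft : tree (ins x Y) :=
  Tree graft_inj graft_img graft_reach.
End Graft.

End TreeOperations.

Section FreeOperad.
Variables (k : fieldType) (C : coldata k).

Record tree_iso (X : finType) (t t' : tree X) := TreeIso {
  iso_v :> bij 'I_(nv t) 'I_(nv t');
  iso_h : forall v, bij 'I_(ar t v) 'I_(ar t' (iso_v v));
  iso_root : iso_v (root t) = root t';
  iso_glue : forall v i,
    glue t' (iso_v v) (iso_h v i) = sum_map id iso_v (glue t v i) }.

(* A tree with vertices decorated by homogeneous elements of C; it stands for the
   tensor product of the dec v in the order of the vertices. *)
Record dtree (X : finType) (n : int) := DTree {
  dt : tree X;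
  deg : 'I_(nv dt) -> int;
  dec : forall v, C 'I_(ar dt v) (deg v);
  deg_sum : \sum_v deg v = n }.

Definition iso_sign (X : finType) (t t' : tree X) (s : tree_iso t t')
    (d : 'I_(nv t') -> int) : k :=
  \prod_(u < nv t) \prod_(v < nv t | (u < v)%N && (s v < s u)%N) ksign k (d (s u) * d (s v)).

(* Multilinearity in the decorations, and identification of decorated trees
   along isomorphisms; the latter accounts both for the sum over isomorphism
   classes and for the coinvariants under automorphisms. *)
Inductive tree_rel (X : finType) n : free_mod k (dtree X n) -> Prop :=
| TreeRelLin (t : tree X) (d : 'I_(nv t) -> int) (e : \sum_v d v = n)
    (c c1 c2 : forall v, C 'I_(ar t v) (d v)) (v : 'I_(nv t)) a :
    (forall w, w != v -> c w = c1 w /\ c w = c2 w) ->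
    c v = a *: c1 v + c2 v ->
    tree_rel (fgen k (DTree c e) - (a *: fgen k (DTree c1 e) + fgen k (DTree c2 e)))
| TreeRelIso (t t' : tree X) (s : tree_iso t t') (d : 'I_(nv t') -> int)
    (c : forall v, C 'I_(ar t' v) (d v))
    (e : \sum_v d (s v) = n) (e' : \sum_v d v = n) :
    tree_rel (fgen k (@DTree X n t (fun v => d (s v))
                        (fun v => act C (iso_h s v) (c (s v))) e)
              - iso_sign s d *: fgen k (DTree c e')).

Definition free_car (X : finType) : gspace k := fun n => pres (@tree_rel X n).

Definition corolla_dt (X : finType) n (c : C X n) : dtree X n :=
  @DTree X n (cor_tree X) (fun=> n) (fun=> act C (bij_enum X) c)
    (big_ord1 _ (fun=> n)).
Definition corolla (X : finType) n (c : C X n) : free_car X n :=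
  pgen _ (corolla_dt c).

Definition relabel_dt (X Y : finType) (e : bij X Y) n (D : dtree Y n) : dtree X n :=
  @DTree X n (relabel e (dt D)) (@deg Y n D) (@dec Y n D) (deg_sum D).
Definition free_act (X Y : finType) (e : bij X Y) n (u : free_car Y n) : free_car X n :=
  plift (fun D => pgen _ (relabel_dt e D) : free_car X n) u.

Section GraftDecorated.
Variables (X Y : finType) (x : X) (i j n : int) (h : i + j = n).
Variables (D : dtree X i) (E : dtree Y j).
Definition graft_deg' (v : 'I_(nv (dt D)) + 'I_(nv (dt E))) : int :=
  match v with inl v => deg v | inr v => deg v end.
Definition graft_dec' (v : 'I_(nv (dt D)) + 'I_(nv (dt E))) :
    C 'I_(graft_ar' v) (graft_deg' v) :=
  match v with inl v => dec v | inr v => dec v end.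
Lemma graft_deg_sum : \sum_(v < nv (dt D) + nv (dt E)) graft_deg' (split v) = n.
Proof.
rewrite big_split_ord -h; congr (_ + _).
  by rewrite -[RHS](deg_sum D); apply: eq_bigr => v _; rewrite (unsplitK (inl v)).
by rewrite -[RHS](deg_sum E); apply: eq_bigr => v _; rewrite (unsplitK (inr v)).
Qed.
Definition graft_dt : dtree (ins x Y) n :=
  @DTree (ins x Y) n (graft x (dt D) (dt E)) (fun v => graft_deg' (split v))
    (fun v => graft_dec' (split v)) graft_deg_sum.
End GraftDecorated.

Definition free_circ (X Y : finType) (x : X) i j n (h : i + j = n)
    (p : free_car X i) (q : free_car Y j) : free_car (ins x Y) n :=
  plift (fun D => plift (fun E => pgen _ (graft_dt x h D E) : free_car (ins x Y) n) q) p.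

End FreeOperad.

Section Cobar.
Variable k : fieldType.

Definition shift (p : int) (C : coldata k) : coldata k :=
  @ColData k (fun X n => C X (n - p))
    (fun X Y e n c => act C e (c : C Y (n - p)))
    (fun X n m h c => ksign k p *: dif C (deg_shift p h) (c : C X (n - p))).

Variable A : cooperad k.

Definition susp (X : finType) i (a : A X i) : shift 1 A X (i + 1) :=
  gcast (esym (addrK 1 i)) a.

(* With s : A -> A[1] the suspension, which has degree 1, this is the sum over
   the trees with two vertices of the images of s^-1 a under
   (s^-1 (x) s^-1)^-1 o (o_x^* ): a term a' (x) a'' of the decomposition is sent
   to (-1)^(|a'| + 1) sa' (x) sa''. *)
Definition two_vertex (Z : finType) n m (h : n + 1 = m) (a : shift 1 A Z n) :
    free_car (shift 1 A) Z m :=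
  \sum_(S : {set Z})
    plift (fun g : tgen2 (A (cut_low S)) (A (cut_up S)) (n - 1) =>
      ksign k (t2i g + 1) *:
        free_act (bij_inv (bij_cut S))
          (free_circ (None : cut_low S) (deg_susp (t2e g) h)
            (corolla (susp (t2v g))) (corolla (susp (t2w g)))))
      (cocirc A (None : cut_low S) (act A (bij_cut S) (a : A Z (n - 1)))).

(* T(A[1]) is generated by corollas, so there is at most one such derivation. *)
Record cobar_dif := CobarDif {
  cd :> forall X i j, i + 1 = j ->
    free_car (shift 1 A) X i -> free_car (shift 1 A) X j;
  cd_linear : forall X i j (h : i + 1 = j), linear (@cd X i j h);
  cd_act : forall (X Y : finType) (e : bij X Y) i j (h : i + 1 = j)
      (c : free_car (shift 1 A) Y i),
    cd h (free_act e c) = free_act e (cd h c);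
  cd_circ : forall (X Y : finType) (x : X) i j n i' j' m (h : i + j = n)
      (hi : i + 1 = i') (hj : j + 1 = j') (hn : n + 1 = m)
      (hl : i' + j = m) (hr : i + j' = m)
      (p : free_car (shift 1 A) X i) (q : free_car (shift 1 A) Y j),
    cd hn (free_circ x h p q) =
    free_circ x hl (cd hi p) q + ksign k i *: free_circ x hr p (cd hj q);
  cd_cd : forall X i j l (h : i + 1 = j) (h' : j + 1 = l)
      (c : free_car (shift 1 A) X i), cd h' (cd h c) = 0;
  cd_corolla : forall (X : finType) n m (h : n + 1 = m) (a : shift 1 A X n),
    cd h (corolla a) = corolla (dif (shift 1 A) h a) + two_vertex h a }.

Definition cobar (d : cobar_dif) : opdata k :=
  @OpData k (@ColData k (free_car (shift 1 A)) (@free_act k (shift 1 A)) d)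
    (@free_circ k (shift 1 A)).

End Cobar.

(* Main.v *)
(* A decorated tree is evaluated in an operad by visiting its vertices, each after its
   parent, and grafting their decorations one at a time onto the part already visited.
   Two such orders differ by exchanges of vertices with no path between them, so the
   parallel associativity axiom shows that the value depends on the order only through
   its Koszul sign; the sequential axiom shows that grafting trees composes the values.
   Hence equivariant maps f_n : A(n) -> P(n) of degree 1 extend uniquely to T(A[1]).
   The obstruction to commuting with the differentials is, on a corolla, the curvature
   d f + sum_S f o f, the sum over the trees with two vertices.  It is natural, since
   the extension and the cobar differential are, so it is enough to compute its class
   in coinvariants: for f the symmetrization of phi, there are C(N, n) two-vertex trees
   with n legs at the upper vertex, all of the same class, and the class of the curvature
   is N! times the Maurer-Cartan expression of phi. *)

Require Import Defs.
From mathcomp Require Import all_boot all_order fingroup perm all_algebra boolp zify ring.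
From mathcomp Require Import finmap monalg generic_quotient.
Set Implicit Arguments.
Unset Strict Implicit.
Unset Printing Implicit Defensive.
Import GRing.Theory.
Local Open Scope ring_scope.
Local Open Scope quotient_scope.

(** * Operads with labelled inputs *)

(** The operad axioms hold only along explicit bijections of inputs, and degrees agree only
    propositionally; both would pile up along a traversal. Elements are therefore paired with their
    degree, and each input carries as label the leg or the vertex to be glued there. Inputs are
    addressed by label, and composites are compared up to a label-preserving bijection and a sign.
    The labels met in a traversal stay injective, so this bijection is forced, and at the end the
    comparison becomes an equality.

    A [tree] is not inductive: it is glueing data with reachability from the root. Evaluation thus
    follows lists of vertices instead of structural recursion. The same traversal, run on corollas
    inside the free operad, rebuilds the tree up to isomorphism; this shows that corollas generate.

    Two signs conspire: the differential of A[1] is minus that of A, and the two-vertex term of the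
    cobar differential has an extra -1 against the composition of the convolution operad. Hence both
    terms of the curvature appear with sign + in the difference of the two differentials. *)

Lemma ksignD (k : fieldType) (i j : int) : ksign k (i + j) = ksign k i * ksign k j.
Proof.
rewrite /ksign -exprD -signr_odd -[RHS]signr_odd; congr (_ ^+ (nat_of_bool _)).
by lia.
Qed.

Lemma ksign_sq (k : fieldType) (i : int) : ksign k i * ksign k i = 1.
Proof. by rewrite /ksign -expr2 sqrr_sign. Qed.

Lemma ksignS (k : fieldType) (i : int) : ksign k (i + 1) = - ksign k i.
Proof. by rewrite ksignD mulrN1. Qed.

Lemma bij_ext (X Y : Type) (f g : bij X Y) : f =1 g -> f = g.
Proof.
case: f g => [f f' fK f'K] [g g' gK g'K] /= /funext E; subst g.
have E : f' = g' by apply/funext => y; rewrite -{1}[y]g'K fK.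
by subst g'; congr Bij; exact: Prop_irrelevance.
Qed.

Section LinearMaps.
Variables (k : fieldType) (V W : lmodType k) (f : V -> W).
Hypothesis fl : linear f.

Lemma lin0 : f 0 = 0.
Proof. by have := fl (-1) 0 0; rewrite addr0 scaler0 scaleN1r addNr. Qed.
Lemma linZ a u : f (a *: u) = a *: f u.
Proof. by have := fl a u 0; rewrite lin0 !addr0. Qed.
Lemma linD u v : f (u + v) = f u + f v.
Proof. by have := fl 1 u v; rewrite !scale1r. Qed.
Lemma linN u : f (- u) = - f u.
Proof. by rewrite -!scaleN1r linZ. Qed.
Lemma linB u v : f (u - v) = f u - f v.
Proof. by rewrite linD linN. Qed.
Lemma lin_sum (I : Type) (r : seq I) (P : pred I) (F : I -> V) :
  f (\sum_(i <- r | P i) F i) = \sum_(i <- r | P i) f (F i).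
Proof. by apply: big_morph; [exact: linD | exact: lin0]. Qed.
End LinearMaps.

Section TotalSpace.
Variable k : fieldType.

(* Homogeneous elements of unspecified degree: no cast between propositionally
   equal degrees is needed for them. *)
Definition tot (C : coldata k) (X : finType) := {i : int & C X i}.

Section Collection.
Variable C : coldata k.
Definition tact (X Y : finType) (e : bij X Y) (p : tot C Y) : tot C X :=
  existT _ (tag p) (act C e (tagged p)).
Definition tscale (X : finType) a (p : tot C X) : tot C X :=
  existT _ (tag p) (a *: tagged p).

Lemma tot_inj (X : finType) i (u v : C X i) :
  existT (fun i => C X i) i u = existT (fun i => C X i) i v -> u = v.
Proof. exact: (@eq_from_Tagged _ (fun i => C X i)). Qed.

Lemma tscaleA (X : finType) a b (p : tot C X) : tscale a (tscale b p) = tscale (a * b) p.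
Proof. by rewrite /tscale /= scalerA. Qed.
Lemma tscale1 (X : finType) (p : tot C X) : tscale 1 p = p.
Proof. by case: p => i p; rewrite /tscale /= scale1r. Qed.

Hypothesis HC : is_collection C.

Lemma actZ (X Y : finType) (e : bij X Y) i a (c : C Y i) : act C e (a *: c) = a *: act C e c.
Proof. exact: (linZ (act_linear HC e (i:=i)) a c). Qed.

Lemma tact_scale (X Y : finType) (e : bij X Y) a (p : tot C Y) :
  tact e (tscale a p) = tscale a (tact e p).
Proof. by rewrite /tact /tscale /= actZ. Qed.
Lemma tact_comp (X Y Z : finType) (f : bij Y Z) (e : bij X Y) (p : tot C Z) :
  tact e (tact f p) = tact (Defs.bij_comp f e) p.
Proof. by rewrite /tact /= (act_comp HC). Qed.
Lemma tact_id (X : finType) (p : tot C X) : tact (bij_id X) p = p.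
Proof. by case: p => i p; rewrite /tact /= (act_id HC). Qed.
End Collection.

Section TotalOperad.
Variable Q : opdata k.
Definition tcirc (X Y : finType) (x : X) (p : tot Q X) (q : tot Q Y) : tot Q (ins x Y) :=
  existT _ (tag p + tag q) (circ Q x erefl (tagged p) (tagged q)).

(** Pairing with the degree absorbs the proof [h], so that composites formed along different degree
    proofs can be rewritten into each other. *)
Lemma tcircE (X Y : finType) (x : X) i j n (h : i + j = n) (p : Q X i) (q : Q Y j) :
  existT (fun n => Q (ins x Y) n) n (circ Q x h p q) =
  tcirc x (existT (fun n => Q X n) i p) (existT (fun n => Q Y n) j q).
Proof. by case: n / h. Qed.

Hypothesis HQ : is_operad Q.

Lemma circZl (X Y : finType) (x : X) i j n (h : i + j = n) a (p : Q X i) (q : Q Y j) :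
  circ Q x h (a *: p) q = a *: circ Q x h p q.
Proof. exact: (linZ (circ_linearl HQ x h q) a p). Qed.
Lemma circZr (X Y : finType) (x : X) i j n (h : i + j = n) a (p : Q X i) (q : Q Y j) :
  circ Q x h p (a *: q) = a *: circ Q x h p q.
Proof. exact: (linZ (circ_linearr HQ x h p) a q). Qed.

Lemma tcirc_scale (X Y : finType) (x : X) a b (p : tot Q X) (q : tot Q Y) :
  tcirc x (tscale a p) (tscale b q) = tscale (a * b) (tcirc x p q).
Proof. by rewrite /tcirc /tscale /= circZl circZr scalerA. Qed.

Lemma tcirc_act (X X' Y Y' : finType) (e : bij X X') (f : bij Y Y') (x : X) p q :
  tact (bij_ins e f x) (tcirc (e x) p q) = tcirc x (tact e p) (tact f q).
Proof. by rewrite /tcirc /tact /= (circ_act HQ). Qed.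

Lemma tcirc_seq (X Y Z : finType) (x : X) (y : Y) p q (r : tot Q Z) :
  tcirc (insr x y) (tcirc x p q) r = tact (bij_seq Z x y) (tcirc x p (tcirc y q r)).
Proof.
case: p q r => i p [j q] [l r]; rewrite /tcirc /=.
rewrite (circ_seq HQ x y _ _ erefl (addrA _ _ _)) /tact /=.
by move: (_ + l) (addrA _ _ _) => n h; case: n / h.
Qed.

Lemma tcirc_par (X Y Z : finType) (x x' : X) (e : x' != x) (e' : x != x')
    p (q : tot Q Y) (r : tot Q Z) :
  tcirc (insl Y e) (tcirc x p q) r =
  tscale (ksign k (tag q * tag r))
    (tact (bij_par e e' Y Z) (tcirc (insl Z e') (tcirc x' p r) q)).
Proof.
case: p q r => i p [j q] [l r]; rewrite /tcirc /=.
rewrite (circ_par HQ e e' _ _ erefl (addrAC _ _ _)) /tact /tscale /=.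
by move: (_ + _ + l) (addrAC _ _ _) => n h; case: n / h.
Qed.
End TotalOperad.
End TotalSpace.

Section Labelled.
Variables (k : fieldType) (Q : opdata k).

(* An element of Q whose inputs are labelled in U.  Grafting along labels makes
   these into an operad in which the equivariance is hidden in lab_eq. *)
Record lab (U : Type) := Lab { lset : finType; label : lset -> U; elt : tot Q lset }.

Definition ins_label (U : Type) (Z Y : finType) (z : Z) (h : Z -> U) (g : Y -> U)
    (u : ins z Y) : U :=
  match u with inl a => h (sval a) | inr y => g y end.

Definition lab_map (U V : Type) (g : U -> V) (s : lab U) : lab V :=
  Lab (g \o label (l:=s)) (elt s).

Definition lab_circ_at (U : Type) (s : lab U) (z : lset s) (s' : lab U) : lab U :=
  Lab (@ins_label U _ _ z (label (l:=s)) (label (l:=s'))) (tcirc z (elt s) (elt s')).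

(** If no input is labelled [u], the default is [s] itself. Traversals graft only at labels that
    occur, and there injectivity makes the pick unambiguous. *)
Definition lab_circ (U : eqType) (s : lab U) (u : U) (s' : lab U) : lab U :=
  if [pick z | label z == u] is Some z then @lab_circ_at U s z s' else s.

(** The scalar is meant for a Koszul sign. When the labels are injective, at most one bijection [e]
    qualifies. *)
Definition lab_eq (U : Type) (a : k) (s s' : lab U) : Prop :=
  exists2 e : bij (lset s) (lset s'),
    forall z, label (e z) = label z & elt s = tscale a (tact e (elt s')).

Lemma lab_circE (U : eqType) (s s' : lab U) (z : lset s) :
  injective (label (l:=s)) -> lab_circ s (label z) s' = lab_circ_at z s'.
Proof.
rewrite /lab_circ => hI; case: pickP => [z' /eqP/hI -> //|/(_ z)].
by rewrite eqxx.
Qed.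

Lemma lab_circ_map (U V : eqType) (g : U -> V) (s s' : lab U) u :
  injective g -> lab_map g (lab_circ s u s') = lab_circ (lab_map g s) (g u) (lab_map g s').
Proof.
move=> gI; rewrite /lab_circ.
rewrite (@eq_pick _ (fun z => label (l:=lab_map g s) z == g u) (fun z => label (l:=s) z == u)).
  case: pickP => // z _; rewrite /lab_map /lab_circ_at /=; congr Lab.
  by apply/funext => -[].
by move=> z /=; rewrite (inj_eq gI).
Qed.

Lemma lab_eq_tag (U : Type) a (s s' : lab U) : lab_eq a s s' -> tag (elt s) = tag (elt s').
Proof. by case=> e _ ->. Qed.

Hypothesis HQ : is_operad Q.
Let HC : is_collection Q := op_collection HQ.

Lemma lab_eq_refl (U : Type) (s : lab U) : lab_eq 1 s s.
Proof.
by exists (bij_id _) => //; rewrite tscale1 tact_id.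
Qed.

Lemma lab_eq_trans (U : Type) a b (s1 s2 s3 : lab U) :
  lab_eq a s1 s2 -> lab_eq b s2 s3 -> lab_eq (a * b) s1 s3.
Proof.
move=> [e he E] [f hf F]; exists (Defs.bij_comp f e) => [z|] /=; first by rewrite hf he.
by rewrite E F tact_scale // tscaleA tact_comp.
Qed.

Lemma lab_eq_sym (U : Type) a (s s' : lab U) : a * a = 1 -> lab_eq a s s' -> lab_eq a s' s.
Proof.
move=> aa [e he E]; exists (bij_inv e) => [z|]; first by rewrite -he binvK.
rewrite E tact_scale // tact_comp // tscaleA aa tscale1.
by rewrite (_ : Defs.bij_comp _ _ = bij_id _) ?tact_id //; apply: bij_ext => z /=; rewrite binvK.
Qed.

Lemma lab_eq_inj (U : Type) a (s s' : lab U) :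
  lab_eq a s s' -> injective (label (l:=s)) -> injective (label (l:=s')).
Proof.
case=> e he _ hI z1 z2.
rewrite -[z1](binvK e) -[z2](binvK e) !he => /hI; exact: congr1.
Qed.

Lemma lab_eq_map (U V : Type) (g : U -> V) a (s s' : lab U) :
  lab_eq a s s' -> lab_eq a (lab_map g s) (lab_map g s').
Proof. by case=> e he E; exists e => // z /=; rewrite he. Qed.

Lemma lab_circ_eq (U : eqType) a b (s1 s1' s2 s2' : lab U) u :
  injective (label (l:=s1)) -> (exists z : lset s1, label z = u) ->
  lab_eq a s1 s1' -> lab_eq b s2 s2' ->
  lab_eq (a * b) (lab_circ s1 u s2) (lab_circ s1' u s2').
Proof.
move=> hI [z <-{u}] E; have hI' := lab_eq_inj E hI.
case: E => e he E [f hf F].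
rewrite lab_circE // -he lab_circE //; exists (bij_ins e f z) => [[[c hc]|y]|] //=.
by rewrite E F tcirc_scale // tcirc_act.
Qed.

(** The bijection of the sequential axiom preserves labels, so it disappears into [lab_eq]. The same
    happens for the parallel axiom below, of which only the Koszul sign remains visible. *)
Lemma lab_circ_seq (U : Type) (s s' s'' : lab U) (z : lset s) (y : lset s') :
  lab_eq 1 (@lab_circ_at _ (lab_circ_at z s') (insr z y) s'')
    (lab_circ_at z (lab_circ_at y s'')).
Proof.
exists (bij_seq _ z y); first by case=> [[[a|b] h]|c].
by rewrite tscale1; exact: tcirc_seq.
Qed.

Lemma lab_circ_par (U : Type) (s s' s'' : lab U) (z w : lset s) (e : w != z) (e' : z != w) :
  lab_eq (ksign k (tag (elt s') * tag (elt s'')))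
    (@lab_circ_at _ (lab_circ_at z s') (insl _ e) s'')
    (@lab_circ_at _ (lab_circ_at w s'') (insl _ e') s').
Proof.
exists (bij_par e e' _ _); first by case=> [[[a|b] h]|c].
exact: tcirc_par.
Qed.
End Labelled.

(** * Koszul signs of lists *)

Section PairProducts.
Variables (k : fieldType) (T : eqType).
Implicit Types (phi psi : T -> T -> k) (l : seq T).

Fixpoint pair_prod phi l : k :=
  if l is w :: l' then (\prod_(v <- l') phi w v) * pair_prod phi l' else 1.

Lemma pair_prodM phi psi l :
  pair_prod (fun u v => phi u v * psi u v) l = pair_prod phi l * pair_prod psi l.
Proof. by elim: l => [|w l IH] /=; rewrite ?mulr1 // IH big_split /= mulrACA. Qed.

Lemma eq_pair_prod phi psi l : uniq l ->
  {in l &, forall u v, u != v -> phi u v = psi u v} -> pair_prod phi l = pair_prod psi l.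
Proof.
elim: l => [//|w l IH] /= /andP[wl ul] E; congr (_ * _); last first.
  by apply: IH => // u v ul' vl; apply: E; rewrite inE ?ul' ?vl orbT.
rewrite big_seq [RHS]big_seq; apply: eq_bigr => v vl; apply: E; rewrite ?mem_head //.
  by rewrite inE vl orbT.
by apply: contraNneq wl => ->.
Qed.

Lemma prod_sq1 phi w l : (forall u v, phi u v * phi u v = 1) ->
  (\prod_(v <- l) phi w v) * (\prod_(v <- l) phi w v) = 1.
Proof. by move=> h; rewrite -big_split big1 // => v _; exact: h. Qed.

Lemma pair_prod_sq1 phi l : (forall u v, phi u v * phi u v = 1) ->
  pair_prod phi l * pair_prod phi l = 1.
Proof.
move=> h; elim: l => [|w l IH] /=; first by rewrite mulr1.
by rewrite mulrACA IH prod_sq1 ?mulr1.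
Qed.

(** Moving [w] in front of [l1] replaces each factor [phi b w] by [phi w b]; cross-multiplying
    avoids division. *)
Lemma pair_prod_front phi l1 w l2 :
  pair_prod phi (l1 ++ w :: l2) * \prod_(b <- l1) phi w b =
  pair_prod phi (w :: l1 ++ l2) * \prod_(b <- l1) phi b w.
Proof.
elim: l1 => [|b l1 IH] /=; first by rewrite !big_nil.
rewrite !big_cons !big_cat /= big_cons; move: IH; rewrite /= big_cat /=.
set D1 := \prod_(v <- l1) phi b v; set D2 := \prod_(v <- l2) phi b v => H.
set P := pair_prod phi (l1 ++ w :: l2) in H *; set A := \prod_(v <- l1) phi w v in H *.
transitivity (phi b w * phi w b * (D1 * D2) * (P * A)); first by ring.
by rewrite H; ring.
Qed.

Lemma pair_prod_perm phi l l' : (forall u v, phi u v = phi v u) ->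
  perm_eq l l' -> pair_prod phi l = pair_prod phi l'.
Proof.
move=> phiC; elim: l' l => [|w l' IH] l; first by move/perm_nilP ->.
move=> ll'; have wl : w \in l by rewrite (perm_mem ll') mem_head.
case/splitPr: wl ll' => l1 l2 ll'.
have E : perm_eq (l1 ++ l2) l'.
  by rewrite -(perm_cons w) -(permPr ll') perm_sym -cat1s perm_catCA.
rewrite /= -(IH _ E) -(perm_big _ E) /=.
elim: l1 {E ll'} => [//|b l1 IH1] /=.
rewrite IH1 !big_cons !big_cat /= big_cons phiC; ring.
Qed.

Lemma pair_prod_cat phi l1 l2 : {in l1 & l2, forall u v, phi u v = 1} ->
  pair_prod phi (l1 ++ l2) = pair_prod phi l1 * pair_prod phi l2.
Proof.
elim: l1 => [|w l1 IH] h /=; first by rewrite mul1r.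
rewrite IH => [|u v ul vl]; last by apply: h => //; rewrite inE ul orbT.
rewrite big_cat /= [X in _ * X * _](_ : _ = 1) ?mulr1 ?mulrA //.
by rewrite big_seq big1 // => v vl; apply: h => //; exact: mem_head.
Qed.
End PairProducts.

Lemma pair_prod_map (k : fieldType) (T T' : eqType) (g : T -> T') (phi : T' -> T' -> k) l :
  pair_prod phi (map g l) = pair_prod (fun u v => phi (g u) (g v)) l.
Proof. by elim: l => [//|w l IH] /=; rewrite IH big_map. Qed.

Lemma ltn_ord_trans N : transitive (fun u v : 'I_N => u < v)%N.
Proof. by move=> v u w; exact: ltn_trans. Qed.

Section Koszul.
Variables (k : fieldType) (N : nat).
Implicit Types (d : 'I_N -> int) (l : seq 'I_N).

(** Here [u] stands before [v] in a list, and only an inversion of the numbering contributes. The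
    product over all pairs, [list_sign], is the Koszul sign of rearranging a tensor product from the
    numerical order into the order of the list. *)
Definition swap_sign d (u v : 'I_N) : k :=
  if (v < u)%N then ksign k (d u * d v) else 1.
Definition list_sign d l : k := pair_prod (swap_sign d) l.

Lemma swap_sign_sq d u v : swap_sign d u v * swap_sign d u v = 1.
Proof. by rewrite /swap_sign; case: ifP; rewrite ?ksign_sq ?mulr1. Qed.
Lemma list_sign_sq d l : list_sign d l * list_sign d l = 1.
Proof. exact/pair_prod_sq1/swap_sign_sq. Qed.
Lemma list_sign_neq0 d l : list_sign d l != 0.
Proof.
by apply/eqP => E; have := list_sign_sq d l; rewrite E mulr0 => /esym/eqP; rewrite oner_eq0.
Qed.

Lemma swap_signC d u v : u != v -> swap_sign d u v * swap_sign d v u = ksign k (d u * d v).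
Proof.
move=> uv; rewrite /swap_sign [d v * _]mulrC.
by case: ltngtP => h; rewrite ?mulr1 ?mul1r //; case/eqP: uv; apply: val_inj.
Qed.

(** Whatever the numbering, [swap_sign d b w] and [swap_sign d w b] multiply to the full sign of
    exchanging [b] and [w]. Passing [l1] thus costs exactly the signs that the parallel axiom
    produces. *)
Lemma list_sign_front d l1 w l2 : w \notin l1 ->
  list_sign d (l1 ++ w :: l2) =
  (\prod_(b <- l1) ksign k (d b * d w)) * list_sign d (w :: l1 ++ l2).
Proof.
move=> wl1; have := pair_prod_front (swap_sign d) l1 w l2 => H.
rewrite /list_sign; have -> : \prod_(b <- l1) ksign k (d b * d w) =
    (\prod_(b <- l1) swap_sign d b w) * \prod_(b <- l1) swap_sign d w b.
  rewrite -big_split /= big_seq [RHS]big_seq; apply: eq_bigr => b bl1.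
  by rewrite swap_signC //; apply: contraNneq wl1 => <-.
by rewrite [RHS]mulrC mulrA -H -mulrA prod_sq1 ?mulr1 //; exact: swap_sign_sq.
Qed.
End Koszul.

Lemma sorted_enum_ord N : sorted (fun u v : 'I_N => u < v)%N (enum 'I_N).
Proof.
by rewrite -[sorted _ _](@sorted_map _ _ val ltn) val_enum_ord iota_ltn_sorted.
Qed.

Lemma pair_prod_enum (k : fieldType) N (phi : 'I_N -> 'I_N -> k) :
  pair_prod phi (enum 'I_N) = \prod_(u < N) \prod_(v < N | (u < v)%N) phi u v.
Proof.
transitivity (\prod_(u <- enum 'I_N) \prod_(v <- enum 'I_N | (u < v)%N) phi u v); last first.
  by rewrite big_enum /=; apply: eq_bigr => u _; rewrite big_enum_cond.
have := sorted_enum_ord N; rewrite (sorted_pairwise (@ltn_ord_trans N)).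
elim: (enum _) => [|w l IH] /=; first by rewrite big_nil.
move=> /andP[/allP wl /IH ->]; rewrite !big_cons ltnn; congr (_ * _).
  rewrite big_seq [RHS]big_seq_cond; apply: eq_bigl => v.
  by case vl: (v \in l) => //=; rewrite wl.
rewrite big_seq [RHS]big_seq; apply: eq_bigr => u /wl wu.
by rewrite big_cons ltnNge ltnW.
Qed.

(** On a pair of vertices the two list signs multiply to the Koszul sign exactly when [s] reverses
    their relative order. This condition is symmetric in the pair, so the list may be replaced by
    the sorted one, where the product runs over the inversions of [s]. *)
Lemma iso_sign_list (k : fieldType) (X : finType) (t t' : tree X) (s : tree_iso t t')
    (d : 'I_(nv t') -> int) l : perm_eq l (enum 'I_(nv t)) ->
  iso_sign k s d = list_sign k (d \o s) l * list_sign k d (map s l).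
Proof.
move=> pl; rewrite /list_sign pair_prod_map -pair_prodM.
pose phi (u v : 'I_(nv t)) :=
  if (u < v)%N (+) (s u < s v)%N then ksign k (d (s u) * d (s v)) else 1.
rewrite (@eq_pair_prod _ _ _ phi) ?(perm_uniq pl) ?enum_uniq //; last first.
  move=> u v _ _ uv; rewrite /swap_sign /phi /=.
  have suv : (s u : nat) <> s v by move=> /val_inj /(can_inj (bfunK s)) /eqP; apply/negP.
  have nuv : (u : nat) <> v by move/val_inj/eqP; apply/negP.
  by case: (ltngtP u v) => //; case: (ltngtP (s u) (s v)) => //;
     rewrite /= ?mulr1 ?mul1r ?ksign_sq.
have phiC u v : phi u v = phi v u.
  have [->//|uv] := eqVneq u v; rewrite /phi [d (s v) * _]mulrC.
  have suv : (s u : nat) <> s v by move=> /val_inj /(can_inj (bfunK s)) /eqP; apply/negP.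
  have nuv : (u : nat) <> v by move/val_inj/eqP; apply/negP.
  by case: (ltngtP u v) => //; case: (ltngtP (s u) (s v)).
rewrite (pair_prod_perm phiC pl) pair_prod_enum; apply: eq_bigr => u _.
rewrite big_mkcondr /=; apply: eq_bigr => v uv; rewrite /phi uv.
have suv : (s u : nat) <> s v.
  by move=> /val_inj /(can_inj (bfunK s)) E; move: uv; rewrite E ltnn.
by case: (ltngtP (s u) (s v)).
Qed.

(** The list and the numbering both put the first block before the second, so no inversion mixes the
    blocks. *)
Lemma list_sign_graft (k : fieldType) m n (d : 'I_(m + n) -> int) l1 l2 :
  list_sign k d (map (@lshift m n) l1 ++ map (@rshift m n) l2) =
  list_sign k (fun v => d (lshift n v)) l1 * list_sign k (fun v => d (rshift m v)) l2.
Proof.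
rewrite /list_sign pair_prod_cat => [|u v]; last first.
  move=> /mapP[u' _ ->] /mapP[v' _ ->].
  by rewrite /swap_sign /= ltnNge ltnW // (leq_trans (ltn_ord u')) // leq_addr.
rewrite !pair_prod_map; congr (_ * _).
by congr pair_prod; apply/funext => u; apply/funext => v; rewrite /swap_sign /= ltn_add2l.
Qed.

(** * Grafting the vertices of a tree one by one *)

Section Visits.
Variables (X : finType) (t : tree X).
Implicit Types (K : {set 'I_(nv t)}) (v w : 'I_(nv t)) (l : seq 'I_(nv t)).

Definition edge v w := [exists i, glue t v i == inr w].
Definition has_parent K w := [exists v in K, edge v w].

Fixpoint parents_first K l : bool :=
  if l is w :: l' then [&& w \notin K, has_parent K w & parents_first (w |: K) l']
  else true.

Definition down_closed K :=
  Defs.root t \in K /\ forall w, w \in K -> w = Defs.root t \/ has_parent K w.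

Lemma has_parentP K w : reflect (exists v i, v \in K /\ glue t v i = inr w) (has_parent K w).
Proof.
apply: (iffP existsP) => [[v /andP[vK /existsP[i /eqP E]]]|[v [i [vK E]]]].
  by exists v, i.
by exists v; rewrite vK; apply/existsP; exists i; rewrite E.
Qed.

Lemma has_parentS K K' w : K \subset K' -> has_parent K w -> has_parent K' w.
Proof.
move=> /subsetP KK' /has_parentP[v [i [vK E]]]; apply/has_parentP.
by exists v, i; split=> //; exact: KK'.
Qed.

Lemma glue_vertex v i w j : glue t v i = glue t w j -> v = w.
Proof. by move/glue_inj/(congr1 (@projT1 _ _)). Qed.

Lemma down_closed_root : down_closed [set Defs.root t].
Proof. by split; rewrite ?set11 // => w /set1P ->; left. Qed.

Lemma down_closedU K w : down_closed K -> has_parent K w -> down_closed (w |: K).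
Proof.
case=> rK hK wK; split; first by rewrite inE rK orbT.
move=> u /setU1P[->|/hK[]]; [right|by left|right]; apply: has_parentS; try exact: subsetUr; done.
Qed.

Lemma parents_first_exists K : down_closed K ->
  exists2 l, parents_first K l & forall v, v \notin K -> v \in l.
Proof.
have [n] := ubnP #|~: K|; elim: n K => // n IH K Kn HK.
have [/eqP/setP KT|/set0Pn[v]] := boolP (~: K == set0).
  by exists [::] => // v vK; have := KT v; rewrite !inE vK.
rewrite inE => vK.
(* A path from the root to [v] starts in [K] and leaves it for the first time at such a [w]. *)
have [w wK wp] : exists2 w, w \notin K & has_parent K w.
  have [p] := connectP (glue_reach v); have := HK.1.
  move: (Defs.root t) => r; elim: p r => [|w p IHp] r rK /=.
    by move=> _ E; rewrite E rK in vK.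
  case/andP=> /existsP[i /eqP E] pw; have [wK|wK] := boolP (w \in K); first exact: IHp.
  by move=> _; exists w => //; apply/has_parentP; exists r, i.
have lt : (#|~: (w |: K)| < n)%N.
  have := cardsC K; have := cardsC (w |: K); rewrite cardsU1 wK; lia.
have [l lf cl] := IH _ lt (down_closedU HK wp).
exists (w :: l); first by rewrite /= wK wp.
move=> u uK; rewrite inE; have [//|uw] := eqVneq u w.
by apply: cl; rewrite !inE negb_or uw.
Qed.

Lemma parents_first_uniq K l : parents_first K l -> uniq l /\ {in l, forall w, w \notin K}.
Proof.
elim: l K => [//|w l IH] K /= /and3P[wK _ /IH[ul hl]]; split.
  by rewrite ul andbT; apply/negP => /hl; rewrite setU11.
move=> u /predU1P[->//|/hl]; by rewrite !inE negb_or => /andP[].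
Qed.

(* The legs and the vertices above K which the partial tree on K is glued to. *)
Definition frontier K (Z : Type) (h : Z -> X + 'I_(nv t)) :=
  injective h /\
  forall y, (exists z, h z = y) <->
    (exists v i, v \in K /\ glue t v i = y) /\ (forall w, w \in K -> y <> inr w).

Lemma frontier_root : frontier [set Defs.root t] (glue t (Defs.root t)).
Proof.
split=> [i j /glue_inj|y].
  exact: (@eq_from_Tagged _ (fun v => 'I_(ar t v))).
split=> [[i <-]|[[v [i [/set1P vr <-]]] _]]; last first.
  by subst v; exists i.
split; first by exists (Defs.root t), i; rewrite set11.
by move=> w /set1P ->; apply/glue_img; exists (Defs.root t), i.
Qed.

Lemma frontier_leg K w (Z : Type) (h : Z -> X + 'I_(nv t)) :
  frontier K h -> w \notin K -> has_parent K w -> exists z, h z = inr w.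
Proof.
move=> [_ hK] wK /has_parentP[v [i [vK E]]]; apply/hK; split; first by exists v, i.
by move=> u uK [] E'; rewrite E' uK in wK.
Qed.

(** Injectivity of the glueing gives each vertex at most one parent and each leg one half-edge. So
    the half-edges at [w] lead nowhere that those of [K] lead, and no child of [w] has been visited
    before. *)
Lemma frontier_ins K w (Z : finType) (h : Z -> X + 'I_(nv t)) (z : Z) :
  down_closed K -> frontier K h -> w \notin K -> has_parent K w -> h z = inr w ->
  frontier (w |: K) (@ins_label _ _ _ z h (glue t w)).
Proof.
move=> dK [hI hK] wK wp hz; split.
  have D a j : h a <> glue t w j.
    move=> E; have [[v [i [vK E']]] _] := (hK (h a)).1 (ex_intro _ a erefl).
    by move: E'; rewrite E => /glue_vertex vw; rewrite -vw vK in wK.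
  move=> [a|i] [b|j] /=.
  - by move/hI/sval_neq ->.
  - by move/D.
  - by move/esym/D.
  by move/glue_inj/(@eq_from_Tagged _ (fun v => 'I_(ar t v))) ->.
move=> y; split=> [[[a|j] <-]|[[v [i [/setU1P[vw|vK] E]]] hy]] /=.
- have [[v [i [vK E]]] hn] := (hK (h (sval a))).1 (ex_intro _ _ erefl).
  split; first by exists v, i; rewrite inE vK orbT.
  move=> u /setU1P[->|/hn//]; rewrite -hz => /hI E'.
  by have := svalP a; rewrite E' eqxx.
- split; first by exists w, j; rewrite setU11.
  (* A visited vertex is the root, to which no half-edge is glued, or has its parent in [K], while
     the parent of this [u] is [w]. *)
  move=> u uK E; have [u_root|/has_parentP[v [i [vK E']]]] : u = Defs.root t \/ has_parent K u.
    by move: uK => /setU1P[->|/dK.2//]; right.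
    by move: E; rewrite u_root; apply/glue_img; exists w, j.
  by move: E'; rewrite -E => /glue_vertex vw; rewrite -vw vK in wK.
- by subst v; exists (inr i).
have [z0 hz0] : exists z, h z = y.
  by apply/hK; split; [exists v, i|move=> u uK; apply: hy; rewrite inE uK orbT].
have z0z : z0 != z.
  by apply/eqP => E'; apply: (hy w); rewrite ?setU11 // -hz0 E'.
by exists (insl _ z0z).
Qed.
End Visits.

Section Runs.
Variables (k : fieldType) (Q : opdata k) (X : finType) (t : tree X).
Variable (c : forall v : 'I_(nv t), tot Q 'I_(ar t v)).
Implicit Types (K : {set 'I_(nv t)}) (v w : 'I_(nv t)) (l : seq 'I_(nv t)).

Definition vertex_lab v : lab Q (X + 'I_(nv t)) := Lab (glue t v) (c v).
Definition visit (s : lab Q (X + 'I_(nv t))) w := lab_circ s (inr w) (vertex_lab w).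
Definition run s l := foldl visit s l.
Definition start := vertex_lab (Defs.root t).
(** The invariant of a traversal. It guarantees that an unvisited vertex with its parent in [K] is
    the label of exactly one input of [s]. *)
Definition visited K (s : lab Q (X + 'I_(nv t))) := down_closed K /\ frontier K (label (l:=s)).

Lemma visited_start : visited [set Defs.root t] start.
Proof. split; [exact: down_closed_root | exact: frontier_root]. Qed.

Lemma visit_at K s w : visited K s -> w \notin K -> has_parent K w ->
  exists2 z : lset s, label z = inr w & visit s w = lab_circ_at z (vertex_lab w).
Proof.
move=> [_ fK] wK wp; have [z hz] := frontier_leg fK wK wp.
by exists z => //; rewrite /visit -hz lab_circE //; exact: fK.1.
Qed.

Lemma visited_visit K s w : visited K s -> w \notin K -> has_parent K w ->
  visited (w |: K) (visit s w).
Proof.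
move=> vK wK wp; have [z hz ->] := visit_at vK wK wp.
by split; [exact: down_closedU vK.1 wp | exact: frontier_ins vK.1 vK.2 wK wp hz].
Qed.

Lemma visited_run K s l : visited K s -> parents_first K l ->
  visited (K :|: [set v in l]) (run s l).
Proof.
elim: l K s => [|w l IH] K s vK /=.
  by move=> _; rewrite (_ : [set v in [::]] = set0) ?setU0 //; apply/setP => v; rewrite !inE.
case/and3P=> wK wp /(IH _ _ (visited_visit vK wK wp)).
by congr (visited _ _); apply/setP => v; rewrite !inE orbA; congr (_ || _); rewrite orbC.
Qed.

(** Induction along a traversal; [free_ind] uses it to carry its predicate from corollas to whole
    trees. *)
Lemma run_elt (p : forall Z : finType, tot Q Z -> Prop) s l :
  (forall v, p _ (c v)) ->
  (forall (Y Z : finType) (y : Y) a b, p Y a -> p Z b -> p (ins y Z) (tcirc y a b)) ->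
  p _ (elt s) -> p _ (elt (run s l)).
Proof.
move=> hc hp; elim: l s => [//|w l IH] s ps /=; apply: IH; rewrite /visit /lab_circ.
by case: pickP => // z _; apply: hp ps (hc w).
Qed.

Hypothesis HQ : is_operad Q.

Lemma visited_eq K a s s' : lab_eq a s s' -> visited K s -> visited K s'.
Proof.
move=> E [dK fK]; split=> //; split; first exact: lab_eq_inj E fK.1.
case: E => e he _ y; rewrite -fK.2; split=> -[z <-].
  by exists (binv e z); rewrite -he binvK.
by exists (e z).
Qed.

Lemma visit_eq K a s s' w : visited K s -> w \notin K -> has_parent K w ->
  lab_eq a s s' -> lab_eq a (visit s w) (visit s' w).
Proof.
move=> vK wK wp E; rewrite -[a]mulr1.
apply: lab_circ_eq => //; [exact: vK.2.1 | exact: frontier_leg vK.2 wK wp |].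
exact: lab_eq_refl.
Qed.

Lemma run_eq K a s s' l : visited K s -> parents_first K l ->
  lab_eq a s s' -> lab_eq a (run s l) (run s' l).
Proof.
elim: l K s s' => [//|w l IH] K s s' vK /= /and3P[wK wp wl] E.
by apply: (IH _ _ _ (visited_visit vK wK wp) wl); exact: (visit_eq vK wK wp E).
Qed.

(** Both parents lie in [K], so [b] and [w] label two distinct inputs of [s], and this is the
    situation of the parallel axiom. *)
Lemma visit_swap K s b w : visited K s -> b \notin K -> has_parent K b ->
  w \notin K -> has_parent K w -> b != w ->
  lab_eq (ksign k (tag (c b) * tag (c w))) (visit (visit s b) w) (visit (visit s w) b).
Proof.
move=> vK bK bp wK wp bw.
have [y hy Eb] := visit_at vK bK bp; have [z hz Ew] := visit_at vK wK wp.
have zy : z != y by apply: contra_neq bw => E; move: hz; rewrite E hy => -[].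
have yz : y != z by rewrite eq_sym.
have Ebw : visit (visit s b) w =
    @lab_circ_at _ _ _ (lab_circ_at y (vertex_lab b)) (insl _ zy) (vertex_lab w).
  rewrite /visit -[lab_circ s _ _]/(visit s b) Eb -hz.
  rewrite -[label z]/(label (l:=lab_circ_at y (vertex_lab b)) (insl _ zy)) lab_circE //.
  by rewrite -Eb; have [_ []] := visited_visit vK bK bp.
have Ewb : visit (visit s w) b =
    @lab_circ_at _ _ _ (lab_circ_at z (vertex_lab w)) (insl _ yz) (vertex_lab b).
  rewrite /visit -[lab_circ s _ _]/(visit s w) Ew -hy.
  rewrite -[label y]/(label (l:=lab_circ_at z (vertex_lab w)) (insl _ yz)) lab_circE //.
  by rewrite -Ew; have [_ []] := visited_visit vK wK wp.
by rewrite Ebw Ewb; exact: lab_circ_par.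
Qed.

(** Since the parent of [w] is already in [K], no vertex of [l1] is an ancestor of [w]. It can
    therefore pass them one at a time by [visit_swap], and the rearranged list still visits parents
    first. *)
Lemma run_front K s l1 w l2 : visited K s -> parents_first K (l1 ++ w :: l2) ->
  has_parent K w ->
  parents_first K (w :: l1 ++ l2) /\
  lab_eq (\prod_(b <- l1) ksign k (tag (c b) * tag (c w)))
    (run s (l1 ++ w :: l2)) (run s (w :: l1 ++ l2)).
Proof.
elim: l1 K s => [|b l1 IH] K s vK.
  by rewrite /= big_nil => wl _; split=> //; exact: lab_eq_refl.
move=> pl wp; have [ul hl] := parents_first_uniq pl.
have wK : w \notin K by apply: hl; rewrite mem_cat mem_head orbT.
have bw : b != w.
  by move: ul; rewrite /= mem_cat inE !negb_or => /andP[/and3P[]].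
move: pl => /= /and3P[bK bp pl]; have vb := visited_visit vK bK bp.
have wp' : has_parent (b |: K) w by apply: has_parentS wp; exact: subsetUr.
have [pf E] := IH _ _ vb pl wp'.
move: pf => /= /and3P[wbK _ pl'].
have bwK : b \notin w |: K by rewrite !inE negb_or bw.
have bp' : has_parent (w |: K) b by apply: has_parentS bp; exact: subsetUr.
split; first by rewrite wK wp bwK bp' setUCA.
rewrite big_cons mulrC; apply: (lab_eq_trans HQ E) => /=.
apply: (run_eq (visited_visit vb wbK wp') pl').
exact: (visit_swap vK bK bp wK wp bw).
Qed.

(** Selection sort: the head of [l'] has its parent in [K], so it can be pulled to the front of [l],
    and the tails are compared by induction. *)
Lemma run_perm K s l l' : visited K s -> parents_first K l -> parents_first K l' ->
  perm_eq l l' ->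
  lab_eq (list_sign k (fun v => tag (c v)) l * list_sign k (fun v => tag (c v)) l')
    (run s l) (run s l').
Proof.
set d := fun v => tag (c v).
elim: l' K s l => [|w l' IH] K s l vK pl pl' ll'.
  move/perm_nilP: ll' => -> /=; rewrite mulr1; exact: lab_eq_refl.
have wl : w \in l by rewrite (perm_mem ll') mem_head.
case/splitPr: wl pl ll' => l1 l2 pl ll'.
have E : perm_eq (l1 ++ l2) l'.
  by rewrite -(perm_cons w) -(permPr ll') perm_sym -cat1s perm_catCA.
move: pl' => /= /and3P[wK wp pl'].
have [/= /and3P[_ _ pl2] E1] := run_front vK pl wp.
have E2 := IH _ _ _ (visited_visit vK wK wp) pl2 pl' E.
have := lab_eq_trans HQ E1 E2; congr (lab_eq _ _ _).
have wl1 : w \notin l1.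
  have [+ _] := parents_first_uniq pl; rewrite cat_uniq => /and3P[_ + _].
  by rewrite /= negb_or => /andP[].
rewrite list_sign_front // /list_sign /= -(perm_big _ E) /=.
(* Both list signs contain the factors of [w] against all later vertices; this product occurs
   squared and drops out. *)
set p := \prod_(v <- l1 ++ l2) _.
have pp : p * p = 1 by apply: prod_sq1; exact: swap_sign_sq.
rewrite -!/(list_sign k _ _) -[X in X * _ = _]mulr1 -pp; ring.
Qed.
End Runs.

Section TotalLinear.
Variable k : fieldType.

(** Since [tot] has no addition, linear dependence is a relation between three elements that share a
    degree. *)
Definition tlin (C : coldata k) (Z : finType) a (p p1 p2 : tot C Z) : Prop :=
  exists i (x1 x2 : C Z i),
    [/\ p = existT _ i (a *: x1 + x2), p1 = existT _ i x1 & p2 = existT _ i x2].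

Lemma tlin_scale (C : coldata k) (Z : finType) a b (p p1 p2 : tot C Z) :
  tlin a p p1 p2 -> tlin a (tscale b p) (tscale b p1) (tscale b p2).
Proof.
case=> i [x1 [x2 [-> -> ->]]]; exists i, (b *: x1), (b *: x2); split=> //.
by rewrite /tscale /= scalerDr !scalerA mulrC.
Qed.

Lemma tlin_act (C : coldata k) (Z Y : finType) (e : bij Y Z) a (p p1 p2 : tot C Z) :
  is_collection C -> tlin a p p1 p2 -> tlin a (tact e p) (tact e p1) (tact e p2).
Proof.
move=> HC [i [x1 [x2 [-> -> ->]]]]; exists i, (act C e x1), (act C e x2); split=> //.
by rewrite /tact /= (act_linear HC).
Qed.

Lemma tlin_circl (Q : opdata k) (Z Y : finType) (z : Z) a (p p1 p2 : tot Q Z) (q : tot Q Y) :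
  is_operad Q -> tlin a p p1 p2 -> tlin a (tcirc z p q) (tcirc z p1 q) (tcirc z p2 q).
Proof.
move=> HQ [i [x1 [x2 [-> -> ->]]]]; case: q => j q.
exists (i + j), (circ Q z erefl x1 q), (circ Q z erefl x2 q); split=> //.
by rewrite /tcirc /= (circ_linearl HQ).
Qed.

Lemma tlin_circr (Q : opdata k) (Z Y : finType) (z : Z) a (p : tot Q Z) (q q1 q2 : tot Q Y) :
  is_operad Q -> tlin a q q1 q2 -> tlin a (tcirc z p q) (tcirc z p q1) (tcirc z p q2).
Proof.
move=> HQ [j [x1 [x2 [-> -> ->]]]]; case: p => i p.
exists (i + j), (circ Q z erefl p x1), (circ Q z erefl p x2); split=> //.
by rewrite /tcirc /= (circ_linearr HQ).
Qed.

Lemma tlin_tag (C : coldata k) (Z : finType) a (p p1 p2 : tot C Z) :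
  tlin a p p1 p2 -> tag p = tag p1 /\ tag p = tag p2.
Proof. by case=> i [x1 [x2 [-> -> ->]]]. Qed.
End TotalLinear.

Section VisitingLists.
Variables (X : finType) (t : tree X).
Definition visiting (l : seq 'I_(nv t)) :=
  parents_first [set Defs.root t] l /\ forall v, v \notin [set Defs.root t] -> v \in l.

Lemma visiting_exists : exists l, visiting l.
Proof. by have [l pl cl] := parents_first_exists (down_closed_root t); exists l. Qed.

Lemma visiting_perm l : visiting l -> perm_eq (Defs.root t :: l) (enum 'I_(nv t)).
Proof.
move=> [pl cl]; have [ul hl] := parents_first_uniq pl.
apply: uniq_perm; rewrite ?enum_uniq //= ?ul ?andbT.
  by apply/negP => /hl; rewrite set11.
by move=> v; rewrite mem_enum inE; have := cl v; rewrite inE; case: eqP => //= _ ->.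
Qed.
End VisitingLists.

Lemma parents_first_map (X Y : finType) (t : tree X) (s : tree Y)
    (f : 'I_(nv t) -> 'I_(nv s)) (K : {set 'I_(nv t)}) (K' : {set 'I_(nv s)}) l :
  injective f -> (forall v w, edge v w -> edge (f v) (f w)) ->
  (forall v, v \in K -> f v \in K') -> {in l, forall v, f v \notin K'} ->
  parents_first K l -> parents_first K' (map f l).
Proof.
move=> fI fe; elim: l K K' => [//|w l IH] K K' KK' lK' /= /and3P[wK wp wl].
have ul : w \notin l.
  by have [_ hl] := parents_first_uniq wl; apply/negP => /hl; rewrite setU11.
apply/and3P; split; first by apply: lK'; exact: mem_head.
  case/existsP: wp => v /andP[vK E]; apply/existsP; exists (f v).
  by rewrite KK' //=; exact: fe.
apply: IH wl => [v|v vl].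
  by rewrite !inE => /orP[/eqP ->|/KK' ->]; rewrite ?eqxx ?orbT.
rewrite !inE negb_or lK' ?inE ?vl ?orbT // andbT.
by apply: contraNneq ul => /fI <-.
Qed.

(** * The value of a decorated tree in an operad *)

Section TreeValue.
Variables (k : fieldType) (Q : opdata k).
Hypothesis HQ : is_operad Q.
Let HC : is_collection Q := op_collection HQ.

Section OneTree.
Variables (X : finType) (t : tree X) (c : forall v : 'I_(nv t), tot Q 'I_(ar t v)).

(** Frontier labels are never visited vertices. After a complete traversal only legs are left, and
    the labels identify the inputs with [X]. *)
Lemma visiting_legs l : visiting l ->
  exists e : bij X (lset (run c (start c) l)), forall x, label (e x) = inl x.
Proof.
move=> vl; have [_ [hI hh]] := visited_run c (visited_start c) vl.1.
set s := run _ _ _ in hI hh *.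
have K v : v \in [set Defs.root t] :|: [set v in l].
  by have := vl.2 v; rewrite !inE; case: eqP => //= _ ->.
have f x : {z | label (l:=s) z = inl x}.
  apply: cid; apply/hh; split=> // .
  have /glue_img [v [i E]] : inl x <> inr (Defs.root t) :> X + 'I_(nv t) by [].
  by exists v, i.
have g z : {x | label (l:=s) z = inl x}.
  apply: cid; case E: (label z) => [x|v]; first by exists x.
  have [_ /(_ v (K v))] := (hh (label z)).1 (ex_intro _ z erefl).
  by rewrite E.
have fK : cancel (fun x => sval (f x)) (fun z => sval (g z)).
  by move=> x; case: (f x) => z /= E; case: (g z) => y /=; rewrite E => -[].
have gK : cancel (fun z => sval (g z)) (fun x => sval (f x)).
  by move=> z; case: (g z) => x /= E; case: (f x) => y /=; rewrite -E => /hI.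
by exists (Bij fK gK) => x; exact: svalP (f x).
Qed.

(** A relation rather than a function: the traversal is a choice, and the degree obtained is the
    degree sum only propositionally. The sign passes from the numbering, in which the decorations
    are tensored, to the order of visit. *)
Definition tree_value (q : tot Q X) : Prop :=
  exists2 l, visiting l &
    lab_eq (list_sign k (fun v => tag (c v)) (Defs.root t :: l))
      (Lab (@inl X 'I_(nv t)) q) (run c (start c) l).

Lemma lab_eq_inl (U : Type) a (q q' : tot Q X) :
  lab_eq a (Lab (@inl X U) q) (Lab (@inl X U) q') -> q = tscale a q'.
Proof.
case=> /= e he ->; rewrite (_ : e = bij_id X) ?(tact_id HC) //.
by apply: bij_ext => x /=; have [] := he x.
Qed.

(** [run_perm] exchanges the traversal that witnesses the value for an arbitrary one; the sign of
    the old order then occurs twice and cancels. *)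
Lemma tree_value_lab l q : visiting l -> tree_value q ->
  lab_eq (list_sign k (fun v => tag (c v)) (Defs.root t :: l))
    (Lab (@inl X 'I_(nv t)) q) (run c (start c) l).
Proof.
move=> vl [l' vl' E].
have ll' : perm_eq l' l.
  by rewrite -(perm_cons (Defs.root t)) (permPl (visiting_perm vl')) perm_sym visiting_perm.
have := lab_eq_trans HQ E (run_perm c HQ (visited_start c) vl'.1 vl.1 ll').
congr (lab_eq _ _ _); rewrite /list_sign /= (perm_big _ ll') /= -!/(list_sign k _ _).
by rewrite mulrA -[_ * _ * list_sign _ _ l']mulrA list_sign_sq mulr1.
Qed.

Lemma tree_value_uniq q q' : tree_value q -> tree_value q' -> q = q'.
Proof.
move=> h h'; have [l vl] := visiting_exists t.
have E := tree_value_lab vl h; have E' := tree_value_lab vl h'.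
have /lab_eq_inl := lab_eq_trans HQ E (lab_eq_sym HQ (list_sign_sq _ _ _) E').
by rewrite list_sign_sq tscale1.
Qed.

Lemma tree_value_exists : exists q, tree_value q.
Proof.
have [l vl] := visiting_exists t; have [e he] := visiting_legs vl.
exists (tscale (list_sign k (fun v => tag (c v)) (Defs.root t :: l))
  (tact e (elt (run c (start c) l)))).
by exists l => //; exists e.
Qed.
End OneTree.

(** A traversal of [t] is pushed forward along [s]. Relabelling by [s] commutes with the run, so the
    two values differ only by their list signs, which [iso_sign_list] combines. *)
Lemma tree_value_iso (X : finType) (t t' : tree X) (s : tree_iso t t')
    (c : forall v, tot Q 'I_(ar t v)) (c' : forall v, tot Q 'I_(ar t' v)) q q' :
  (forall v, c v = tact (iso_h s v) (c' (s v))) ->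
  tree_value c q -> tree_value c' q' ->
  q = tscale (iso_sign k s (fun v => tag (c' v))) q'.
Proof.
move=> hc hq hq'; have [l vl] := visiting_exists t.
pose sg := sum_map id s : X + _ -> X + _.
have sI : injective s := can_inj (bfunK s).
have sgI : injective sg by move=> [a|v] [b|w] //= []; [move-> | move/sI ->].
have vE v : lab_eq 1 (lab_map sg (vertex_lab c v)) (vertex_lab c' (s v)).
  exists (iso_h s v) => [i|]; first exact: iso_glue.
  by rewrite tscale1 /= hc.
have rE K st st' l0 : visited K st -> parents_first K l0 -> lab_eq 1 (lab_map sg st) st' ->
    lab_eq 1 (lab_map sg (run c st l0)) (run c' st' (map s l0)).
  elim: l0 K st st' => [//|w l0 IH] K st st' vK /= /and3P[wK wp wl] E.
  apply: (IH _ _ _ (visited_visit c vK wK wp) wl).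
  rewrite lab_circ_map //= -[1]mulr1; apply: lab_circ_eq => //.
    by move=> z1 z2 /sgI /vK.2.1.
  by have [z hz] := frontier_leg vK.2 wK wp; exists z; rewrite /= hz.
have vl' : visiting (map s l).
  split=> [|v].
    apply: (parents_first_map sI _ _ _ vl.1) => [v w /existsP[i /eqP E]|v|v vl'].
    - by apply/existsP; exists (iso_h s v i); rewrite iso_glue E.
    - by rewrite !inE => /eqP ->; rewrite iso_root.
    have [_ /(_ v vl')] := parents_first_uniq vl.1.
    by rewrite !inE -(iso_root s) (inj_eq sI).
  rewrite inE -(iso_root s) -[v](binvK s) (inj_eq sI) (mem_map sI) => h.
  by apply: vl.2; rewrite inE.
have E1 := lab_eq_map sg (tree_value_lab vl hq).
have := rE _ _ _ _ (visited_start c) vl.1 (vE (Defs.root t)).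
rewrite iso_root => /(lab_eq_trans HQ E1); rewrite mulr1 => E2.
have E3 := lab_eq_sym HQ (list_sign_sq _ _ _) (tree_value_lab vl' hq').
have /lab_eq_inl := lab_eq_trans HQ E2 E3.
rewrite (iso_sign_list k s _ (visiting_perm vl)) /= iso_root => ->.
congr (tscale (list_sign _ _ _ * _) _).
by apply/funext => v /=; rewrite hc.
Qed.

Lemma tree_value_relabel (X Y : finType) (e : bij X Y) (t : tree Y)
    (c : forall v, tot Q 'I_(ar t v)) q :
  tree_value c q -> @tree_value X (relabel e t) c (tact e q).
Proof.
case=> l vl E; exists l.
  split; last exact: vl.2.
  rewrite -[l]map_id; apply: (parents_first_map _ _ _ _ vl.1) => //.
    move=> v w /existsP[i /eqP h]; apply/existsP; exists i.
    by rewrite /= /relabel_glue h.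
  by have [] := parents_first_uniq vl.1.
pose sg := sum_map (binv e) id : Y + 'I_(nv t) -> X + 'I_(nv t).
have sgI : injective sg by move=> [a|v] [b|w] //= []; [move/(can_inj (binvK e)) -> | move->].
have rE st : @run _ _ _ (relabel e t) c (lab_map sg st) l = lab_map sg (run c st l).
  elim: {E vl}l st => [//|w l IH] st /=.
  rewrite -IH (_ : lab_map sg (visit c st w) = @visit _ _ _ (relabel e t) c (lab_map sg st) w) //.
  exact: lab_circ_map.
have := lab_eq_map sg E; rewrite -rE; set r := run _ _ _ => E'.
rewrite -[list_sign _ _ _]mul1r; apply: lab_eq_trans E' => //.
by exists e => [x|] /=; rewrite ?bfunK ?tscale1.
Qed.

Lemma tree_value_corolla (X : finType) (c : tot Q X) :
  @tree_value X (cor_tree X) (fun=> tact (bij_enum X) c) c.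
Proof.
exists [::]; first by split=> // v; rewrite inE (ord1 v).
rewrite /list_sign /= big_nil mul1r; exists (bij_inv (bij_enum X)) => [x|].
  by rewrite /= /cor_glue enum_rankK.
rewrite tscale1 /= tact_comp // (_ : Defs.bij_comp _ _ = bij_id _) ?(tact_id HC) //.
by apply: bij_ext => x /=; rewrite enum_rankK.
Qed.
End TreeValue.

Lemma parents_first_cat (X : finType) (t : tree X) (K : {set 'I_(nv t)}) l1 l2 :
  parents_first K (l1 ++ l2) = parents_first K l1 && parents_first (K :|: [set v in l1]) l2.
Proof.
elim: l1 K => [|w l1 IH] K /=.
  by congr parents_first; apply/setP => v; rewrite !inE orbF.
rewrite IH -!andbA; do 3!congr (_ && _); congr parents_first.
by apply/setP => v; rewrite !inE orbA; congr (_ || _); rewrite orbC.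
Qed.

(** * Multilinearity of tree values and their compatibility with grafting *)

Section TreeValueOperations.
Variables (k : fieldType) (Q : opdata k).
Hypothesis HQ : is_operad Q.
Let HC : is_collection Q := op_collection HQ.

Section Multilinear.
Variables (X : finType) (t : tree X) (c c1 c2 : forall v : 'I_(nv t), tot Q 'I_(ar t v)).
Variables (a : k) (v0 : 'I_(nv t)).
Hypotheses (c_off : forall w, w != v0 -> c w = c1 w /\ c w = c2 w)
  (c_on : tlin a (c v0) (c1 v0) (c2 v0)).

Let lab_lin (U : Type) (s s1 s2 : lab Q U) : Prop :=
  exists (Z : finType) (h : Z -> U) (p p1 p2 : tot Q Z),
    [/\ s = Lab h p, s1 = Lab h p1, s2 = Lab h p2 & tlin a p p1 p2].

Let lin_run_after s s1 s2 l : v0 \notin l -> lab_lin s s1 s2 ->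
  lab_lin (run c s l) (run c1 s1 l) (run c2 s2 l).
Proof.
elim: l s s1 s2 => [//|w l IH] s s1 s2 /=; rewrite inE negb_or eq_sym => /andP[wv vl] h.
apply: IH => //; have [E1 E2] := c_off wv.
have [Z [h' [p [p1 [p2 [-> -> -> hl]]]]]] := h.
rewrite /visit /lab_circ /=; case: pickP => [z _|_]; last by exists Z, h', p, p1, p2.
eexists _, _, _, _, _; split=> //=.
by rewrite -E1 -E2; exact: tlin_circl.
Qed.

Let lin_run K s l : visited K s -> parents_first K l -> v0 \in l ->
  lab_lin (run c s l) (run c1 s l) (run c2 s l).
Proof.
elim: l K s => [//|w l IH] K s vK /= /and3P[wK wp wl].
have [v0w _|wv] := eqVneq v0 w.
  subst w; have [z hz] := frontier_leg vK.2 wK wp.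
  have [_ hl] := parents_first_uniq wl.
  apply: lin_run_after; first by apply/negP => /hl; rewrite setU11.
  rewrite /visit /lab_circ; case: pickP => [z' _|/(_ z)]; last by rewrite hz eqxx.
  by eexists _, _, _, _, _; split=> //=; exact: tlin_circr.
rewrite inE (negbTE wv) /= => vl; rewrite eq_sym in wv; have [E1 E2] := c_off wv.
rewrite (_ : visit c1 s w = visit c s w) 1?(_ : visit c2 s w = visit c s w).
- exact: (IH _ _ (visited_visit c vK wK wp)).
- by rewrite /visit /vertex_lab E2.
by rewrite /visit /vertex_lab E1.
Qed.

(** The three runs coincide until [v0] is visited. There linearity of grafting in its second
    argument applies, and from then on linearity in the first; if [v0] is the root, the runs differ
    from the start. *)
Lemma tree_value_lin q q1 q2 : tree_value c q -> tree_value c1 q1 -> tree_value c2 q2 ->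
  tlin a q q1 q2.
Proof.
have [l vl] := visiting_exists t.
have tagE v : tag (c v) = tag (c1 v) /\ tag (c v) = tag (c2 v).
  have [->|/c_off[<- <-]//] := eqVneq v v0; exact: tlin_tag c_on.
have d1 : (fun v => tag (c1 v)) = (fun v => tag (c v)).
  by apply/funext => v; case: (tagE v).
have d2 : (fun v => tag (c2 v)) = (fun v => tag (c v)).
  by apply/funext => v; case: (tagE v).
move=> /(tree_value_lab HQ vl) E /(tree_value_lab HQ vl) E1 /(tree_value_lab HQ vl) E2.
rewrite d1 in E1; rewrite d2 in E2.
have H : lab_lin (run c (start c) l) (run c1 (start c1) l) (run c2 (start c2) l).
  have [v0r|v0r] := eqVneq v0 (Defs.root t).
    apply: lin_run_after.
      have [_ hl] := parents_first_uniq vl.1.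
      by apply/negP => /hl; rewrite v0r set11.
    by rewrite /start -v0r; eexists _, _, _, _, _; split.
  have [e1 e2] : c (Defs.root t) = c1 (Defs.root t) /\ c (Defs.root t) = c2 (Defs.root t).
    by apply: c_off; rewrite eq_sym.
  have -> : start c1 = start c by rewrite /start /vertex_lab e1.
  have -> : start c2 = start c by rewrite /start /vertex_lab e2.
  by apply: lin_run (visited_start c) vl.1 _; apply: vl.2; rewrite inE.
have hI := (visited_run c (visited_start c) vl.1).2.1.
case: H hI E E1 E2 => Z [h [p [p1 [p2 [-> -> -> hl]]]]] /= hI.
case=> /= e he -> [/= e1 he1 ->] [/= e2 he2 ->].
(* The labels of the completed run are injective, which forces the three identifications of its
   inputs with [X] to agree. *)
have -> : e1 = e by apply: bij_ext => z; apply: hI; rewrite he he1.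
have -> : e2 = e by apply: bij_ext => z; apply: hI; rewrite he he2.
exact/tlin_scale/tlin_act.
Qed.
End Multilinear.

Section Grafting.
Variables (X Y : finType) (x : X) (t : tree X) (s : tree Y).
Variables (c : forall v : 'I_(nv t), tot Q 'I_(ar t v)).
Variables (c' : forall v : 'I_(nv s), tot Q 'I_(ar s v)).

Definition graft_tot' (v : 'I_(nv t) + 'I_(nv s)) : tot Q 'I_(graft_ar' v) :=
  match v with inl v => c v | inr v => c' v end.
Definition graft_tot (v : 'I_(nv (graft x t s))) : tot Q 'I_(ar (graft x t s) v) :=
  graft_tot' (split v).

Local Notation gl := (@graft_left X Y x t s).
Local Notation gr := (@graft_right X Y x t s).

Let vertexE (v : 'I_(nv t) + 'I_(nv s)) :
  vertex_lab graft_tot (unsplit v) =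
  match v with
  | inl v => lab_map gl (vertex_lab c v)
  | inr v => lab_map gr (vertex_lab c' v)
  end.
Proof.
transitivity (Lab (@graft_glue' X Y x t s (split (unsplit v)))
  (graft_tot' (split (unsplit v)))) => //.
by rewrite unsplitK; case: v.
Qed.

Let edgeE (v : 'I_(nv t) + 'I_(nv s)) (i : 'I_(graft_ar' v)) w :
  graft_glue' x i = inr w -> @edge _ (graft x t s) (unsplit v) w.
Proof.
move=> E; have [i' Ei] := @graft_glueP X Y x t s v i.
by apply/existsP; exists i'; rewrite -E -Ei.
Qed.

(** The grafted tree is traversed through [t], then the root of [s], then the rest of [s]. The first
    stretch is the run of [t] with its labels transported. By the sequential axiom the visits in the
    last stretch may be carried out inside [s] before it is grafted. *)
Lemma tree_value_graft p q : tree_value c p -> tree_value c' q ->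
  @tree_value _ Q (ins x Y) (graft x t s) graft_tot (tcirc x p q).
Proof.
case=> l [pl cl] E [m [pm cm] F].
have [ul hl] := parents_first_uniq pl; have [um hm] := parents_first_uniq pm.
have lI : injective (@lshift (nv t) (nv s)) by exact: lshift_inj.
have rI : injective (@rshift (nv t) (nv s)) by exact: rshift_inj.
pose u0 := @rshift (nv t) (nv s) (Defs.root s).
pose L := map (@lshift (nv t) (nv s)) l ++ map (@rshift (nv t) (nv s)) (Defs.root s :: m).
pose g := graft x t s.
have pfL : @parents_first _ g [set Defs.root g] (map (@lshift (nv t) (nv s)) l).
  apply: (@parents_first_map X _ t g _ _ _ l lI _ _ _ pl)
    => [v w /existsP[i /eqP Ei]|v /set1P ->|v vl].
  - by apply: (edgeE (v := inl v) (i := i)); rewrite /= Ei.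
  - by rewrite set11.
  - by rewrite inE (inj_eq lI); have := hl v vl; rewrite inE.
pose KL := [set Defs.root g] :|: [set v in map (@lshift (nv t) (nv s)) l].
have lKL v : lshift (nv s) v \in KL.
  rewrite !inE (mem_map lI) (inj_eq lI); have := cl v; rewrite inE.
  by case: eqP => //= _ ->.
have rKL v : rshift (nv t) v \notin KL.
  rewrite !inE negb_or; apply/andP; split.
    by apply/eqP => /(congr1 val) /=; have := ltn_ord (Defs.root t); lia.
  by apply/mapP => -[w _ /(congr1 val)] /=; have := ltn_ord w; lia.
have u0p : @has_parent _ g KL u0.
  (* The vertex of [t] that carries the leg [x] is the parent of the root of [s]. *)
  have /glue_img [v [i Ei]] : inl x <> inr (Defs.root t) :> X + 'I_(nv t) by [].
  apply/existsP; exists (lshift (nv s) v); rewrite lKL.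
  by apply: (edgeE (v := inl v) (i := i)); rewrite /= Ei graft_leftx.
have pfM : @parents_first _ g (u0 |: KL) (map (@rshift (nv t) (nv s)) m).
  apply: (@parents_first_map Y _ s g _ _ _ m rI _ _ _ pm)
    => [v w /existsP[i /eqP Ei]|v /set1P ->|v vm].
  - by apply: (edgeE (v := inr v) (i := i)); rewrite /= Ei.
  - by rewrite setU11.
  - by rewrite inE negb_or rKL andbT inE (inj_eq rI); have := hm v vm; rewrite inE.
have vL : @visiting _ g L.
  split; first by rewrite parents_first_cat pfL /= -/KL -/u0 rKL u0p pfM.
  move=> v; rewrite -(splitK v) inE mem_cat; case: (split v) => w /=.
    rewrite (inj_eq lI) (mem_map lI) => h; by rewrite cl ?inE.
  move=> _; rewrite inE (inj_eq rI) (mem_map rI); have := cm w; rewrite inE.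
  by case: eqP => [_ _|_ ->] //=; rewrite !orbT.
exists L => //.
have glI : injective gl := @graft_left_inj X Y x t s.
have grI : injective gr := @graft_right_inj X Y x t s.
have runl st l0 : run graft_tot (lab_map gl st) (map (@lshift _ _) l0) = lab_map gl (run c st l0).
  elim: l0 st => [//|w l0 IH] st /=; rewrite -IH; congr foldl.
  by rewrite /visit lab_circ_map // -(vertexE (inl w)).
pose S := lab_map gl (run c (start c) l).
have SE : run graft_tot (start graft_tot) (map (@lshift _ _) l) = S.
  by rewrite /S -runl /start -(vertexE (inl _)).
have vS : visited KL S by rewrite -SE; apply: visited_run (visited_start graft_tot) pfL.
have [z0 hz0] := frontier_leg vS.2 (rKL _) u0p.
have atS T : lab_circ S (inr u0) T = lab_circ_at z0 T by rewrite -hz0 lab_circE //; exact: vS.2.1.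
(* The input labelled by the next vertex [w] lies in the part coming from [s], so [lab_circ_seq]
   moves its visit inside the grafting. *)
have runr (K : {set 'I_(nv g)}) (K' : {set 'I_(nv s)}) st l0 :
    @visited _ Q _ g K (lab_circ S (inr u0) (lab_map gr st)) -> visited K' st ->
    @parents_first _ g K (map (@rshift _ _) l0) -> parents_first K' l0 ->
    lab_eq 1 (run graft_tot (lab_circ S (inr u0) (lab_map gr st)) (map (@rshift _ _) l0))
      (lab_circ S (inr u0) (lab_map gr (run c' st l0))).
  elim: l0 K K' st => [|w l0 IH] K K' st vK vK' /=; first by move=> _ _; exact: lab_eq_refl.
  move=> /and3P[wK wp wl] /and3P[wK' wp' wl'].
  have [y hy Ey] := visit_at c' vK' wK' wp'.
  have Ew : lab_eq 1 (visit graft_tot (lab_circ S (inr u0) (lab_map gr st)) (rshift _ w))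
      (lab_circ S (inr u0) (lab_map gr (visit c' st w))).
    have -> : lab_map gr (visit c' st w) =
        @lab_circ_at _ _ _ (lab_map gr st) y (lab_map gr (vertex_lab c' w)).
      rewrite /visit lab_circ_map // -hy -[gr _]/(label (l:=lab_map gr st) y) lab_circE //.
      by move=> z1 z2 /grI /vK'.2.1.
    move: vK; rewrite !atS => vK; rewrite /visit (vertexE (inr w)).
    have -> : inr (rshift (nv t) w) =
        label (l:=lab_circ_at z0 (lab_map gr st)) (insr z0 y) by rewrite /= hy.
    by rewrite lab_circE; [exact: lab_circ_seq | exact: vK.2.1].
  have vw := visited_visit graft_tot vK wK wp.
  rewrite -[1]mulr1; apply: (lab_eq_trans HQ (run_eq graft_tot HQ vw wl Ew)).
  by apply: IH (visited_eq Ew vw) (visited_visit c' vK' wK' wp') wl wl'.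
have -> : run graft_tot (start graft_tot) L =
    run graft_tot (lab_circ S (inr u0) (lab_map gr (start c'))) (map (@rshift _ _) m).
  by rewrite /L [LHS]foldl_cat [foldl _ _ (map _ l)]SE /= /visit (vertexE (inr _)).
have vu := visited_visit graft_tot vS (rKL _) u0p.
rewrite /visit (vertexE (inr _)) in vu.
have R := runr _ _ _ _ vu (visited_start c') pfM pm.
rewrite -[list_sign _ _ _]mulr1; apply: lab_eq_trans (lab_eq_sym HQ (mulr1 1) R) => //.
case: E => /= e he Ep; case: F => /= f hf Eq.
(* Grafting turns the leg [x] of [t] into the edge towards the root of [s], which is the label of
   [z0]. *)
have e0 : z0 = e x by apply: vS.2.1; rewrite hz0 /= he graft_leftx.
rewrite atS e0; exists (bij_ins e f x) => [[[b hb]|b]|] /=.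
- rewrite he /=; case: {-}_ / (boolP (b != x)) => [h'|]; rewrite ?hb //.
  by congr (inl (inl _)); apply: val_inj.
- by rewrite hf.
rewrite tcirc_act // Ep Eq tcirc_scale //; congr (tscale _ _).
have tagE v : tag (graft_tot (unsplit v)) =
    match v with inl v => tag (c v) | inr v => tag (c' v) end.
  by have := congr1 (fun st => tag (elt st)) (vertexE v); case: v.
rewrite -[_ :: L]/(map (@lshift _ _) (Defs.root t :: l) ++ map (@rshift _ _) (Defs.root s :: m)).
rewrite list_sign_graft; congr (_ * _); congr (list_sign _ _ _); apply/funext => v.
  exact: (esym (tagE (inl v))).
exact: (esym (tagE (inr v))).
Qed.
End Grafting.
End TreeValueOperations.

(** * The universal property of the free operad *)

Section LinearLifts.
Variables (k : fieldType) (M : Type) (R : free_mod k M -> Prop).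

Lemma plift_comp (E E' : lmodType k) (g : E -> E') (f : M -> E) (x : pres R) :
  linear g -> g (plift f x) = plift (g \o f) x.
Proof.
by move=> gl; rewrite /plift /free_lift (lin_sum gl); apply: eq_bigr => m _; rewrite (linZ gl).
Qed.

Lemma pres_ind (Pr : pres R -> Prop) :
  Pr 0 -> (forall a m u, Pr u -> Pr (a *: pgen R m + u)) -> forall u, Pr u.
Proof.
move=> h0 hl u; pose r := repr (u : qmod R).
have -> : u = \sum_(m <- msupp r) mcoeff m r *: pgen R m.
  rewrite -[LHS](reprK (u : qmod R)) -/r {1}[r]monalgE (lin_sum (@pi_qmod_linear _ _ R)).
  apply: eq_bigr => m _; rewrite -(linZ (@pi_qmod_linear _ _ R)); congr (\pi_(qmod R) _).
  by apply/malgP => m'; rewrite mcoeffZ !mcoeffU mulr_natr.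
elim: (enum_fset _) => [|m s IH]; first by rewrite big_nil.
by rewrite big_cons; exact: hl.
Qed.
End LinearLifts.

Section DecoratedTrees.
Variables (k : fieldType) (C : coldata k).

Definition tdec (X : finType) n (D : dtree C X n) (v : 'I_(nv (dt D))) : tot C 'I_(ar (dt D) v) :=
  existT _ (deg v) (dec v).
Arguments tdec {X n} D v.

(** The two clauses match the two kinds of [tree_rel]. Arbitrary proofs of the degree sum and
    decorations in total form keep degree casts out of the applications. *)
Definition tree_invariant (X : finType) n (E : lmodType k) (g : dtree C X n -> E) :=
  (forall (t : tree X) (d : 'I_(nv t) -> int) (e e1 e2 : \sum_v d v = n)
      (c c1 c2 : forall v, C 'I_(ar t v) (d v)) (v : 'I_(nv t)) a,
      (forall w, w != v -> c w = c1 w /\ c w = c2 w) -> c v = a *: c1 v + c2 v ->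
      g (DTree c e) = a *: g (DTree c1 e1) + g (DTree c2 e2)) /\
  (forall (D D' : dtree C X n) (s : tree_iso (dt D) (dt D')),
      (forall v, tdec D v = tact (iso_h s v) (tdec D' (s v))) ->
      g D = iso_sign k s (@deg _ _ _ _ D') *: g D').

Section Invariant.
Variables (X : finType) (n : int) (E : lmodType k) (g : dtree C X n -> E).
Hypothesis gi : tree_invariant g.

Lemma free_lift_tree_rel u : tree_rel u -> free_lift g u = 0.
Proof.
case=> [t d e c c1 c2 v a c_off c_on|t t' s d c e e'].
  rewrite (linB (free_lift_linear g)) (free_lift_linear g) !free_lift_gen.
  by rewrite (gi.1 _ _ _ e e _ _ _ _ _ c_off c_on) subrr.
rewrite (linB (free_lift_linear g)) (linZ (free_lift_linear g)) !free_lift_gen.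
rewrite (gi.2 (DTree (fun v => act C (iso_h s v) (c (s v))) e) (DTree c e') s) ?subrr //.
Qed.

Lemma plift_tree_linear : linear (plift g : free_car C X n -> E).
Proof. by apply: plift_linear => u /free_lift_tree_rel. Qed.

Lemma plift_tree_gen D : plift g (pgen _ D : free_car C X n) = g D.
Proof. by apply: plift_gen => u /free_lift_tree_rel. Qed.
End Invariant.

Lemma pgen_invariant (X : finType) n :
  tree_invariant (fun D : dtree C X n => pgen _ D : free_car C X n).
Proof.
split=> [t d e e1 e2 c c1 c2 v a c_off c_on|[t d c e] [t' d' c' e'] /= s h].
  rewrite (Prop_irrelevance e1 e) (Prop_irrelevance e2 e) /pgen -pi_qmod_linear.
  apply/qmod_eq/span_gen.
  exact: TreeRelLin c_off c_on.
have dE : d = fun v => d' (s v).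
  by apply/funext => v; exact: (congr1 (fun p : tot C _ => tag p) (h v)).
subst d; have cE : c = fun v => act C (iso_h s v) (c' (s v)).
  by apply: functional_extensionality_dep => v; exact: tot_inj (h v).
subst c; rewrite /pgen -(linZ (@pi_qmod_linear _ _ _)); apply/qmod_eq/span_gen.
exact: TreeRelIso.
Qed.
End DecoratedTrees.
Arguments tdec {k C X n} D v.

Section Evaluation.
Variables (k : fieldType) (C : coldata k) (Q : opdata k).
Hypothesis HQ : is_operad Q.
Let HC : is_collection Q := op_collection HQ.
Variable f : forall (X : finType) i, C X i -> Q X i.
Hypothesis f_linear : forall X i, linear (@f X i).
Hypothesis f_act : forall (X Y : finType) (e : bij X Y) i (c : C Y i),
  f (act C e c) = act Q e (f c).

Definition tot_map (X : finType) (c : tot C X) : tot Q X :=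
  existT _ (tag c) (f (tagged c)).

Lemma tot_map_act (X Y : finType) (e : bij X Y) c : tot_map (tact e c) = tact e (tot_map c).
Proof. by rewrite /tot_map /tact /= f_act. Qed.

Lemma tree_value_tag (X : finType) (t : tree X) (c : forall v, tot Q 'I_(ar t v)) q :
  tree_value c q -> tag q = \sum_v tag (c v).
Proof.
case=> l vl /lab_eq_tag /= ->; rewrite -big_enum -(perm_big _ (visiting_perm vl)) /= big_cons.
have : parents_first [set Defs.root t] l := vl.1.
have := visited_start c; rewrite -[tag (c _)]/(tag (elt (start c))).
elim: l [set _] (start c) {vl} => [|w l IH] K s vK /=; first by rewrite big_nil addr0.
case/and3P=> wK wp wl; rewrite (IH _ _ (visited_visit c vK wK wp) wl) big_cons addrA.
by have [z _ ->] := visit_at c vK wK wp.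
Qed.

Lemma tree_eval_exists (X : finType) n (D : dtree C X n) :
  exists u : Q X n, tree_value (fun v => tot_map (tdec D v)) (existT _ n u).
Proof.
have [[m u] h] := tree_value_exists (fun v => tot_map (tdec D v)).
have E : m = n by rewrite -(deg_sum D); exact: (tree_value_tag h).
by case: n / E D h => D h; exists u.
Qed.
Definition tree_eval (X : finType) n (D : dtree C X n) : Q X n :=
  sval (cid (tree_eval_exists D)).

Lemma tree_evalP (X : finType) n (D : dtree C X n) :
  tree_value (fun v => tot_map (tdec D v)) (existT (fun n => Q X n) n (tree_eval D)).
Proof. exact: svalP (cid (tree_eval_exists D)). Qed.

Lemma tree_eval_uniq (X : finType) n (D : dtree C X n) u :
  tree_value (fun v => tot_map (tdec D v)) (existT (fun n => Q X n) n u) -> tree_eval D = u.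
Proof. move=> h; exact: tot_inj (tree_value_uniq HQ (tree_evalP D) h). Qed.

Lemma tree_eval_invariant (X : finType) n : tree_invariant (@tree_eval X n).
Proof.
split=> [t d e e1 e2 c c1 c2 v a c_off c_on|D D' s h].
  have /= := tree_value_lin HQ (v0 := v) (a := a) _ _ (tree_evalP (DTree c e))
    (tree_evalP (DTree c1 e1)) (tree_evalP (DTree c2 e2)).
  case=> [w /c_off[E1 E2]||]; first by rewrite /tdec /= E1 -E2 E1.
    exists (d v), (f (c1 v)), (f (c2 v)); split=> //.
    by rewrite /tot_map /= c_on f_linear.
  move=> i [x1 [x2 [E E1 E2]]].
  have ni : i = n by have := congr1 (fun p : tot Q _ => tag p) E.
  by subst i; rewrite (tot_inj E) (tot_inj E1) (tot_inj E2).
apply: tot_inj; apply: (tree_value_iso HQ _ (tree_evalP D) (tree_evalP D')) => v.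
by rewrite h tot_map_act.
Qed.

Lemma tree_eval_relabel (X Y : finType) (e : bij X Y) n (D : dtree C Y n) :
  tree_eval (relabel_dt e D) = act Q e (tree_eval D).
Proof. exact/tree_eval_uniq/(tree_value_relabel HQ e (tree_evalP D)). Qed.

Lemma tree_eval_graft (X Y : finType) (x : X) i j n (h : i + j = n)
    (D : dtree C X i) (E : dtree C Y j) :
  tree_eval (graft_dt x h D E) = circ Q x h (tree_eval D) (tree_eval E).
Proof.
apply: tree_eval_uniq; rewrite tcircE.
have := tree_value_graft HQ x (tree_evalP D) (tree_evalP E).
congr (tree_value _ _); apply: functional_extensionality_dep => v.
have dE (u : 'I_(nv (dt D)) + 'I_(nv (dt E))) :
    graft_tot' (fun v => tot_map (tdec D v)) (fun v => tot_map (tdec E v)) u =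
    tot_map (existT (fun i => C 'I_(graft_ar' u) i) (graft_deg' u) (graft_dec' u)).
  by case: u.
exact: dE (split v).
Qed.

Lemma tree_eval_corolla (X : finType) n (c : C X n) : tree_eval (corolla_dt c) = f c.
Proof.
apply: tree_eval_uniq; have := tree_value_corolla HQ (existT (fun n => Q X n) n (f c)).
congr (tree_value _ _); apply: functional_extensionality_dep => v.
by rewrite -[RHS]/(tot_map (tact (bij_enum X) (existT (fun i => C X i) n c))) tot_map_act.
Qed.

Definition free_eval (X : finType) n (u : free_car C X n) : Q X n := plift (@tree_eval X n) u.

Lemma free_eval_linear (X : finType) n : linear (@free_eval X n).
Proof. exact/plift_tree_linear/tree_eval_invariant. Qed.

Lemma free_eval_gen (X : finType) n (D : dtree C X n) :
  free_eval (pgen _ D : free_car C X n) = tree_eval D.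
Proof. exact/plift_tree_gen/tree_eval_invariant. Qed.

Lemma free_eval_corolla (X : finType) n (c : C X n) : free_eval (corolla c) = f c.
Proof. by rewrite free_eval_gen tree_eval_corolla. Qed.

Lemma free_eval_act (X Y : finType) (e : bij X Y) n (u : free_car C Y n) :
  free_eval (free_act e u) = act Q e (free_eval u).
Proof.
rewrite /free_act (plift_comp _ _ (@free_eval_linear X n)).
rewrite [in RHS]/free_eval (plift_comp _ _ (act_linear HC e (i:=n))).
congr plift; apply/funext => D /=.
by rewrite free_eval_gen tree_eval_relabel.
Qed.

Lemma free_eval_circ (X Y : finType) (x : X) i j n (h : i + j = n)
    (p : free_car C X i) (q : free_car C Y j) :
  free_eval (free_circ x h p q) = circ Q x h (free_eval p) (free_eval q).
Proof.
rewrite /free_circ (plift_comp _ _ (@free_eval_linear _ n)).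
rewrite [in X in circ Q x h X _]/free_eval.
rewrite [RHS](plift_comp (g := fun p => circ Q x h p (free_eval q)) _ _ (circ_linearl HQ x h _)).
congr plift; apply/funext => D /=.
rewrite (plift_comp _ _ (@free_eval_linear _ n)).
rewrite [in RHS]/free_eval [RHS](plift_comp (g := circ Q x h _) _ _ (circ_linearr HQ x h _)).
by congr plift; apply/funext => E /=; rewrite free_eval_gen tree_eval_graft.
Qed.
End Evaluation.

(** * Generation of the free operad by corollas *)

Section GraftIso.
Variables (X Y : finType) (x : X) (t t' : tree X) (s s' : tree Y).
Variables (a : tree_iso t t') (b : tree_iso s s').

Definition tree_id (Z : finType) (u : tree Z) : tree_iso u u.
Proof.
by apply: (@TreeIso Z u u (bij_id _) (fun v => bij_id _)) => // v i /=; case: (glue u v i).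
Defined.

Definition graft_iso_fun (u : 'I_(nv t) + 'I_(nv s)) : 'I_(nv t') + 'I_(nv s') := sum_map a b u.
Let gfK : cancel graft_iso_fun (sum_map (binv a) (binv b)).
Proof. exact: sum_map_can (bfunK a) (bfunK b). Qed.
Let gfVK : cancel (sum_map (binv a) (binv b)) graft_iso_fun.
Proof. exact: sum_map_can (binvK a) (binvK b). Qed.
Definition graft_iso_v : bij 'I_(nv t + nv s) 'I_(nv t' + nv s') :=
  Bij (can_comp (@unsplitK _ _) (can_comp gfK (@splitK _ _)))
    (can_comp (can_comp (@unsplitK _ _) gfVK) (@splitK _ _)).

Lemma graft_iso_unsplit u : graft_iso_v (unsplit u) = unsplit (graft_iso_fun u).
Proof. exact: (congr1 (fun w => unsplit (graft_iso_fun w)) (unsplitK u)). Qed.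
Lemma graft_iso_lshift v : graft_iso_v (lshift (nv s) v) = lshift (nv s') (a v).
Proof. exact: (graft_iso_unsplit (inl v)). Qed.
Lemma graft_iso_rshift v : graft_iso_v (rshift (nv t) v) = rshift (nv t') (b v).
Proof. exact: (graft_iso_unsplit (inr v)). Qed.

Definition graft_iso_h' (u : 'I_(nv t) + 'I_(nv s)) :
    bij 'I_(graft_ar' u) 'I_(graft_ar' (graft_iso_fun u)) :=
  match u with inl v => iso_h a v | inr v => iso_h b v end.

(** [split (unsplit w)] is only propositionally equal to [w], so bijections between half-edges must
    be transported along that equality. *)
Definition graft_ar_cast (w w' : 'I_(nv t') + 'I_(nv s')) (e : w = w') :
    bij 'I_(graft_ar' w) 'I_(graft_ar' w') :=
  match e with erefl => bij_id _ end.

Definition graft_iso_h (v : 'I_(nv t + nv s)) :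
    bij 'I_(graft_ar v) 'I_(graft_ar (graft_iso_v v)) :=
  Defs.bij_comp (graft_ar_cast (esym (unsplitK (graft_iso_fun (split v)))))
    (graft_iso_h' (split v)).

Let left_iso y : graft_left x s' (sum_map id a y) = sum_map id graft_iso_v (graft_left x s y).
Proof.
case: y => [c|v]; last exact: (congr1 inr (esym (graft_iso_lshift v))).
rewrite /=; case: {-}_ / (boolP (c != x)) => // _; rewrite -(iso_root b).
exact: (congr1 inr (esym (graft_iso_rshift _))).
Qed.
Let right_iso y : graft_right x t' (sum_map id b y) = sum_map id graft_iso_v (graft_right x t y).
Proof.
by case: y => [c|v] //; exact: (congr1 inr (esym (graft_iso_rshift _))).
Qed.

Lemma graft_iso_root : graft_iso_v (graft_root t s) = graft_root t' s'.
Proof. by rewrite graft_iso_lshift iso_root. Qed.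

Lemma graft_iso_glue v i :
  graft_glue x (graft_iso_h v i) = sum_map id graft_iso_v (@graft_glue X Y x t s v i).
Proof.
rewrite /graft_glue /graft_iso_h /=.
have castE w w' (e : w = w') j : graft_glue' x (graft_ar_cast e j) = graft_glue' x j.
  by case: w' / e.
rewrite castE; move: i; rewrite /graft_ar; case: (split v) => w i /=.
  by rewrite iso_glue left_iso.
by rewrite iso_glue right_iso.
Qed.

Definition graft_iso : tree_iso (graft x t s) (graft x t' s') :=
  @TreeIso _ (graft x t s) (graft x t' s') graft_iso_v graft_iso_h graft_iso_root graft_iso_glue.

(** Both sides are computed on the list of the vertices of [t] followed by those of [s]; the
    isomorphism sends blocks to blocks. *)
Lemma iso_sign_graft (k : fieldType) (d : 'I_(nv t' + nv s') -> int) :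
  iso_sign k graft_iso d =
  iso_sign k a (fun v => d (lshift _ v)) * iso_sign k b (fun v => d (rshift _ v)).
Proof.
pose l := map (@lshift (nv t) (nv s)) (enum 'I_(nv t)) ++
  map (@rshift (nv t) (nv s)) (enum 'I_(nv s)).
have pl : perm_eq l (enum 'I_(nv t + nv s)).
  apply: uniq_perm; rewrite ?enum_uniq //.
    rewrite cat_uniq (map_inj_uniq (@lshift_inj _ _)) (map_inj_uniq (@rshift_inj _ _)).
    rewrite !enum_uniq andbT; apply/hasPn => _ /mapP[v _ ->]; apply/mapP => -[w _].
    by move/(congr1 val) => /=; have := ltn_ord w; lia.
  move=> v; rewrite mem_enum mem_cat -(splitK v); case: (split v) => w /=.
    by rewrite map_f ?mem_enum.
  by rewrite orbC map_f ?mem_enum.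
have gl : map graft_iso l = map (@lshift (nv t') (nv s')) (map a (enum 'I_(nv t))) ++
    map (@rshift (nv t') (nv s')) (map b (enum 'I_(nv s))).
  rewrite /l map_cat -!map_comp; congr (_ ++ _); apply: eq_map => v.
    exact: graft_iso_lshift.
  exact: graft_iso_rshift.
rewrite (iso_sign_list k graft_iso d pl) gl (iso_sign_list k a _ (perm_refl _)).
rewrite (iso_sign_list k b _ (perm_refl _)) !list_sign_graft mulrACA.
congr (_ * _ * (_ * _)); congr (list_sign _ _ _); apply/funext => v.
  exact: (congr1 d (graft_iso_lshift v)).
exact: (congr1 d (graft_iso_rshift v)).
Qed.
End GraftIso.

Section GraftPresentation.
Variables (k : fieldType) (C : coldata k).
Hypothesis HC : is_collection C.

Lemma iso_sign_id (X : finType) (t : tree X) (d : 'I_(nv t) -> int) :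
  iso_sign k (tree_id t) d = 1.
Proof.
by rewrite (iso_sign_list k _ _ (perm_refl _)) map_id (_ : d \o _ = d) ?list_sign_sq.
Qed.

Section Iso.
Variables (X Y : finType) (x : X) (i j n : int) (h : i + j = n).
Variables (D D' : dtree C X i) (E E' : dtree C Y j).
Variables (a : tree_iso (dt D) (dt D')) (b : tree_iso (dt E) (dt E')).
Hypotheses (aD : forall v, tdec D v = tact (iso_h a v) (tdec D' (a v)))
  (bE : forall v, tdec E v = tact (iso_h b v) (tdec E' (b v))).

Lemma pgen_graft_iso :
  pgen _ (graft_dt x h D E) =
  (iso_sign k a (@deg _ _ _ _ D') * iso_sign k b (@deg _ _ _ _ E')) *:
    pgen _ (graft_dt x h D' E') :> free_car C (ins x Y) n.
Proof.
rewrite ((pgen_invariant C _ _).2 (graft_dt x h D E) (graft_dt x h D' E') (graft_iso x a b)).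
  rewrite iso_sign_graft; congr ((_ * _) *: _); congr (iso_sign _ _ _); apply/funext => v.
    exact: (congr1 (@graft_deg' _ _ _ _ _ _ D' E') (unsplitK (inl v))).
  exact: (congr1 (@graft_deg' _ _ _ _ _ _ D' E') (unsplitK (inr v))).
pose gdec (D0 : dtree C X i) (E0 : dtree C Y j) u : tot C 'I_(graft_ar' u) :=
  existT (fun i => C 'I_(graft_ar' u) i) (graft_deg' u) (@graft_dec' _ _ _ _ _ _ D0 E0 u).
have castE (Z : finType) w w' (e : w = w') (g : bij Z 'I_(graft_ar' w)) :
    tact (Defs.bij_comp (graft_ar_cast e) g) (gdec D' E' w') = tact g (gdec D' E' w).
  by case: w' / e; congr (tact _ _); exact: bij_ext.
move=> v; rewrite -[LHS]/(gdec D E (split v)).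
rewrite -[RHS]/(tact (graft_iso_h a b v) (gdec D' E' (split (graft_iso_v a b v)))).
rewrite /graft_iso_h /= castE.
have gdecE u : gdec D E u = tact (graft_iso_h' a b u) (gdec D' E' (graft_iso_fun a b u)).
  by case: u => w; [exact: aD | exact: bE].
exact: gdecE.
Qed.
End Iso.

Lemma tdec_id (X : finType) n (D : dtree C X n) v :
  tdec D v = tact (iso_h (tree_id (dt D)) v) (tdec D (tree_id (dt D) v)).
Proof. by rewrite [RHS](tact_id HC). Qed.

Section Graft.
Variables (X Y : finType) (x : X) (i j n : int) (h : i + j = n).

Lemma graft_invariantr (D : dtree C X i) :
  tree_invariant (fun E : dtree C Y j => pgen _ (graft_dt x h D E) : free_car C (ins x Y) n).
Proof.
split=> [t d e e1 e2 c c1 c2 v a c_off c_on|E E' s hs]; last first.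
  by rewrite (pgen_graft_iso x h (@tdec_id _ _ D) hs) iso_sign_id mul1r.
pose g := @graft_dec' _ _ _ _ _ _ D (DTree c e).
pose g1 := @graft_dec' _ _ _ _ _ _ D (DTree c1 e1).
pose g2 := @graft_dec' _ _ _ _ _ _ D (DTree c2 e2).
apply: ((pgen_invariant C _ n).1 (graft x (dt D) t)
  (fun u => @graft_deg' _ _ _ _ _ _ D (DTree c e) (split u)) _ _ _ _ _ _ (rshift (nv (dt D)) v))
  => [w wv|].
  have uv : split w <> inr v by move=> E; move: wv; rewrite -(splitK w) E eqxx.
  have off u : u <> inr v -> g u = g1 u /\ g u = g2 u.
    by case: u => u //= h0; apply: c_off; apply: contra_notN h0 => /eqP ->.
  exact: off uv.
have on u : u = inr v -> g u = a *: g1 u + g2 u by case: u => // u [->].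
exact: on (unsplitK (inr v)).
Qed.

Lemma graft_invariantl (E : dtree C Y j) :
  tree_invariant (fun D : dtree C X i => pgen _ (graft_dt x h D E) : free_car C (ins x Y) n).
Proof.
split=> [t d e e1 e2 c c1 c2 v a c_off c_on|D D' s hs]; last first.
  by rewrite (pgen_graft_iso x h hs (@tdec_id _ _ E)) iso_sign_id mulr1.
pose g := @graft_dec' _ _ _ _ _ _ (DTree c e) E.
pose g1 := @graft_dec' _ _ _ _ _ _ (DTree c1 e1) E.
pose g2 := @graft_dec' _ _ _ _ _ _ (DTree c2 e2) E.
apply: ((pgen_invariant C _ n).1 (graft x t (dt E))
  (fun u => @graft_deg' _ _ _ _ _ _ (DTree c e) E (split u)) _ _ _ _ _ _ (lshift (nv (dt E)) v))
  => [w wv|].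
  have uv : split w <> inl v by move=> F; move: wv; rewrite -(splitK w) F eqxx.
  have off u : u <> inl v -> g u = g1 u /\ g u = g2 u.
    by case: u => u //= h0; apply: c_off; apply: contra_notN h0 => /eqP ->.
  exact: off uv.
have on u : u = inl v -> g u = a *: g1 u + g2 u by case: u => // u [->].
exact: on (unsplitK (inl v)).
Qed.

(** A [plift] computes on generators once its function respects the relations. For the two nested
    lifts this is invariance of grafting in each argument separately. *)
Lemma free_circ_gen (D : dtree C X i) (E : dtree C Y j) :
  free_circ x h (pgen _ D : free_car C X i) (pgen _ E : free_car C Y j) =
  pgen _ (graft_dt x h D E).
Proof.
rewrite /free_circ -[RHS](plift_tree_gen (graft_invariantl E)).
by congr plift; apply/funext => D'; rewrite (plift_tree_gen (graft_invariantr D')).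
Qed.
End Graft.

Section Relabel.
Variables (X Y : finType) (e : bij X Y) (n : int).

Lemma relabel_iso_glue (t t' : tree Y) (s : tree_iso t t') v i :
  relabel_glue e (iso_h s v i) = sum_map id s (@relabel_glue X Y e t v i).
Proof. by rewrite /relabel_glue iso_glue; case: (glue t v i). Qed.

Definition relabel_iso (t t' : tree Y) (s : tree_iso t t') :
    tree_iso (relabel e t) (relabel e t') :=
  @TreeIso _ (relabel e t) (relabel e t') s (iso_h s) (iso_root s) (@relabel_iso_glue t t' s).

Lemma relabel_invariant :
  tree_invariant (fun D : dtree C Y n => pgen _ (relabel_dt e D) : free_car C X n).
Proof.
split=> [t d e0 e1 e2 c c1 c2 v a c_off c_on|D D' s hs].
  exact: ((pgen_invariant C X n).1 (relabel e t) d e0 e1 e2 c c1 c2 v).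
exact: ((pgen_invariant C X n).2 (relabel_dt e D) (relabel_dt e D') (relabel_iso s) hs).
Qed.

Lemma free_act_gen (D : dtree C Y n) :
  free_act e (pgen _ D : free_car C Y n) = pgen _ (relabel_dt e D).
Proof. exact: plift_tree_gen relabel_invariant D. Qed.
End Relabel.
End GraftPresentation.

Section Generation.
Variables (k : fieldType) (C : coldata k).
Hypothesis HC : is_collection C.

(** The free operad with zero differential, packaged so that traversals can be run inside it. *)
Definition free_opdata : opdata k :=
  @OpData k (@ColData k (free_car C) (@free_act k C) (fun _ _ _ _ _ => 0)) (@free_circ k C).

Definition tot_corolla (X : finType) (c : tot C X) : tot free_opdata X :=
  existT (fun n => free_opdata X n) (tag c) (corolla (tagged c)).

Section OneTree.
Variables (X : finType) (t : tree X) (c : forall v : 'I_(nv t), tot C 'I_(ar t v)).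

(* s is represented by a tree isomorphic to the restriction of t to K. *)
Definition subtree (K : {set 'I_(nv t)}) (s : lab free_opdata (X + 'I_(nv t))) : Prop :=
  exists n (D : dtree C (lset s) n) (f : 'I_(nv (dt D)) -> 'I_(nv t))
      (g : forall v, bij 'I_(ar (dt D) v) 'I_(ar t (f v))),
    [/\ injective f /\ (forall w, w \in K <-> exists v, f v = w),
        f (Defs.root (dt D)) = Defs.root t,
        forall v i, glue t (f v) (g v i) =
          match glue (dt D) v i with inl z => label z | inr w => inr (f w) end,
        forall v, tdec D v = tact (g v) (c (f v))
      & elt s = existT (fun n => free_opdata (lset s) n) n (pgen _ D)].

Lemma subtree_start : subtree [set Defs.root t] (start (fun v => tot_corolla (c v))).
Proof.
exists (tag (c (Defs.root t))), (corolla_dt (tagged (c (Defs.root t)))).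
exists (fun=> Defs.root t), (fun=> bij_enum _); split=> //.
split=> [u v _|w]; first by rewrite (ord1 u) (ord1 v).
by rewrite inE; split=> [/eqP ->|[_ ->]]; first by exists ord0.
Qed.

(** Grafting a corolla adds one vertex, numbered last and sent to [w]; the input [z], labelled by
    [w], becomes the inner edge joining [w] to its parent. *)
Lemma subtree_visit K s w : visited K s -> w \notin K -> has_parent K w -> subtree K s ->
  subtree (w |: K) (visit (fun v => tot_corolla (c v)) s w).
Proof.
move=> vK wK wp; have [z hz ->] := visit_at (fun v => tot_corolla (c v)) vK wK wp.
case=> n [D [f [g [[fI fK] f_root f_glue f_dec f_elt]]]].
pose E := corolla_dt (tagged (c w)).
pose f' (u : 'I_(nv (dt D)) + 'I_(nv (dt E))) : 'I_(nv t) :=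
  match u with inl v => f v | inr _ => w end.
pose g' u : bij 'I_(graft_ar' u) 'I_(ar t (f' u)) :=
  match u with inl v => g v | inr v => bij_enum _ end.
have fw v : f v <> w by move=> E'; case/negP: wK; apply/fK; exists v.
exists (n + tag (c w)), (graft_dt z erefl D E), (fun v => f' (split v)), (fun v => g' (split v)).
split.
- split=> [u v|u].
    rewrite -{2}(splitK u) -{2}(splitK v); case: (split u) => a; case: (split v) => b //=.
    + by move/fI ->.
    + by move/fw.
    + by move/esym/fw.
    by rewrite (ord1 a) (ord1 b).
  rewrite in_setU1; split=> [/orP[/eqP ->|/fK[v <-]]|[v]].
  + by exists (unsplit (inr ord0)); rewrite unsplitK.
  + by exists (unsplit (inl v)); rewrite unsplitK.
  case: (split v) => a /= <-; last by rewrite eqxx.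
  by apply/orP; right; apply/fK; exists a.
- exact: etrans (congr1 f' (unsplitK (inl (Defs.root (dt D))))) f_root.
- have glueE u (i : 'I_(graft_ar' u)) : glue t (f' u) (g' u i) =
      match graft_glue' z i with
      | inl y => ins_label (label (l:=s)) (glue t w) y
      | inr v => inr (f' (split v))
      end.
    case: u i => [v|v] i /=; last by [].
    rewrite f_glue; case: (glue (dt D) v i) => [y|v'] /=; last first.
      by have -> : split (lshift 1 v') = inl v' by exact: (unsplitK (inl v')).
    case: {-}_ / (boolP (y != z)) => [//|]; rewrite negbK => /eqP ->.
    rewrite hz; have -> // : split (rshift (nv (dt D)) (ord0 : 'I_1)) = inr ord0.
    exact: (unsplitK (inr ord0)).
  by move=> v i; exact: glueE.
- have decE u : existT (fun i => C 'I_(graft_ar' u) i) (graft_deg' u)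
      (@graft_dec' _ _ _ _ _ _ D E u) = tact (g' u) (c (f' u)).
    by case: u => v; [exact: f_dec | ].
  by move=> v; exact: decE.
rewrite /= f_elt /tot_corolla /tcirc /=; congr existT.
exact: (free_circ_gen HC).
Qed.

Lemma subtree_run K s l : visited K s -> parents_first K l -> subtree K s ->
  subtree (K :|: [set v in l]) (run (fun v => tot_corolla (c v)) s l).
Proof.
elim: l K s => [|w l IH] K s vK /=.
  by rewrite (_ : [set v in [::]] = set0) ?setU0 //; apply/setP => v; rewrite !inE.
case/and3P=> wK wp wl sK.
have := IH _ _ (visited_visit _ vK wK wp) wl (subtree_visit vK wK wp sK).
by congr (subtree _ _); apply/setP => v; rewrite !inE orbA; congr (_ || _); rewrite orbC.
Qed.
End OneTree.

Lemma iso_sign_neq0 (X : finType) (t t' : tree X) (s : tree_iso t t') d :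
  iso_sign k s d != 0.
Proof.
by rewrite (iso_sign_list k s d (perm_refl _)) mulf_neq0 ?list_sign_neq0.
Qed.

Variable Pr : forall (X : finType) n, free_car C X n -> Prop.
Hypothesis Pr0 : forall X n, Pr (0 : free_car C X n).
Hypothesis Pr_lin : forall (X : finType) n a (u v : free_car C X n),
  Pr u -> Pr v -> Pr (a *: u + v).
Hypothesis Pr_act : forall (X Y : finType) (e : bij X Y) n (u : free_car C Y n),
  Pr u -> Pr (free_act e u).
Hypothesis Pr_circ : forall (X Y : finType) (x : X) i j n (h : i + j = n)
    (p : free_car C X i) (q : free_car C Y j), Pr p -> Pr q -> Pr (free_circ x h p q).
Hypothesis Pr_corolla : forall (X : finType) n (c : C X n), Pr (corolla c).

(** Traversing a decorated tree with corollas as decorations gives an element built by graftings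
    alone. By [subtree_run] it is represented by a tree isomorphic to the given one after
    relabelling its legs, so generators are reached up to sign. *)
Lemma free_ind (X : finType) n (u : free_car C X n) : Pr u.
Proof.
elim/pres_ind: u => [|a D u hu]; first exact: Pr0.
apply: Pr_lin hu; set t := dt D; pose c := tdec D.
have [l vl] := visiting_exists t.
pose c' v := tot_corolla (c v).
have full w : w \in [set Defs.root t] :|: [set v in l].
  by have := vl.2 w; rewrite !inE; case: eqP => //= _ ->.
have vR := visited_run c' (visited_start c') vl.1.
have := subtree_run (visited_start c') vl.1 (subtree_start c).
have PrR : Pr (tagged (elt (run c' (start c') l))).
  apply: (@run_elt _ _ _ _ c' (fun Z p => Pr (tagged p))) => /= [v|Y Z y p q hp hq|].
  - exact: Pr_corolla.
  - exact: Pr_circ.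
  - exact: Pr_corolla.
have [e he] := visiting_legs c' vl.
move: PrR e he; rewrite -/c'; case: (run _ _ _) => Z h p /= Prp e he.
case=> m [E [f [g [[fI fK] f_root f_glue f_dec /= f_elt]]]].
have f_onto : (#|'I_(nv t)| <= #|'I_(nv (dt E))|)%N.
  rewrite -!cardsT (_ : [set: 'I_(nv t)] = f @: [set: _]) ?leq_imset_card //.
  by apply/setP => w; have /fK[v <-] := full w; rewrite inE imset_f.
(* All vertices have been visited, so the embedding [f] of the rebuilt tree is onto. *)
pose fb := bij_of_inj fI f_onto.
have fb_glue v i : glue t (fb v) (g v i) = sum_map id fb (@relabel_glue _ _ e (dt E) v i).
  rewrite f_glue /relabel_glue; case: (glue (dt E) v i) => //= z.
  by rewrite -he binvK.
pose s := @TreeIso X (relabel e (dt E)) t fb g f_root fb_glue.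
have mn : m = n.
  transitivity (\sum_(v < nv t) @deg _ _ _ _ D v); last exact: deg_sum.
  rewrite (reindex fb); last by exists (binv fb) => v _; rewrite ?bfunK ?binvK.
  apply: etrans (esym (deg_sum E)) _; apply: eq_bigr => v _.
  exact: (congr1 (fun p : tot C _ => tag p) (f_dec v)).
subst m.
have := (pgen_invariant C X n).2 (relabel_dt e E) D s f_dec.
rewrite -free_act_gen // => E1.
(* The sign of the isomorphism is invertible, so the generator is a multiple of the relabelled
   element. *)
rewrite -[pgen _ D]scale1r -(mulVf (iso_sign_neq0 s (@deg _ _ _ _ D))) -scalerA -E1.
rewrite -[_ *: _]addr0; apply: Pr_lin => //; apply: Pr_act.
by move: Prp; rewrite f_elt.
Qed.
End Generation.

(** * The Maurer-Cartan equation in coinvariants *)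

Section Coinvariants.
Variables (k : fieldType) (R : opdata k).
Hypothesis char0 : [pchar k] =i pred0.
Hypothesis act_lin : forall (X Y : finType) (e : bij X Y) i, linear (act R e : R Y i -> R X i).
Hypothesis act_one : forall X i (u : R X i), act R (bij_id X) u = u.
Hypothesis act_mul : forall (X Y Z : finType) (f : bij Y Z) (e : bij X Y) i (u : R Z i),
  act R (Defs.bij_comp f e) u = act R e (act R f u).

Let natr_neq0 n : (0 < n)%N -> n%:R != 0 :> k.
Proof. by move=> n0; rewrite (pcharf0P k).1 ?lt0n_neq0 // -lt0n. Qed.

Lemma natr_fact_neq0 n : (n`!)%:R != 0 :> k.
Proof. exact/natr_neq0/fact_gt0. Qed.

Lemma ord_bij_eq m n : bij 'I_m 'I_n -> m = n.
Proof. by move=> e; have := bij_eq_card (Bijective (bfunK e) (binvK e)); rewrite !card_ord. Qed.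

Lemma bij_is_perm (X : finType) (e : bij X X) : exists s : {perm X}, e = bij_perm s.
Proof.
by exists (perm (can_inj (bfunK e))); apply: bij_ext => x; rewrite /= permE.
Qed.

Section Degree.
Variables (n : nat) (p : int).
Implicit Types (u : R 'I_n p) (c : coinv R n p).

Definition cls u : coinv R n p := \pi_(qmod (@coinv_rel k R n p)) u.

Lemma cls_linear : linear cls.
Proof. exact: pi_qmod_linear. Qed.

Lemma cls_repr c : cls (repr (c : qmod _)) = c.
Proof. exact: reprK. Qed.

Lemma cls_perm (s : {perm 'I_n}) u : cls (act R (bij_perm s) u) = cls u.
Proof. by apply/esym/qmod_eq/span_gen; exact: CoinvRel. Qed.

Definition perm_sum u : R 'I_n p := \sum_(s : {perm 'I_n}) act R (bij_perm s) u.

Lemma perm_sum_linear : linear perm_sum.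
Proof.
move=> a u v; rewrite /perm_sum scaler_sumr -big_split /=.
by apply: eq_bigr => s _; rewrite act_lin.
Qed.

Lemma bij_permM (s s' : {perm 'I_n}) :
  bij_perm (s * s')%g = Defs.bij_comp (bij_perm s') (bij_perm s).
Proof. by apply: bij_ext => i; rewrite /= permM. Qed.

Lemma perm_sum_act s u : perm_sum (act R (bij_perm s) u) = perm_sum u.
Proof.
rewrite /perm_sum [RHS](reindex_inj (mulIg s)) /=.
by apply: eq_bigr => s' _; rewrite -act_mul bij_permM.
Qed.

Lemma act_perm_sum s u : act R (bij_perm s) (perm_sum u) = perm_sum u.
Proof.
rewrite /perm_sum [RHS](reindex_inj (mulgI s)) /= (lin_sum (act_lin _ (i:=p))).
by apply: eq_bigr => s' _; rewrite -act_mul bij_permM.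
Qed.

(** The sum over the group annihilates the relations of coinvariants, so the representative chosen
    by [symmetrize] is immaterial. *)
Lemma symmetrize_cls u : symmetrize (cls u) = perm_sum u.
Proof.
rewrite /symmetrize -/(perm_sum _); apply/subr0_eq; rewrite -(linB perm_sum_linear).
have /qmod_eq : \pi_(qmod (@coinv_rel k R n p)) (repr (cls u : qmod _)) =
    \pi_(qmod (@coinv_rel k R n p)) u.
  exact: reprK.
elim=> [_ [s v]||a v w _ hv _ hw].
- by rewrite (linB perm_sum_linear) perm_sum_act subrr.
- exact: lin0 perm_sum_linear.
by rewrite perm_sum_linear hv hw scaler0 addr0.
Qed.

Lemma symmetrize_act s c : act R (bij_perm s) (symmetrize c) = symmetrize c.
Proof. exact: act_perm_sum. Qed.

Lemma cls_perm_sum u : cls (perm_sum u) = (n`!)%:R *: cls u.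
Proof.
rewrite /perm_sum (lin_sum cls_linear) (eq_bigr (fun=> cls u)) => [|s _]; last exact: cls_perm.
by rewrite sumr_const card_Sn scaler_nat.
Qed.

Lemma cls_symmetrize c : cls (symmetrize c) = (n`!)%:R *: c.
Proof. by rewrite -[X in symmetrize X]cls_repr symmetrize_cls cls_perm_sum cls_repr. Qed.

Lemma symmetrize_inj : injective (@symmetrize k R n p).
Proof.
move=> c c' /(congr1 cls); rewrite !cls_symmetrize.
by move/(scalerI (natr_fact_neq0 n)).
Qed.

(** The sum over the group depends only on the class, and on an invariant it is multiplication by
    n!, injective in characteristic zero. *)
Lemma invariant_cls0 u : (forall s, act R (bij_perm s) u = u) -> cls u = 0 -> u = 0.
Proof.
move=> hu u0; have E : perm_sum u = (n`!)%:R *: u.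
  by rewrite /perm_sum (eq_bigr (fun=> u)) // sumr_const card_Sn scaler_nat.
apply: (scalerI (natr_fact_neq0 n)); rewrite scaler0 -E -symmetrize_cls u0.
by rewrite -(lin0 cls_linear) symmetrize_cls (lin0 perm_sum_linear).
Qed.

Lemma symmetrize_surj u : (forall s, act R (bij_perm s) u = u) ->
  symmetrize ((n`!)%:R^-1 *: cls u) = u.
Proof.
move=> hu; rewrite -(linZ cls_linear) symmetrize_cls (linZ perm_sum_linear).
rewrite /perm_sum (eq_bigr (fun=> u)) // sumr_const card_Sn -scaler_nat scalerA.
by rewrite mulVf ?scale1r ?natr_fact_neq0.
Qed.

(** Two numberings of [Z] differ by a permutation, which coinvariants do not see. *)
Lemma cls_act (Z : finType) (e e' : bij 'I_n Z) (u : R Z p) :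
  cls (act R e u) = cls (act R e' u).
Proof.
have [s sE] := bij_is_perm (Defs.bij_comp (bij_inv e) e').
have -> : e' = Defs.bij_comp e (bij_perm s).
  by rewrite -sE; apply: bij_ext => x /=; rewrite binvK.
by rewrite act_mul cls_perm.
Qed.
End Degree.

Lemma act_symmetrize m n p (e : bij 'I_m 'I_n) (phi : chat R p) :
  act R e (symmetrize (phi n)) = symmetrize (phi m).
Proof.
have mn := ord_bij_eq e; subst m; have [s ->] := bij_is_perm e.
exact: symmetrize_act.
Qed.

(** The vertices of a two-vertex tree have input sets other than ['I_n], so the invariants are
    spread to all finite sets; by [sym_familyE] every numbering gives the same result. *)
Definition sym_family p (phi : chat R p) (X : finType) : R X p :=
  act R (bij_inv (bij_enum X)) (symmetrize (phi #|X|)).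

Lemma sym_familyE p (phi : chat R p) (X : finType) n (e : bij X 'I_n) :
  sym_family phi X = act R e (symmetrize (phi n)).
Proof.
rewrite /sym_family -(act_symmetrize (Defs.bij_comp e (bij_enum X))) -act_mul.
by rewrite (_ : Defs.bij_comp _ _ = e) //; apply: bij_ext => x /=; rewrite enum_rankK.
Qed.

Lemma sym_family_act p (phi : chat R p) (X Y : finType) (e : bij X Y) :
  act R e (sym_family phi Y) = sym_family phi X.
Proof.
rewrite [sym_family phi Y]/sym_family -act_mul.
by rewrite (sym_familyE phi (Defs.bij_comp (bij_inv (bij_enum Y)) e)).
Qed.

Section Curvature.
Hypothesis dif_lin : forall X i j (h : i + 1 = j), linear (dif R h : R X i -> R X j).
Hypothesis act_dif : forall (X Y : finType) (e : bij X Y) i j (h : i + 1 = j) (u : R Y i),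
  dif R h (act R e u) = act R e (dif R h u).
Hypothesis circ_linl : forall (X Y : finType) (x : X) i j n (h : i + j = n) (q : R Y j),
  linear (fun p : R X i => circ R x h p q).
Hypothesis circ_linr : forall (X Y : finType) (x : X) i j n (h : i + j = n) (p : R X i),
  linear (fun q : R Y j => circ R x h p q).
Hypothesis act_circ : forall (X X' Y Y' : finType) (e : bij X X') (f : bij Y Y') (x : X)
    i j n (h : i + j = n) (p : R X' i) (q : R Y' j),
  act R (bij_ins e f x) (circ R (e x) h p q) = circ R x h (act R e p) (act R f q).

Definition split_sum p q (h : p + p = q) (f : forall X : finType, R X p) (X : finType) : R X q :=
  \sum_(S : {set X}) act R (bij_inv (bij_cut S))
    (circ R (None : cut_low S) h (f (cut_low S)) (f (cut_up S))).

Lemma cls_circ m n N (E : (m + n)%N = N) (X Y : finType) (x : X) p q r (h : p + q = r)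
    (e : bij X 'I_m.+1) (f : bij Y 'I_n) (g : bij 'I_N (ins x Y)) u v :
  cls (act R g (circ R x h (act R e u) (act R f v))) = cls (ord_circ E (e x) h u v).
Proof.
rewrite -act_circ -act_mul /ord_circ; exact: cls_act.
Qed.

Section PreLie.
Variables (m n N : nat) (E : (m + n)%N = N) (p q r : int) (h : p + q = r).
Implicit Types (u : R 'I_m.+1 p) (v : R 'I_n q).

Let W u v := cls (\sum_(i < m.+1) ord_circ E i h u v).

Let W_linl v : linear (W^~ v).
Proof.
move=> a u u'; rewrite /W -(cls_linear a); congr cls.
rewrite scaler_sumr -big_split; apply: eq_bigr => i _ /=.
by rewrite /ord_circ circ_linl act_lin.
Qed.
Let W_linr u : linear (W u).
Proof.
move=> a v v'; rewrite /W -(cls_linear a); congr cls.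
rewrite scaler_sumr -big_split; apply: eq_bigr => i _ /=.
by rewrite /ord_circ circ_linr act_lin.
Qed.

Let ord_circ_perm i s s' u v :
  cls (ord_circ E i h (act R (bij_perm s) u) (act R (bij_perm s') v)) =
  cls (ord_circ E (s i) h u v).
Proof. exact: cls_circ. Qed.

Let W_perm s s' u v : W (act R (bij_perm s) u) (act R (bij_perm s') v) = W u v.
Proof.
rewrite /W !(lin_sum (@cls_linear _ _)) [RHS](reindex_inj (@perm_inj _ s)) /=.
by apply: eq_bigr => i _; rewrite ord_circ_perm.
Qed.

Let W_perm_sum u v : W (perm_sum u) (perm_sum v) = (m.+1`! * n`!)%:R *: W u v.
Proof.
rewrite {1}/perm_sum (lin_sum (W_linl _)) (eq_bigr (fun=> (n`!)%:R *: W u v)) => [|s _].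
  by rewrite sumr_const card_Sn -scaler_nat scalerA natrM.
rewrite /perm_sum (lin_sum (W_linr _)) (eq_bigr (fun=> W u v)) => [|s' _]; last exact: W_perm.
by rewrite sumr_const card_Sn -scaler_nat.
Qed.

(** All inputs of a symmetrized element give the same class, so a single term is the sum over the
    inputs divided by m + 1. By bilinearity that sum carries the factor (m + 1)! n!, which leaves m!
    n!. *)
Lemma cls_ord_circ_sym i u v :
  cls (ord_circ E i h (perm_sum u) (perm_sum v)) =
  (m`! * n`!)%:R *: cls (\sum_(i < m.+1) ord_circ E i h u v).
Proof.
have indep j : cls (ord_circ E j h (perm_sum u) (perm_sum v)) =
    cls (ord_circ E i h (perm_sum u) (perm_sum v)).
  rewrite -[in LHS](act_perm_sum (tperm j i) u) -[in LHS](act_perm_sum 1%g v).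
  by rewrite ord_circ_perm tpermL.
apply: (scalerI (natr_neq0 (ltn0Sn m))); rewrite scalerA -natrM mulnA -factS.
rewrite -[RHS]W_perm_sum /W (lin_sum (@cls_linear _ _)).
rewrite (eq_bigr (fun=> cls (ord_circ E i h (perm_sum u) (perm_sum v)))) //.
by rewrite sumr_const card_ord scaler_nat.
Qed.
End PreLie.

Lemma bij_of_card (X : finType) n : #|X| = n -> exists e : bij X 'I_n, True.
Proof. by move=> <-; exists (bij_inv (bij_enum X)). Qed.

(** Each tree with m legs at its lower vertex contributes m! (N - m)! times the same summand of the
    pre-Lie product. There are C(N, N - m) of them, and the constants multiply to N! independently
    of m. *)
Lemma cls_split_sum p q (h : p + p = q) (phi : chat R p) N :
  cls (split_sum h (sym_family phi) 'I_N) = (N`!)%:R *: prelie h phi phi N.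
Proof.
pose T (m : 'I_N.+1) : coinv R N q := cls (ord_circ (subnKC (ltnSE (ltn_ord m))) ord0 h
  (symmetrize (phi m.+1)) (symmetrize (phi (N - m)%N))).
have ST (S : {set 'I_N}) (m : 'I_N.+1) : #|S| = (N - m)%N ->
    cls (act R (bij_inv (bij_cut S)) (circ R (None : cut_low S) h
      (sym_family phi (cut_low S)) (sym_family phi (cut_up S)))) = T m.
  move=> Sm; pose mN := ltnSE (ltn_ord m).
  have [e _] : exists e : bij (cut_low S) 'I_m.+1, True.
    apply: bij_of_card; rewrite card_option card_sig; congr _.+1.
    have := cardsC S; rewrite card_ord Sm => H.
    by transitivity #|~: S|; [apply: eq_card => z; rewrite !inE | have := mN; lia].
  have [f _] : exists f : bij (cut_up S) 'I_(N - m), True.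
    by apply: bij_of_card; rewrite card_sig -Sm.
  rewrite (sym_familyE phi e) (sym_familyE phi f) (cls_circ (subnKC mN)).
  by rewrite cls_ord_circ_sym -(cls_ord_circ_sym _ _ ord0).
rewrite /split_sum (lin_sum (@cls_linear _ _)) /prelie scaler_sumr.
(* The number of legs at the lower vertex. The inner edge is one further input there, whence the
   arity [m.+1] in [prelie]. *)
pose wt (S : {set 'I_N}) : 'I_N.+1 := inord (N - #|S|).
have cardS (S : {set 'I_N}) : (#|S| <= N)%N by rewrite -[X in (_ <= X)%N]card_ord max_card.
have wtE S (m : 'I_N.+1) : (wt S == m) = (#|S| == N - m)%N.
  rewrite -val_eqE /= inordK; last by rewrite ltnS leq_subr.
  have := cardS S; have := ltn_ord m; move: #|S| (nat_of_ord m) => a b ? ?.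
  by apply/eqP/eqP; lia.
rewrite (partition_big wt xpredT) //=; apply: eq_bigr => m _.
rewrite (eq_bigr (fun=> T m)) => [|S]; last by rewrite wtE => /eqP; exact: ST.
rewrite sumr_const (_ : #|_| = 'C(N, N - m)); last first.
  rewrite -[N in 'C(N, _)]card_ord -card_draws; apply: eq_card => S.
  by rewrite !inE -wtE.
rewrite /T cls_ord_circ_sym -scaler_nat scalerA -natrM.
congr (_%:R *: _); have := bin_fact (leq_subr m N); rewrite subKn; last exact: ltnSE.
by move=> <-; rewrite [X in _ = (_ * X)%N]mulnC.
Qed.

Lemma cls_dif_sym p q (h : p + 1 = q) (phi : chat R p) N :
  cls (dif R h (sym_family phi 'I_N)) = (N`!)%:R *: lie_dif h phi N.
Proof.
rewrite (sym_familyE phi (bij_id _)) act_one /symmetrize (lin_sum (dif_lin h)).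
rewrite /lie_dif -cls_perm_sum /perm_sum; congr cls; apply: eq_bigr => s _.
exact: act_dif.
Qed.

Definition curvature (f : forall X : finType, R X 1) (X : finType) : R X 2 :=
  dif R (erefl : 1 + 1 = 2 :> int) (f X) + split_sum (erefl : 1 + 1 = 2 :> int) f X.

(** An invariant vanishes as soon as its class does, so the assumed invariance of the curvature lets
    the equation be tested in coinvariants. *)
Lemma maurer_cartan_curvature (phi : chat R 1) :
  (forall (X : finType) (e : bij X X),
    act R e (curvature (sym_family phi) X) = curvature (sym_family phi) X) ->
  maurer_cartan phi <-> forall N, curvature (sym_family phi) 'I_N = 0.
Proof.
move=> hinv.
have half (V : lmodType k) (x : V) : 2%:R^-1 *: (x + x) = x.
  by rewrite -mulr2n -scaler_nat scalerA mulVf ?scale1r ?natr_neq0.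
have E N : cls (curvature (sym_family phi) 'I_N) =
    (N`!)%:R *: (2%:R^-1 *: lie_bracket (erefl : 1 + 1 = 2) phi phi N +
                 lie_dif (erefl : 1 + 1 = 2) phi N).
  rewrite (linD (@cls_linear _ _)) cls_split_sum cls_dif_sym -scalerDr addrC; congr (_ *: (_ + _)).
  (* In degree 1 the commutator sign is -1, so the bracket of [phi] with itself is twice its pre-Lie
     square. *)
  rewrite /lie_bracket (Prop_irrelevance (etrans _ _) erefl) /ksign /= expr1 scaleN1r opprK.
  by rewrite half.
split=> [mc N|h N].
  by apply: invariant_cls0 => [s|]; rewrite ?hinv // E mc scaler0.
apply: (scalerI (natr_fact_neq0 N)); rewrite -E h scaler0; exact: lin0 (@cls_linear _ _).
Qed.
End Curvature.
End Coinvariants.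

(** * The convolution operad and the cobar construction *)

Lemma bij_invK (X Y : Type) (e : bij X Y) : bij_inv (bij_inv e) = e.
Proof. exact: bij_ext. Qed.

Section GradedMaps.
Variable k : fieldType.

Lemma ghom_eval_linear (V W : gspace k) p i j (e : i + p = j) (v : V i) :
  linear (fun f : ghom V W p => f i j e v).
Proof. by []. Qed.

Lemma ghom_cast (V W : gspace k) p (f : ghom V W p) i i' j (E : i = i') (e : i + p = j)
    (e' : i' + p = j) (v : V i) : f i' j e' (gcast E v) = f i j e v.
Proof. by case: i' / E e' => e'; rewrite (Prop_irrelevance e' e). Qed.

Lemma free_lift_trel2 (V W : gspace k) n (E : lmodType k) (f : tgen2 V W n -> E) :
  (forall i j (e : i + j = n) (w : W j), linear (fun v : V i => f (Tgen2 e v w))) ->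
  (forall i j (e : i + j = n) (v : V i), linear (fun w : W j => f (Tgen2 e v w))) ->
  forall u, trel2 u -> free_lift f u = 0.
Proof.
move=> fl fr _ [i j e a v v' w|i j e a v w w'];
  rewrite (linB (free_lift_linear f)) (free_lift_linear f) !free_lift_gen.
  by rewrite (fl i j e w a v v') subrr.
by rewrite (fr i j e v a w w') subrr.
Qed.
End GradedMaps.

Section ConvolutionOperad.
Variables (k : fieldType) (A : cooperad k) (P : operad k).
Let R := convolution A P.
Let HA : is_collection A := coop_collection (cooperadP A).
Let HP : is_operad P := operadP P.
Let HPc : is_collection P := op_collection HP.

Lemma conv_act_lin (X Y : finType) (e : bij X Y) i : linear (act R e : R Y i -> R X i).
Proof. by move=> a f g; apply: ghomP => m n h v /=; rewrite /conv_act_fun /= (act_linear HPc). Qed.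

Lemma conv_act_one (X : finType) i (u : R X i) : act R (bij_id X) u = u.
Proof.
apply: ghomP => m n h v /=; rewrite /conv_act_fun (act_id HPc).
by rewrite (_ : bij_inv _ = bij_id X) ?(act_id HA) //; exact: bij_ext.
Qed.

Lemma conv_act_mul (X Y Z : finType) (f : bij Y Z) (e : bij X Y) i (u : R Z i) :
  act R (Defs.bij_comp f e) u = act R e (act R f u).
Proof.
apply: ghomP => m n h v /=; rewrite /conv_act_fun /= /conv_act_fun (act_comp HPc) -(act_comp HA).
by rewrite (_ : bij_inv _ = Defs.bij_comp (bij_inv e) (bij_inv f)) //; exact: bij_ext.
Qed.

Lemma conv_dif_lin (X : finType) i j (h : i + 1 = j) : linear (dif R h : R X i -> R X j).
Proof.
move=> a f g; apply: ghomP => m n e v /=; rewrite /conv_dif_fun /=.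
rewrite (dif_linear HPc) scalerDr scalerBr opprD addrACA !scalerA.
by rewrite [ksign k i * a]mulrC.
Qed.

Lemma conv_act_dif (X Y : finType) (e : bij X Y) i j (h : i + 1 = j) (u : R Y i) :
  dif R h (act R e u) = act R e (dif R h u).
Proof.
apply: ghomP => m n e' v /=; rewrite /conv_dif_fun /= /conv_act_fun /= /conv_dif_fun.
rewrite (dif_act HPc) -(dif_act HA).
by rewrite (linB (act_linear HPc e (i:=n))) (linZ (act_linear HPc e (i:=n))).
Qed.

Lemma conv_circ_linl (X Y : finType) (x : X) i j n (h : i + j = n) (q : R Y j) :
  linear (fun p : R X i => circ R x h p q).
Proof.
move=> a f g; apply: ghomP => m l e v /=; rewrite /conv_circ_fun /=.
rewrite /plift /free_lift scaler_sumr -big_split; apply: eq_bigr => t _ /=.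
by rewrite (circ_linearl HP) !scalerDr !scalerA; congr (_ *: _ + _); ring.
Qed.

Lemma conv_circ_linr (X Y : finType) (x : X) i j n (h : i + j = n) (p : R X i) :
  linear (fun q : R Y j => circ R x h p q).
Proof.
move=> a f g; apply: ghomP => m l e v /=; rewrite /conv_circ_fun /=.
rewrite /plift /free_lift scaler_sumr -big_split; apply: eq_bigr => t _ /=.
by rewrite (circ_linearr HP) !scalerDr !scalerA; congr (_ *: _ + _); ring.
Qed.

Lemma conv_act_circ (X X' Y Y' : finType) (e : bij X X') (f : bij Y Y') (x : X)
    i j n (h : i + j = n) (p : R X' i) (q : R Y' j) :
  act R (bij_ins e f x) (circ R (e x) h p q) = circ R x h (act R e p) (act R f q).
Proof.
apply: ghomP => m l e' v /=; rewrite /conv_act_fun /=.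
set E := bij_ins e f x; set b := act A (bij_inv E) v.
(* Equivariance of [cocirc] speaks of elements of this form, and the action of [E] is invertible. *)
have -> : v = act A E b.
  rewrite /b -(act_comp HA) (_ : Defs.bij_comp _ _ = bij_id _) ?(act_id HA) //.
  by apply: bij_ext => y; exact: bfunK.
rewrite /conv_circ_fun (cocirc_act (cooperadP A)).
rewrite /tens2_act; set G := fun g : tgen2 (A X) (A Y) m => _.
have Gl a b' (E' : a + b' = m) (w : A Y b') : linear (fun v : A X a => G (Tgen2 E' v w)).
  move=> s u u'; rewrite /G /= /conv_act_fun (act_linear HA) ghom_linear (act_linear HPc).
  by rewrite (circ_linearl HP) scalerDr !scalerA mulrC.
have Gr a b' (E' : a + b' = m) (y : A X a) : linear (fun w : A Y b' => G (Tgen2 E' y w)).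
  move=> s u u'; rewrite /G /= /conv_act_fun (act_linear HA) ghom_linear (act_linear HPc).
  by rewrite (circ_linearr HP) scalerDr !scalerA mulrC.
rewrite [RHS](plift_comp _ _ (plift2_linear Gl Gr)) (plift_comp _ _ (act_linear HPc E (i:=l))).
congr plift; apply/funext => -[a b' E' u w] /=.
rewrite plift_gen; last exact: free_lift_trel2.
rewrite /G /= /conv_act_fun (linZ (act_linear HPc E (i:=l))) (circ_act HP).
have K (Z Z' : finType) (g : bij Z Z') c (y : A Z' c) : act A (bij_inv g) (act A g y) = y.
  rewrite -(act_comp HA) (_ : Defs.bij_comp _ _ = bij_id _) ?(act_id HA) //.
  by apply: bij_ext => z; exact: binvK.
by rewrite !K.
Qed.
End ConvolutionOperad.

Lemma shift_collection (k : fieldType) p (C : coldata k) :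
  is_collection C -> is_collection (shift p C).
Proof.
move=> HC; split=> /=.
- by move=> X Y e i a u v; exact: (act_linear HC).
- by move=> X i c; exact: (act_id HC).
- by move=> X Y Z f e i c; exact: (act_comp HC).
- by move=> X i j h a u v; rewrite (dif_linear HC) scalerDr !scalerA mulrC.
- move=> X i j l h h' c; rewrite (linZ (dif_linear HC _)) (dif_dif HC).
  by rewrite !scaler0.
by move=> X Y e i j h c; rewrite (dif_act HC) (linZ (act_linear HC e (i := _))).
Qed.

(** Both sides are corollas on [X] that differ only in the numbering of their half-edges; an
    isomorphism of one-vertex trees has trivial sign. *)
Lemma corolla_act (k : fieldType) (C : coldata k) (X Y : finType) (e : bij X Y) n (c : C Y n) :
  is_collection C -> corolla (act C e c) = free_act e (corolla c).
Proof.
move=> HC; rewrite free_act_gen.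
pose g := Defs.bij_comp (Defs.bij_comp (bij_inv (bij_enum Y)) e) (bij_enum X).
have gE (v : 'I_1) i : glue (relabel e (cor_tree Y)) v (g i) =
    sum_map id (bij_id 'I_1) (glue (cor_tree X) v i).
  by rewrite /= /relabel_glue /= /cor_glue /= enum_rankK bfunK.
pose s := @TreeIso X (cor_tree X) (relabel e (cor_tree Y)) (bij_id 'I_1) (fun=> g) erefl gE.
rewrite /corolla ((pgen_invariant C X n).2 (corolla_dt (act C e c))
  (relabel_dt e (corolla_dt c)) s).
  rewrite (iso_sign_list k s _ (perm_refl _)) (_ : map s _ = enum 'I_1) ?list_sign_sq ?scale1r //.
  exact: map_id.
move=> v; rewrite /tdec /tact /=; congr existT; rewrite -!(act_comp HC).
rewrite (_ : Defs.bij_comp (bij_enum Y) g = Defs.bij_comp e (bij_enum X)) //.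
by apply: bij_ext => x /=; rewrite enum_rankK.
Qed.

(** * The curvature as the obstruction to commuting with the differentials *)

Section Cobar.
Variables (k : fieldType) (A : cooperad k) (P : operad k) (d : cobar_dif A).
Let R := convolution A P.
Let C := shift 1 A.
Let HA : is_collection A := coop_collection (cooperadP A).
Let HC : is_collection C := shift_collection 1 HA.
Let HP : is_operad P := operadP P.
Let HPc : is_collection P := op_collection HP.

(** A degree 1 map on A read as a degree 0 map on A[1], whose part of degree i is that of A in
    degree i - 1. *)
Definition family_on_gen (F : forall X : finType, R X 1) (X : finType) i (a : C X i) : P X i :=
  (F X : ghom (A X) (P X) 1) (i - 1) i (subrK 1 i) a.

Section Extension.
Variables (F : forall X : finType, R X 1).
Variable G : forall (X : finType) i, free_car C X i -> P X i.
Hypothesis G_lin : forall X i, linear (@G X i).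
Hypothesis G_act : forall (X Y : finType) (e : bij X Y) i (c : free_car C Y i),
  G (free_act e c) = act P e (G c).
Hypothesis G_circ : forall (X Y : finType) (x : X) i j n (h : i + j = n)
    (p : free_car C X i) (q : free_car C Y j), G (free_circ x h p q) = circ P x h (G p) (G q).
Hypothesis G_corolla : forall (X : finType) i (a : C X i), G (corolla a) = family_on_gen F a.

Lemma ghom_linearZ (V W : gspace k) p (f : ghom V W p) i j (e : i + p = j) a (v : V i) :
  f i j e (a *: v) = a *: f i j e v.
Proof. exact: (linZ (@ghom_linear _ _ _ _ f i j e)). Qed.

Lemma G_susp (X : finType) i (a : A X i) :
  G (corolla (susp a)) = (F X : ghom (A X) (P X) 1) i (i + 1) erefl a.
Proof. by rewrite G_corolla /family_on_gen /susp (ghom_cast _ _ erefl). Qed.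

(** The minus sign is the quotient of the sign (-1)^(|a'| + 1) in the cobar differential by the
    Koszul sign (-1)^|a'| of evaluating two maps of degree 1 on a tensor. *)
Lemma G_two_vertex (X : finType) n m (h : n + 1 = m) (a : C X n) (e : n - 1 + 2 = m) :
  G (two_vertex h a) =
  - (split_sum (erefl : 1 + 1 = 2 :> int) F X : ghom (A X) (P X) 2) (n - 1) m e a.
Proof.
rewrite /two_vertex /split_sum (lin_sum (@G_lin X m)).
rewrite (lin_sum (ghom_eval_linear e a)) -sumrN; apply: eq_bigr => S _.
rewrite (plift_comp _ _ (@G_lin X m)) /= /conv_act_fun /= bij_invK.
set e' := bij_inv (bij_cut S).
rewrite /conv_circ_fun (plift_comp _ _ (act_linear HPc e' (i:=m))).
rewrite (plift_comp (g := fun x => - x)); last by move=> b u v; rewrite opprD scalerN.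
congr plift; apply/funext => -[i j E v w] /=.
rewrite (linZ (@G_lin X m)) G_act G_circ !G_susp (linZ (act_linear HPc e' (i:=m))).
by rewrite ksignS mul1r scaleNr; congr (- (_ *: act P _ (circ P _ _ _ _))); exact: Prop_irrelevance.
Qed.

(** As F has degree 1, its differential is d F + F d. The second term arises because the
    differential of A[1] is minus that of A, and the quadratic term because of the sign in
    [G_two_vertex]. *)
Lemma curvature_corolla (X : finType) n m (h : n + 1 = m) (a : C X n) (e : n - 1 + 2 = m) :
  (curvature F X : ghom (A X) (P X) 2) (n - 1) m e a =
  dif P h (G (corolla a)) - G (d X n m h (corolla a)).
Proof.
(* The intermediate degree is made a variable so that the equation defining it can be eliminated. *)
have dP q (E : n - 1 + 1 = q) (h' : q + 1 = m) :
    dif P h' ((F X : ghom (A X) (P X) 1) (n - 1) q E a) =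
    dif P (deg_next (erefl : 1 + 1 = 2) e) ((F X : ghom (A X) (P X) 1) (n - 1) _ erefl a).
  by case: q / E h' => h'; congr (dif P _ _); exact: Prop_irrelevance.
have dA q (E : n - 1 + 1 = q) (h' : q + 1 = m) :
    (F X : ghom (A X) (P X) 1) q m h' (dif A E a) =
    (F X : ghom (A X) (P X) 1) _ m (deg_prev (erefl : 1 + 1 = 2) e) (dif A erefl a).
  by case: q / E h' => h'; rewrite (Prop_irrelevance h' (deg_prev (erefl : 1 + 1 = 2) e)).
rewrite (cd_corolla d) (linD (@G_lin X m)) (G_two_vertex _ _ e) opprB !G_corolla.
rewrite /family_on_gen dP /curvature [LHS]/= /conv_dif_fun -[LHS]addrA; congr (_ + _).
by rewrite addrC; congr (_ - _); rewrite /= ghom_linearZ [in RHS]dA.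
Qed.

(** Naturality is read off from [curvature_corolla]: corollas, [G] and both differentials commute
    with relabelling. *)
Lemma curvature_act (X Y : finType) (e : bij X Y) :
  act R e (curvature F Y) = curvature F X.
Proof.
apply: ghomP => i m h a.
have [n E] : exists n, i = n - 1 by exists (i + 1); rewrite addrK.
subst i; have h' : n + 1 = m by rewrite -h; ring.
rewrite [RHS](curvature_corolla h').
rewrite -[LHS]/(act P e ((curvature F Y : ghom (A Y) (P Y) 2) (n - 1) m h (act A (bij_inv e) a))).
rewrite (curvature_corolla h').
rewrite (linB (act_linear HPc e (i:=m))) -(dif_act HPc) -!G_act.
have aE : act C e (act A (bij_inv e) a : C Y n) = a.
  rewrite -(act_comp HC) (_ : Defs.bij_comp _ _ = bij_id _) ?(act_id HC) //.
  by apply: bij_ext => x /=; rewrite bfunK.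
by rewrite -(cd_act d) -!(corolla_act _ _ HC) aE.
Qed.

(** Naturality spreads the vanishing from ['I_N] to all finite sets, which settles corollas. Both
    differentials are derivations, so agreement propagates through [free_ind]. *)
Lemma dif_extension :
  (forall N, curvature F 'I_N = 0) <->
  (forall X i j (h : i + 1 = j) (c : free_car C X i), G (d X i j h c) = dif P h (G c)).
Proof.
split=> [F0|GD N]; last first.
  apply: ghomP => i m h a.
  have [n E] : exists n, i = n - 1 by exists (i + 1); rewrite addrK.
  subst i; have h' : n + 1 = m by rewrite -h; ring.
  by rewrite (curvature_corolla h') GD subrr.
have curv0 X : curvature F X = 0.
  rewrite -(curvature_act (bij_inv (bij_enum X))) F0.
  exact: lin0 (@conv_act_lin _ A P _ _ _ _).
move=> X i j h c; move: j h.
elim/(free_ind HC): c => {X i}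
  [X n|X n a u v hu hv|X Y e n u hu|X Y x i j n h p q hp hq|X n a] m h'.
- by rewrite !(lin0 (@G_lin _ _), lin0 (@cd_linear _ _ d _ _ _ _), lin0 (dif_linear HPc _)).
- by rewrite (cd_linear d) !(@G_lin _ _) (dif_linear HPc) hu hv.
- by rewrite (cd_act d) !G_act (dif_act HPc) hu.
- have hl : i + 1 + j = m by rewrite -h' -h addrAC.
  have hr : i + (j + 1) = m by rewrite -h' -h addrA.
  rewrite (cd_circ d x h erefl erefl h' hl hr) (linD (@G_lin _ _)) (linZ (@G_lin _ _)) !G_circ.
  by rewrite (dif_circ HP x h erefl erefl h' hl hr) hp hq.
have e : n - 1 + 2 = m by rewrite -h'; ring.
by have := curvature_corolla h' a e; rewrite curv0 => /esym/subr0_eq.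
Qed.
End Extension.
End Cobar.

(** * The bijection between Maurer-Cartan elements and morphisms *)

Section Correspondence.
Variables (k : fieldType) (A : cooperad k) (P : operad k) (d : cobar_dif A).
Hypothesis char0 : [pchar k] =i pred0.
Let R := convolution A P.
Let C := shift 1 A.
Let HA : is_collection A := coop_collection (cooperadP A).
Let HC : is_collection C := shift_collection 1 HA.
Let HP : is_operad P := operadP P.
Let HPc : is_collection P := op_collection HP.

Let actL := @conv_act_lin k A P.
Let actM := @conv_act_mul k A P.

(** Here [G] is any extension of the family: the evaluation map in one direction of the
    correspondence, a given morphism in the other. *)
Lemma maurer_cartan_dif (phi : chat R 1) (G : forall (X : finType) i, free_car C X i -> P X i) :
  (forall X i, linear (@G X i)) ->
  (forall (X Y : finType) (e : bij X Y) i (c : free_car C Y i),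
    G X i (free_act e c) = act P e (G Y i c)) ->
  (forall (X Y : finType) (x : X) i j n (h : i + j = n) (p : free_car C X i) (q : free_car C Y j),
    G _ n (free_circ x h p q) = circ P x h (G X i p) (G Y j q)) ->
  (forall (X : finType) i (a : C X i), G X i (corolla a) = family_on_gen (sym_family phi) a) ->
  maurer_cartan phi <->
  (forall X i j (h : i + 1 = j) (c : free_car C X i), G X j (d X i j h c) = dif P h (G X i c)).
Proof.
move=> Gl Ga Gc Gcor; rewrite -(dif_extension d Gl Ga Gc Gcor).
apply: maurer_cartan_curvature => //.
- exact: conv_act_one.
- exact: conv_dif_lin.
- exact: conv_act_dif.
- exact: conv_circ_linl.
- exact: conv_circ_linr.
- exact: conv_act_circ.
by move=> X e; exact: (curvature_act d Gl Ga Gc Gcor e).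
Qed.

Section FromMaurerCartan.
Variable phi : chat R 1.
Let f X i (a : C X i) : P X i := @family_on_gen k A P (sym_family phi) X i a.

Let f_lin X i : linear (@f X i).
Proof. by move=> a u v; rewrite /f /family_on_gen ghom_linear. Qed.

Let f_act (X Y : finType) (e : bij X Y) i (c : C Y i) : f (act C e c) = act P e (f c).
Proof.
rewrite /f /family_on_gen -(sym_family_act actL actM phi e).
rewrite -[LHS]/(act P e ((sym_family phi Y : ghom (A Y) (P Y) 1) _ _ (subrK 1 i)
  (act A (bij_inv e) (act A e (c : A Y (i - 1)))))).
rewrite -(act_comp HA) (_ : Defs.bij_comp _ _ = bij_id _) ?(act_id HA) //.
by apply: bij_ext => x; exact: binvK.
Qed.

Let eval X i : free_car C X i -> P X i := @free_eval k C P f X i.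

Let eval_corolla (X : finType) i (a : C X i) : eval (corolla a) = family_on_gen (sym_family phi) a.
Proof. exact: (free_eval_corolla HP f_lin f_act). Qed.

Let eval_dif (mc : maurer_cartan phi) X i j (h : i + 1 = j) (c : free_car C X i) :
  eval (d X i j h c) = dif P h (eval c).
Proof.
apply: (proj1 (@maurer_cartan_dif phi eval _ _ _ eval_corolla) mc).
- exact: (free_eval_linear HP f_lin f_act).
- exact: (free_eval_act HP f_lin f_act).
- exact: (free_eval_circ HP f_lin f_act).
Qed.

Definition mc_hom (mc : maurer_cartan phi) : ophom (cobar d) P :=
  @OpHom k (cobar d) P eval (free_eval_linear HP f_lin f_act) (free_eval_act HP f_lin f_act)
    (free_eval_circ HP f_lin f_act) (eval_dif mc).

Lemma mc_hom_corolla mc (X : finType) i (a : C X i) :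
  mc_hom mc X i (corolla a : cobar d X i) = family_on_gen (sym_family phi) a.
Proof. exact: eval_corolla. Qed.
End FromMaurerCartan.

Lemma ophom_ext (G G' : ophom (cobar d) P) :
  (forall (X : finType) i (a : C X i),
    G X i (corolla a : cobar d X i) = G' X i (corolla a : cobar d X i)) -> G = G'.
Proof.
move=> h; have E X i (u : free_car C X i) : G X i u = G' X i u.
  elim/(free_ind HC): u => {X i} [X n|X n a u v hu hv|X Y e n u hu|X Y x i j n e p q hp hq|X n a].
  - by rewrite (lin0 (oh_linear G (X := X) (i := n))) (lin0 (oh_linear G' (X := X) (i := n))).
  - by rewrite (oh_linear G a u v) (oh_linear G' a u v) hu hv.
  - by rewrite (oh_act G e u) (oh_act G' e u) hu.
  - by rewrite (oh_circ G x e p q) (oh_circ G' x e p q) hp hq.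
  exact: h.
case: G G' {h} E => [g g1 g2 g3 g4] [g' g1' g2' g3' g4'] /= E.
have gE : g = g'.
  by do 2![apply: functional_extensionality_dep => ?]; apply/funext => u; exact: E.
by subst g'; congr OpHom; exact: Prop_irrelevance.
Qed.

Section FromHom.
Variable G : ophom (cobar d) P.

Lemma corolla_linear (X : finType) i : linear (fun a : C X i => corolla a).
Proof.
move=> a u v; apply: ((pgen_invariant C X i).1 (cor_tree X) _ _ _ _ _ _ _ ord0) => [w|].
  by rewrite (ord1 w).
exact: (act_linear HC).
Qed.

Lemma deg_unshift (i j : int) : i + 1 = j -> i = j - 1.
Proof. by move=> <-; rewrite addrK. Qed.

Definition on_corollas_fun (X : finType) i j (e : i + 1 = j) (a : A X i) : P X j :=
  G X j (corolla (gcast (deg_unshift e) a : C X j) : cobar d X j).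

Lemma on_corollas_linear (X : finType) i j (e : i + 1 = j) : linear (@on_corollas_fun X i j e).
Proof.
move=> a u v; rewrite /on_corollas_fun.
have -> : gcast (deg_unshift e) (a *: u + v) =
    a *: gcast (deg_unshift e) u + gcast (deg_unshift e) v :> A X (j - 1).
  by case: _ / (deg_unshift e).
rewrite -(oh_linear G); congr (oh_fun _ _); exact: corolla_linear.
Qed.

Definition on_corollas (X : finType) : R X 1 := Ghom (@on_corollas_linear X).

Lemma on_corollasE (X : finType) i (a : C X i) :
  family_on_gen on_corollas a = G X i (corolla a : cobar d X i).
Proof.
rewrite /family_on_gen /= /on_corollas_fun.
by rewrite (Prop_irrelevance (deg_unshift _) erefl).
Qed.

Lemma on_corollas_act (X Y : finType) (e : bij X Y) : act R e (on_corollas Y) = on_corollas X.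
Proof.
apply: ghomP => i j h a; have E := deg_unshift h; subst i.
rewrite (Prop_irrelevance h (subrK 1 j)).
rewrite -[RHS]/(family_on_gen on_corollas (a : C X j)) on_corollasE.
rewrite -[LHS]/(act P e (family_on_gen on_corollas (act A (bij_inv e) a : C Y j))) on_corollasE.
rewrite -(oh_act G e); congr (oh_fun _ _); rewrite -[LHS](corolla_act e _ HC); congr corolla.
rewrite -[LHS](act_comp HA) (_ : Defs.bij_comp _ _ = bij_id _) ?(act_id HA) //.
by apply: bij_ext => x; exact: bfunK.
Qed.

(** The factor compensates for the n! by which symmetrization multiplies an invariant. *)
Definition hom_mc : chat R 1 := fun n => (n`!)%:R^-1 *: cls (on_corollas 'I_n).

Lemma symmetrize_hom_mc n : symmetrize (hom_mc n) = on_corollas 'I_n.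
Proof. by apply: (symmetrize_surj char0 actL actM) => s; exact: on_corollas_act. Qed.

Lemma sym_family_hom_mc : sym_family hom_mc = on_corollas.
Proof.
apply: functional_extensionality_dep => X.
by rewrite /sym_family symmetrize_hom_mc on_corollas_act.
Qed.

Lemma hom_mc_maurer_cartan : maurer_cartan hom_mc.
Proof.
apply: (proj2 (@maurer_cartan_dif hom_mc G _ _ _ _)).
- exact: (oh_linear G).
- exact: (oh_act G).
- exact: (oh_circ G).
- by move=> X i a; rewrite sym_family_hom_mc on_corollasE.
exact: (oh_dif G).
Qed.
End FromHom.
End Correspondence.

Theorem theorem5p1 (k : fieldType) (char0 : [pchar k] =i pred0)
    (A : cooperad k) (P : operad k) (d : cobar_dif A) :
  exists Phi : {phi : chat (convolution A P) 1 | maurer_cartan phi} ->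
               ophom (cobar d) P,
    bijective Phi /\
    forall (phi : {phi : chat (convolution A P) 1 | maurer_cartan phi})
           (n : nat) (i : int) (a : shift 1 A 'I_n i),
      oh_fun (Phi phi) (corolla a : cobar d 'I_n i) =
      (symmetrize (sval phi n) : ghom (A 'I_n) (P 'I_n) 1) (i - 1) i (subrK 1 i) a.
Proof.
have sym_ord (phi : chat (convolution A P) 1) n : sym_family phi 'I_n = symmetrize (phi n).
  rewrite (sym_familyE (@conv_act_lin k A P) (@conv_act_mul k A P) phi (bij_id 'I_n)).
  exact: conv_act_one.
exists (fun phi => mc_hom d char0 (svalP phi)); split; last first.
  by move=> phi n i a; rewrite mc_hom_corolla /family_on_gen sym_ord.
(* The inverse restricts a morphism to corollas and takes normalized classes. *)
exists (fun G => exist _ (hom_mc G) (hom_mc_maurer_cartan char0 G)) => [phi|G].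
  (* Only the underlying elements need comparing, and these are determined by their symmetrizations,
     that is, by the values on corollas. *)
  apply: (eq_sig_hprop (fun _ => @Prop_irrelevance _)) => /=.
  apply: functional_extensionality_dep => n.
  apply: (symmetrize_inj char0 (@conv_act_lin k A P) (@conv_act_mul k A P)).
  rewrite symmetrize_hom_mc // -sym_ord; apply: ghomP => i j h a.
  have E := deg_unshift h; subst i; rewrite (Prop_irrelevance h (subrK 1 j)).
  rewrite -[LHS]/(family_on_gen (on_corollas _) (a : shift 1 A 'I_n j)).
  by rewrite on_corollasE mc_hom_corolla.
apply: ophom_ext => X i a.
by rewrite mc_hom_corolla /= sym_family_hom_mc // on_corollasE.
Qed.
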